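(* Let $\Phi$ be a symmetric norming function and $\mathfrak{I}=\mathfrak{S}_{\Phi}$. Let $P:\mathfrak{I}\to\mathfrak{I}$, $P(x)=\sum_{i=1}^{w}p_ixp_i$, be the pinching operator associated with a family $\{p_i\}_1^w$ $(1\le w\le\infty)$ of mutually orthogonal hermitian projections on $\mathcal{H}$, and let $p_0=1-\sum_{i=1}^{w}p_i$. If $\mathfrak{I}\ne\mathfrak{K}$ (where $\mathfrak{K}$ is the ideal of compact operators), assume in addition that $w<\infty$ and there is only one infinite rank projection in the family $\{p_i\}_0^w$. Then the map $$\Pi:\mathcal{U}_{\mathfrak{I}}(P)\longrightarrow\mathcal{O}_{\mathfrak{I}}(P),\qquad \Pi(L_uPL_{u^*})=Ad_u\,P\,Ad_{u^*}\quad(u\in\mathcal{U}_{\mathfrak{I}}),$$ is a covering map, when $\mathcal{U}_{\mathfrak{I}}(P)$ is considered with the topology inherited from $\mathcal{B}(\mathfrak{I})$ and $\mathcal{O}_{\mathfrak{I}}(P)$ with the quotient topology.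
   Context: $\mathcal{H}$ is an infinite dimensional separable Hilbert space and $\mathcal{B}(\mathcal{H})$ the bounded operators on it with the operator norm $\|\cdot\|$. Let $\hat c$ be the real vector space of real sequences with finitely many nonzero terms. A symmetric norming function is a norm $\Phi:\hat c\to\mathbb{R}$ with $\Phi(1,0,0,\dots)=1$ and $\Phi(a_1,\dots,a_n,0,\dots)=\Phi(|a_{j_1}|,\dots,|a_{j_n}|,0,\dots)$ for every permutation $j_1,\dots,j_n$ of $1,\dots,n$, $n\geq 1$. For a compact operator $x$ with singular values $s_1(x)\ge s_2(x)\ge\cdots$, put $\|x\|_\Phi=\sup_{k\geq 1}\Phi(s_1(x),\dots,s_k(x),0,\dots)\in[0,\infty]$. Then $\mathfrak{S}_\Phi=\{x\text{ compact}:\|x\|_\Phi<\infty\}$ is a Banach space and a two-sided ideal; write $\mathfrak{I}=\mathfrak{S}_\Phi$ and $\|\cdot\|_{\mathfrak{I}}=\|\cdot\|_\Phi$. $\mathcal{U}_{\mathfrak{I}}=\{u\text{ unitary on }\mathcal{H}:u-1\in\mathfrak{I}\}$ is a topological group with the metric $\|u_1-u_2\|_{\mathfrak{I}}$. If $w=\infty$, the index $i$ runs over all positive integers, $\sum_i p_i$ converges strongly and $\sum_i p_ixp_i$ converges in operator norm for $x$ compact. The projection $p_0$ may be zero. $\mathcal{B}(\mathfrak{I})$ is the Banach algebra of bounded operators on $\mathfrak{I}$ with the usual operator norm. For $x\in\mathcal{B}(\mathcal{H})$, $L_x:\mathfrak{I}\to\mathfrak{I}$, $L_x(y)=xy$;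 for $u\in\mathcal{U}_{\mathfrak{I}}$, $Ad_u:\mathfrak{I}\to\mathfrak{I}$, $Ad_u(x)=uxu^*$. The orbits are $\mathcal{U}_{\mathfrak{I}}(P)=\{L_uPL_{u^*}:u\in\mathcal{U}_{\mathfrak{I}}\}$ and $\mathcal{O}_{\mathfrak{I}}(P)=\{Ad_uPAd_{u^*}:u\in\mathcal{U}_{\mathfrak{I}}\}$. The quotient topology on $\mathcal{O}_{\mathfrak{I}}(P)$ comes from the identification $\mathcal{O}_{\mathfrak{I}}(P)\simeq\mathcal{U}_{\mathfrak{I}}/H$, where $H=\{u\in\mathcal{U}_{\mathfrak{I}}:Ad_uPAd_{u^*}=P\}$. *)

(* Defs.v *)
From HB Require Import structures.
From mathcomp Require Import all_boot all_order all_algebra.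
From mathcomp Require Import sesquilinear generic_quotient complex.
From mathcomp Require Import all_classical all_reals all_analysis.

Set Implicit Arguments.
Unset Strict Implicit.
Unset Printing Implicit Defensive.

Import Order.TTheory GRing.Theory Num.Theory.
Import numFieldNormedType.Exports.

Local Open Scope classical_set_scope.
Local Open Scope complex_scope.
Local Open Scope ring_scope.

(** * Topologies *)

(* [T] with the topology whose neighborhoods of [x] are generated by the balls
   [{y | d x y < e}]; used below for metrics only. *)
Definition edist_space (R : realType) (T : Type) (d : T -> T -> \bar R) : Type :=
  T.

Section EdistSpace.
Context {R : realType} {T : Type} {d : T -> T -> \bar R}.
Local Notation X := (edist_space d).

HB.instance Definition _ := gen_eqMixin X.
HB.instance Definition _ := gen_choiceMixin X.

Definition edist_open : set (set X) := [set A | forall x, A x ->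
  exists2 e : R, 0 < e & [set y | (d x y < e%:E)%E] `<=` A].

Let openT : edist_open setT.
Proof. by move=> x _; exists 1. Qed.

Let openI : setI_closed edist_open.
Proof.
move=> A B oA oB x [/oA[e e0 Ae] /oB[e' e0' Be']].
exists (Num.min e e'); first by rewrite lt_min e0.
move=> y /=; rewrite EFin_min lt_min => /andP[ye ye'].
by split; [exact: Ae|exact: Be'].
Qed.

Let open_bigU (I : Type) (f : I -> set X) :
  (forall i, edist_open (f i)) -> edist_open (\bigcup_i f i).
Proof.
move=> of_ x [i _ /of_[e e0 fe]]; exists e => // y /fe fy; by exists i.
Qed.

HB.instance Definition _ := isOpenTopological.Build X openT openI open_bigU.
End EdistSpace.

(* [range f] as a quotient of the domain of [f]; [quotient_topology] then
   provides the quotient topology. *)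
Definition to_range (X Y : Type) (f : X -> Y) (x : X) : set_type (range f) :=
  exist _ (f x) (mem_set (imageT f x)).

Definition range_quot (X Y : Type) (f : X -> Y) : Type := set_type (range f).

Section RangeQuot.
Context {X Y : Type} {f : X -> Y}.

Let range_repr (z : range_quot f) : X :=
  projT1 (cid2 (set_mem (projT2 z))).

Let range_reprK : cancel range_repr (to_range f : X -> range_quot f).
Proof.
move=> z; apply/val_inj; rewrite /= /range_repr.
by case: cid2 => x /= _ ->.
Qed.

HB.instance Definition _ := isQuotient.Build X (range_quot f) range_reprK.
End RangeQuot.

Definition homeomorphism_on (X Y : topologicalType) (V : set X) (U : set Y)
    (f : X -> Y) : Prop :=
  exists g : Y -> X,
    [/\ forall x, V x -> U (f x) /\ g (f x) = x,
        forall y, U y -> V (g y) /\ f (g y) = y,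
        {within V, continuous f} &
        {within U, continuous g}].

Definition covering_map (X Y : topologicalType) (f : X -> Y) : Prop :=
  [/\ continuous f,
      range f = setT &
      forall y, exists U : set Y, open_nbhs y U /\
        exists (J : Type) (V : J -> set X),
          [/\ forall j, open (V j),
              trivIset setT V,
              f @^-1` U = \bigcup_j V j &
              forall j, homeomorphism_on (V j) U f]].

(** * Linear algebra and Hilbert spaces *)

Definition has_dim (K : numFieldType) (V : lmodType K) (S : set V) (n : nat) :
    Prop :=
  exists e : 'I_n -> V, (forall i, S (e i)) /\
    forall v, S v -> exists! c : {ffun 'I_n -> K}, v = \sum_i c i *: e i.

Definition finite_dim (K : numFieldType) (V : lmodType K) (S : set V) : Prop :=
  exists n, has_dim S n.

(* The norm of a normed module over [R[i]] is [R[i]]-valued. *)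
Definition rnorm (R : realType) (H : normedModType R[i]) (h : H) : R :=
  complex.Re `|h|.

Definition separable_space (T : topologicalType) : Prop :=
  exists D : set T, countable D /\ dense D.

Section Operators.
Context {R : realType} {H : completeNormedModType R[i]}.

Definition bounded_op (x : H -> H) : Prop := linear x /\ continuous x.

Definition op_norm (x : H -> H) : \bar R :=
  ereal_sup [set (rnorm (x h))%:E | h in [set h : H | rnorm h <= 1]].

Definition compact_op : set (H -> H) := [set x |
  bounded_op x /\ precompact (x @` [set h : H | rnorm h <= 1])].

Definition infinite_rank (x : H -> H) : Prop := ~ finite_dim (range x).

Variable ip : {dot H for Num.conj}.

Definition adj (x : H -> H) : H -> H :=
  xget 0 [set y | bounded_op y /\ forall a b, ip (x a) b = ip a (y b)].

Definition unitary_op (u : H -> H) : Prop :=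
  [/\ bounded_op u, adj u \o u = id & u \o adj u = id].

Definition hermitian_projection (p : H -> H) : Prop :=
  [/\ bounded_op p, p \o p = p & adj p = p].

(* The singular values are the square roots of the eigenvalues of [x^* x], in
   decreasing order, repeated according to multiplicity and completed by zeros;
   [s k] is the (k+1)-st one. *)
Definition is_singular_values (x : H -> H) (s : nat -> R) : Prop :=
  [/\ forall k, 0 <= s k,
      {homo s : j k / (j <= k)%N >-> k <= j} &
      forall l : R, 0 < l -> exists n,
        ([set k | s k = l] #= `I_n)%card /\
        has_dim [set h : H | adj x (x h) = (l ^+ 2)%:C *: h] n].

Definition singular_value (x : H -> H) : nat -> R :=
  xget (cst 0) [set s | is_singular_values x s].

End Operators.

(** * Symmetrically normed ideals *)

Definition c_hat (R : realType) : set (nat -> R) :=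
  [set a | exists n, forall k, (n <= k)%N -> a k = 0].

(* Only the values of [Phi] on [c_hat] matter; [nth 0 s] is the sequence
   [(s_1, ..., s_n, 0, 0, ...)]. *)
Record symmetric_norming (R : realType) (Phi : (nat -> R) -> R) : Prop := {
  sn_ge0 : forall a, c_hat a -> 0 <= Phi a ;
  sn_eq0 : forall a, c_hat a -> Phi a = 0 -> a = 0 ;
  sn_scale : forall t a, c_hat a -> Phi (fun k => t * a k) = `|t| * Phi a ;
  sn_triangle : forall a b, c_hat a -> c_hat b -> Phi (a + b) <= Phi a + Phi b ;
  sn_normalized : Phi (nth 0 [:: 1]) = 1 ;
  sn_symmetric : forall s t : seq R, perm_eq s t ->
    Phi (nth 0 s) = Phi (nth 0 [seq `|a| | a <- t]) }.

Section Ideal.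
Context {R : realType} {H : completeNormedModType R[i]}.
Variables (ip : {dot H for Num.conj}) (Phi : (nat -> R) -> R).

Definition Phi_norm (x : H -> H) : \bar R :=
  if `[< compact_op x >] then
    ereal_sup [set (Phi (nth 0 (mkseq (singular_value ip x) k)))%:E
              | k in [set k | (1 <= k)%N]]
  else +oo%E.

Definition S_Phi : set (H -> H) :=
  [set x | compact_op x /\ (Phi_norm x < +oo)%E].

(* [S_Phi] is a two-sided ideal, so that for bounded [x] the default value of
   [insubd] is never used. *)
Definition Lmul (x : H -> H) (y : S_Phi) : S_Phi :=
  insubd y (x \o set_val y).

Definition Ad (u : H -> H) (y : S_Phi) : S_Phi :=
  insubd y (u \o set_val y \o adj ip u).

Definition U_dist (u v : H -> H) : \bar R := Phi_norm (u - v).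

Definition U_I : set (edist_space U_dist) :=
  [set u : H -> H | unitary_op ip u /\ S_Phi (u - id)].

(* The operator norm of [S - T]. The topology it defines restricts to the norm
   topology on the bounded operators on [S_Phi]. *)
Definition B_dist (S T : S_Phi -> S_Phi) : \bar R :=
  ereal_sup [set Phi_norm (set_val (S x) - set_val (T x))
            | x in [set x : S_Phi | (Phi_norm (set_val x) <= 1)%E]].

Section Orbits.
Variable P : S_Phi -> S_Phi.

Definition left_act (u : U_I) : edist_space B_dist :=
  Lmul (set_val u) \o P \o Lmul (adj ip (set_val u)).

Definition Ad_act (u : U_I) : S_Phi -> S_Phi :=
  Ad (set_val u) \o P \o Ad (adj ip (set_val u)).

Definition left_orbit : topologicalType := set_type (range left_act).

Definition Ad_orbit : topologicalType := quotient_topology (range_quot Ad_act).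

Definition left_orbit_map : U_I -> left_orbit := to_range left_act.

Definition Ad_orbit_map : U_I -> Ad_orbit := to_range Ad_act.

End Orbits.
End Ideal.

Arguments S_Phi {R H} ip Phi.
Arguments U_I {R H} ip Phi.

(** * Pinching operators *)

(* [w = None] stands for an infinite family. *)
Definition in_family (w : option nat) (i : nat) : bool :=
  (1 <= i)%N && (if w is Some m then (i <= m)%N else true).

Section Pinching.
Context {R : realType} {H : completeNormedModType R[i]}.
Variables (ip : {dot H for Num.conj}) (Phi : (nat -> R) -> R).
Variables (w : option nat) (p : nat -> H -> H).

Definition orthogonal_projections : Prop :=
  (forall i, in_family w i -> hermitian_projection ip (p i)) /\
  (forall i j, in_family w i -> in_family w j -> i <> j -> p i \o p j = 0).

(* [p 0 = 1 - sum_i p i], the sum being strongly convergent; if the family is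
   finite the partial sums are eventually constant, and likewise below. *)
Definition complement_projection : Prop := forall h,
  (\sum_(1 <= i < n.+1 | in_family w i) p i h) @[n --> \oo] --> h - p 0%N h.

Definition is_pinching (P : S_Phi ip Phi -> S_Phi ip Phi) : Prop :=
  forall x : S_Phi ip Phi,
  op_norm (set_val (P x) -
    \sum_(1 <= i < n.+1 | in_family w i) (p i \o set_val x \o p i))
    @[n --> \oo] --> 0%E.

End Pinching.

(* Main.v *)
(* The unitary group [U_I] acts on both orbits, and [Pi] is equivariant. If
   [Ad_u] fixes [P] and [|u - 1| < 1], then [u] permutes the ranges of the [p_i],
   and being close to [1] it commutes with every [p_i], so that [L_u] fixes [P]
   too. Hence the stabilizer of [P] in the left orbit is open in its stabilizer
   [H] in the other one, and [U_I / K -> U_I / H] is a covering map. It remains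
   to identify the norm topology of the left orbit with the quotient topology of
   [U_I / K]. If [L_u P L_u^-1] is close to [P], then [v = u c], with [c] the
   block diagonal part of [u^*], is close to [1] in operator norm, and
   [g = v |v|^(-1)] differs from [u] by a unitary that commutes with the [p_i],
   so that [L_g P L_g^-1 = L_u P L_u^-1]. Either the norm of the ideal is
   equivalent to the operator norm, or all the [p_i] but one have finite rank and
   [v - 1] has bounded rank; in both cases [g] is close to [1] in the ideal.
   Singular values are used through their description as approximation
   numbers. *)
Require Import Defs.
From mathcomp Require Import finmap.
From HB Require Import structures.
From mathcomp Require Import all_boot all_order all_algebra.
From mathcomp Require Import sesquilinear generic_quotient complex.
From mathcomp Require Import all_classical all_reals all_analysis.
From mathcomp Require Import ring lra zify.

Set Implicit Arguments.
Unset Strict Implicit.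
Unset Printing Implicit Defensive.

Import Order.TTheory GRing.Theory Num.Theory.
Import numFieldNormedType.Exports.

Local Open Scope classical_set_scope.
Local Open Scope complex_scope.
Local Open Scope ring_scope.

(** * Hilbert space operators *)

(** [P] acts on operators of the ideal only, so the closeness of L_u P L_u^-1 to [P] is exploited
    through test operators whose ideal norm does not depend on the vector at hand. These are the
    projections on the span of p_1 h, ..., p_n h: they have rank at most n and norm at most Phi (1,
    ..., 1), which stays bounded either because the ideal is that of the compact operators or
    because the family is finite. The hypothesis on the family is used a second time, to turn
    operator norm estimates into ideal norm estimates.

    The block of p_0 is annihilated by [P]; the corners of u next to it are controlled through u^-1
    and adjoints instead.

    The triangle inequality of the ideal norm is proved with a factor 2. Hence the topologies are
    handled with a quasi-triangle inequality, radii are divided by 4, and a small neighborhood of 1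
    is the interior of a ball rather than a ball.

    Identities between operators are checked block by block with [proj_ext], which replaces
    manipulations of infinite sums. The covering argument uses right translations only, so no joint
    continuity of the multiplication is established. *)

Section Hilbert.
Context {R : realType} {H : completeNormedModType R[i]}.
Implicit Types (a b h : H) (c : R[i]) (r : R).
Local Notation N := (@rnorm R H).

Lemma rnormE h : `|h| = (N h)%:C.
Proof. by rewrite /rnorm RRe_real // normr_real. Qed.

Lemma rnorm_ge0 h : 0 <= N h.
Proof. by rewrite -ler0c -rnormE. Qed.

Lemma rnorm0 : N 0 = 0.
Proof. by apply: complexI; rewrite -rnormE normr0. Qed.

Lemma rnorm_eq0 h : N h = 0 -> h = 0.
Proof. by move=> h0; apply/eqP; rewrite -normr_eq0 rnormE h0. Qed.

Lemma rnorm_gt0 h : h != 0 -> 0 < N h.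
Proof.
move=> h0; rewrite lt_neqAle rnorm_ge0 andbT eq_sym.
by apply: contraNneq h0 => /rnorm_eq0 ->.
Qed.

Lemma rnormD a b : N (a + b) <= N a + N b.
Proof. by rewrite -lecR rmorphD /= -!rnormE ler_normD. Qed.

Lemma rnormN a : N (- a) = N a.
Proof. by apply: complexI; rewrite -!rnormE normrN. Qed.

Lemma rnormB a b : N (a - b) <= N a + N b.
Proof. by rewrite -(rnormN b) rnormD. Qed.

Lemma rdistC a b : N (a - b) = N (b - a).
Proof. by rewrite -rnormN opprB. Qed.

Lemma rnorm_triangle b a h : N (a - h) <= N (a - b) + N (b - h).
Proof. by apply: le_trans (rnormD _ _); rewrite addrA subrK. Qed.

Lemma rnormZ c h : N (c *: h) = Normc.normc c * N h.
Proof. by apply: complexI; rewrite rmorphM /= -!rnormE normrZ. Qed.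

Lemma normc_real r : Normc.normc r%:C = `|r|.
Proof. by rewrite /= expr0n addr0 sqrtr_sqr. Qed.

Lemma rnormZr r h : N (r%:C *: h) = `|r| * N h.
Proof. by rewrite rnormZ normc_real. Qed.

Lemma rnorm_sum (I : Type) (s : seq I) (Q : pred I) (F : I -> H) :
  N (\sum_(i <- s | Q i) F i) <= \sum_(i <- s | Q i) N (F i).
Proof.
elim/big_ind2 : _ => [|a r b s'|//]; first by rewrite rnorm0.
by move=> ar bs; apply: le_trans (rnormD _ _) (lerD _ _).
Qed.

(** Radii in [H] are elements of [R[i]]; a positive one is real, so that convergence can be tested
    with radii in [R], where [lra] and [nra] apply. *)
Lemma rcvgP (T : Type) (F : set_system T) (FF : Filter F) (f : T -> H) l :
  f x @[x --> F] --> l <->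
  forall e : R, 0 < e -> \forall x \near F, N (l - f x) < e.
Proof.
split=> [/cvgrPdist_lt fl e e0|fl].
  have := fl e%:C; rewrite ltcR => /(_ e0); apply: filterS => x.
  by rewrite rnormE ltcR.
apply/cvgrPdist_lt => e e0; have [r er] : exists r, e = r%:C.
  by exists (complex.Re e); rewrite RRe_real // gtr0_real.
move: e0; rewrite er ltcR => r0; have := fl _ r0.
by apply: filterS => x; rewrite rnormE ltcR.
Qed.

Lemma rcauchy_cvg (F : set_system H) (FF : ProperFilter F) :
  (forall e : R, 0 < e -> exists2 A, F A &
     forall a b, A a -> A b -> N (a - b) < e) ->
  exists l : H, F --> l.
Proof.
move=> FC; exists (lim F); apply: (@cauchy_cvg H F) => //.
apply/cauchy_exP => /= e e0; have [r er] : exists r, e = r%:C.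
  by exists (complex.Re e); rewrite RRe_real // gtr0_real.
move: e0; rewrite er ltcR => r0; have [A FA AP] := FC _ r0.
have [a Aa] := filter_ex FA; exists a; apply: filterS FA => b Ab.
by rewrite -ball_normE /= rnormE ltcR; exact: AP.
Qed.

Lemma rseq_cauchy_cvg (u : nat -> H) :
  (forall e : R, 0 < e -> exists n0, forall m n, (n0 <= m)%N -> (n0 <= n)%N ->
    N (u m - u n) < e) -> exists l : H, u @ \oo --> l.
Proof.
move=> uC; apply: rcauchy_cvg => e /uC[n0 un0].
exists (u @` [set n | (n0 <= n)%N]).
  by exists n0 => // n /= n0n; exists n.
by move=> _ _ [m n0m <-] [n n0n <-]; exact: un0.
Qed.

(** A bound on the operator norm, as a predicate on real [r] instead of an inequality on the
    extended real [op_norm]. *)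
Definition opb r (x : H -> H) := forall h, N (x h) <= r * N h.

Lemma rcontinuousP (x : H -> H) : continuous x <->
  forall h (e : R), 0 < e ->
    exists2 d : R, 0 < d & forall h', N (h - h') < d -> N (x h - x h') < e.
Proof.
split=> [cx h e e0|cx h].
  have /rcvgP/(_ e e0) := cx h; rewrite -nbhs_nearE => /nbhs_ballP[d /= d0 dP].
  exists (complex.Re d).
    by rewrite -ltcR RRe_real // gtr0_real.
  move=> h' h'd; apply: dP; rewrite -ball_normE /= rnormE.
  by rewrite -(@RRe_real _ d) ?ltcR // gtr0_real.
apply/rcvgP => e e0; have [d d0 dP] := cx h e e0.
apply/nbhs_ballP; exists d%:C; first by rewrite /= ltcR.
by move=> h'; rewrite -ball_normE /= rnormE ltcR; exact: dP.
Qed.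

Lemma linearB0 (x : H -> H) : linear x -> x 0 = 0.
Proof. by move=> lx; have := lx (-1) 0 0; rewrite !scaleN1r !addNr. Qed.

Lemma opb_continuous r (x : H -> H) : linear x -> opb r x -> continuous x.
Proof.
move=> lx xr; apply/rcontinuousP => h e e0.
exists (e / (`|r| + 1)); first by rewrite divr_gt0 // ltr_wpDl.
move=> h' hh'; have -> : x h - x h' = x (h - h').
  by have := lx (-1) h' h; rewrite !scaleN1r !(addrC (- _)) => ->.
apply: le_lt_trans (xr _) _; have r1 : 0 < `|r| + 1 by rewrite ltr_wpDl.
move: hh'; rewrite ltr_pdivlMr // => hh'; apply: le_lt_trans _ hh'.
rewrite mulrC; apply: ler_wpM2l; first exact: rnorm_ge0.
by rewrite (le_trans (ler_norm _)) // lerDl.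
Qed.

Lemma bounded_opP (x : H -> H) :
  bounded_op x <-> linear x /\ exists2 r, 0 <= r & opb r x.
Proof.
split=> [[lx cx]|[lx [r r0 xr]]]; last by split=> //; exact: opb_continuous xr.
split=> //; have /rcontinuousP/(_ 0 1 ltr01)[d d0 dP] := cx.
exists (2 / d); first by rewrite divr_ge0 // ltW.
move=> h; have [->|h0] := eqVneq h 0; first by rewrite (linearB0 lx) rnorm0 mulr0.
have Nh : 0 < N h by exact: rnorm_gt0.
(* This scales [h] to norm d / 2, strictly inside the ball on which |x| < 1. *)
pose t := d / 2 / N h.
have t0 : 0 < t by rewrite !divr_gt0.
have := dP (t%:C *: h); rewrite (linearB0 lx) !sub0r !rnormN rnormZr (gtr0_norm t0).
have -> : x (t%:C *: h) = t%:C *: x h.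
  by have := lx t%:C h 0; rewrite (linearB0 lx) !addr0.
rewrite rnormZr (gtr0_norm t0).
have -> : t * N h = d / 2 by rewrite /t; field; rewrite gt_eqF.
move=> /(_ ltac:(lra)); rewrite -ltr_pdivlMl // mulr1 => /ltW/le_trans; apply.
suff -> : t^-1 = 2 / d * N h by [].
by rewrite /t; field; rewrite !gt_eqF.
Qed.

End Hilbert.

(** * Inner products and the underlying real inner product *)

Section InnerProduct.
Context {R : realType} {H : completeNormedModType R[i]}.
Variable ip : {dot H for Num.conj}.
Hypothesis ip_norm : forall h : H, ip h h = `|h| ^+ 2.
Implicit Types (a b h : H) (c : R[i]) (r : R).
Local Notation N := (@rnorm R H).

Lemma ipC a b : ip a b = (ip b a)^*%C.
Proof. by rewrite hermC expr0 mul1r. Qed.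

(** The real part is a real inner product with the same norm. Estimates are made with it, and [ripE]
    recovers [ip]. *)
Definition rip a b : R := complex.Re (ip a b).

Lemma ipDl a b h : ip (a + b) h = ip a h + ip b h. Proof. exact: linearDl. Qed.
Lemma ipDr a b h : ip h (a + b) = ip h a + ip h b. Proof. exact: linearDr. Qed.
Lemma ipBl a b h : ip (a - b) h = ip a h - ip b h. Proof. exact: linearBl. Qed.
Lemma ipBr a b h : ip h (a - b) = ip h a - ip h b. Proof. exact: linearBr. Qed.
Lemma ipNl a h : ip (- a) h = - ip a h. Proof. exact: linearNl. Qed.
Lemma ipZl c a b : ip (c *: a) b = c * ip a b. Proof. exact: linearZl_LR. Qed.
Lemma ipZr c a b : ip a (c *: b) = c^*%C * ip a b.
Proof. exact: linearZr_LR. Qed.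
Lemma ip0l a : ip 0 a = 0. Proof. exact: linear0l. Qed.
Lemma ip0r a : ip a 0 = 0. Proof. exact: linear0r. Qed.

Lemma ip_suml (I : Type) (s : seq I) (Q : pred I) (F : I -> H) h :
  ip (\sum_(i <- s | Q i) F i) h = \sum_(i <- s | Q i) ip (F i) h.
Proof. exact: (@linear_sumlz _ _ _ _ _ _ ip). Qed.

Lemma ip_sumr (I : Type) (s : seq I) (Q : pred I) (F : I -> H) h :
  ip h (\sum_(i <- s | Q i) F i) = \sum_(i <- s | Q i) ip h (F i).
Proof. exact: linear_sumr. Qed.

Lemma ip_normr h : ip h h = (N h ^+ 2)%:C.
Proof. by rewrite ip_norm rnormE rmorphXn. Qed.

Lemma rip_norm h : rip h h = N h ^+ 2.
Proof. by rewrite /rip ip_normr. Qed.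

Lemma ripC a b : rip a b = rip b a.
Proof. by rewrite /rip ipC; case: (ip b a). Qed.

Lemma ripDl a b h : rip (a + b) h = rip a h + rip b h.
Proof. by rewrite /rip ipDl raddfD. Qed.

Lemma ripDr a b h : rip h (a + b) = rip h a + rip h b.
Proof. by rewrite /rip ipDr raddfD. Qed.

Lemma ripNl a b : rip (- a) b = - rip a b.
Proof. by rewrite /rip ipNl raddfN. Qed.

Lemma ripNr a b : rip a (- b) = - rip a b.
Proof. by rewrite ripC ripNl ripC. Qed.

Lemma ripZl r a b : rip (r%:C *: a) b = r * rip a b.
Proof. by rewrite /rip ipZl; case: (ip a b) => x y /=; rewrite mul0r subr0. Qed.

Lemma ripZr r a b : rip a (r%:C *: b) = r * rip a b.
Proof. by rewrite ripC ripZl ripC. Qed.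

Lemma ripE a b : ip a b = rip a b +i* rip a ('i%C *: b).
Proof.
by rewrite /rip ipZr; case: (ip a b) => x y /=; rewrite !mul0r mulN1r opprK add0r.
Qed.

Lemma rip_ext a b : (forall h, rip a h = rip b h) -> a = b.
Proof.
move=> ab; apply/eqP; rewrite -subr_eq0; apply/eqP/rnorm_eq0.
have : rip (a - b) (a - b) = 0 by rewrite ripDl ripNl ab subrr.
by rewrite rip_norm => /eqP; rewrite expf_eq0 /= => /eqP.
Qed.

Lemma ip_ext a b : (forall h, ip a h = ip b h) -> a = b.
Proof. by move=> ab; apply: rip_ext => h; rewrite /rip ab. Qed.

Lemma sqr_rnormD a b : N (a + b) ^+ 2 = N a ^+ 2 + 2 * rip a b + N b ^+ 2.
Proof.
rewrite -!rip_norm ripDl !ripDr (ripC b a); ring.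
Qed.

Lemma sqr_rnormB a b : N (a - b) ^+ 2 = N a ^+ 2 - 2 * rip a b + N b ^+ 2.
Proof. by rewrite sqr_rnormD ripNr rnormN mulrN. Qed.

Lemma parallelogram a b :
  N (a - b) ^+ 2 = 2 * N a ^+ 2 + 2 * N b ^+ 2 - N (a + b) ^+ 2.
Proof. rewrite sqr_rnormB sqr_rnormD; ring. Qed.

(** The first-order condition of the variational arguments below: t takes both signs, and t = u / w
    with w > v forces u = 0. *)
Lemma ler_quad0 (u v : R) : (forall t : R, t * u <= t ^+ 2 * v) -> u = 0.
Proof.
move=> uv; pose w := `|v| + 1; have w0 : 0 < w by rewrite ltr_wpDl.
have := uv (u / w); have -> : u / w * u = (u / w) ^+ 2 * w.
  by field; rewrite gt_eqF.
rewrite -subr_le0 -mulrBr => h.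
have wv : 0 < w - v by rewrite subr_gt0 /w ltr_pwDr ?ler_norm.
have : (u / w) ^+ 2 <= 0 by rewrite -(pmulr_lle0 _ wv).
move=> h'; have /eqP : (u / w) ^+ 2 = 0 by apply: le_anti; rewrite h' sqr_ge0.
by rewrite expf_eq0 /= mulf_eq0 invr_eq0 (gt_eqF w0) orbF => /eqP.
Qed.

Lemma rip_le a b : `|rip a b| <= N a * N b.
Proof.
have [->|b0] := eqVneq b 0.
  by rewrite ripC -(scale0r (0 : H)) ripZl mul0r normr0 mulr_ge0 ?rnorm_ge0.
have Nb : 0 < N b by exact: rnorm_gt0.
(* The value of t that minimizes |a - t b|. *)
pose t := rip a b / N b ^+ 2.
have : 0 <= N (a - t%:C *: b) ^+ 2 by exact: sqr_ge0.
rewrite sqr_rnormB ripZr rnormZr exprMn real_normK ?num_real //.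
have -> : N a ^+ 2 - 2 * (t * rip a b) + t ^+ 2 * N b ^+ 2 =
    (N a ^+ 2 * N b ^+ 2 - rip a b ^+ 2) / N b ^+ 2.
  by rewrite /t; field; rewrite gt_eqF.
rewrite pmulr_lge0 ?invr_gt0 ?exprn_gt0 // subr_ge0 -exprMn.
rewrite -[rip a b ^+ 2]real_normK ?num_real //.
by rewrite ler_pXn2r // ?nnegrE ?mulr_ge0 ?rnorm_ge0.
Qed.

Lemma rip_le1 a b : rip a b <= N a * N b.
Proof. exact: le_trans (ler_norm _) (rip_le _ _). Qed.

(** Multiplying [a] by the conjugate of [ip a b] makes the inner product real, so the real
    Cauchy-Schwarz inequality applies without loss of constant. *)
Lemma normc_ip_le a b : Normc.normc (ip a b) <= N a * N b.
Proof.
set z := ip a b; have [z0|z0] := eqVneq z 0.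
  by rewrite z0 Normc.normc0 mulr_ge0 ?rnorm_ge0.
have nz : 0 < Normc.normc z.
  by rewrite -ltcR -[(Normc.normc z)%:C]/`|z| normr_gt0.
have : rip ((z^*)%C *: a) b = Normc.normc z ^+ 2.
  apply: complexI; rewrite rmorphXn /= -[X in _ = X ^+ 2]/`|z| sqr_normc.
  rewrite /rip ipZl -/z mulrC RRe_real // ger0_real // mulcJ_ge0 //.
move=> e; have := rip_le1 ((z^*)%C *: a) b; rewrite e rnormZ.
have -> : Normc.normc (z^*)%C = Normc.normc z.
  by apply: complexI; exact: (normcJ z).
by rewrite -mulrA expr2 ler_pM2l.
Qed.

Lemma ip_eq0_rip a b : (forall c, rip a (c *: b) = 0) -> ip a b = 0.
Proof. by move=> ab; rewrite ripE -[in rip a b](scale1r b) !ab. Qed.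

Lemma rnorm_le_dual a r : 0 <= r -> (forall h, rip a h <= r * N h) -> N a <= r.
Proof.
move=> r0 ar; have [->|a0] := eqVneq a 0; first by rewrite rnorm0.
have Na : 0 < N a by exact: rnorm_gt0.
by have := ar a; rewrite rip_norm expr2 ler_pM2r.
Qed.

End InnerProduct.

(** * Riesz representation and adjoints *)

Section Adjoint.
Context {R : realType} {H : completeNormedModType R[i]}.
Variable ip : {dot H for Num.conj}.
Hypothesis ip_norm : forall h : H, ip h h = `|h| ^+ 2.
Implicit Types (a b h : H) (c : R[i]) (r : R).
Local Notation N := (@rnorm R H).
Local Notation rp := (rip ip).

Lemma exists_inv_lt (e : R) : 0 < e -> exists n0 : nat, forall n, (n0 <= n)%N ->
  n.+1%:R^-1 < e.
Proof.
move=> e0; have [n _ nP] := near_infty_natSinv_lt (PosNum e0).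
by exists n => m nm; apply: nP.
Qed.

(* The representing vector minimizes [|a|^2 - 2 f a]; minimizing sequences are
   Cauchy by the parallelogram identity. *)
Lemma real_riesz (f : H -> R) (C : R) :
  (forall a b, f (a + b) = f a + f b) -> (forall r a, f (r%:C *: a) = r * f a) ->
  (forall a, f a <= C * N a) -> exists e, forall a, f a = rp a e.
Proof.
move=> fD fZ fC; pose q a := N a ^+ 2 - 2 * f a.
have qlb a : - C ^+ 2 <= q a.
  rewrite /q; have := fC a; have := sqr_ge0 (N a - C); nra.
have qinf : has_inf (range q).
  split; first by exists (q 0); exists 0.
  by exists (- C ^+ 2) => _ [a _ <-].
pose m := inf (range q).
have qm a : m <= q a by apply: ge_inf; [case: qinf|exists a].
have /choice[u uP] : forall n : nat, exists a, q a < m + n.+1%:R^-1.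
  move=> n; have n0 : 0 < n.+1%:R^-1 :> R by rewrite invr_gt0.
  by have [_ [a _ <-] qa] := inf_adherent n0 qinf; exists a.
have uC j k : N (u j - u k) ^+ 2 <= 2 * (j.+1%:R^-1 + k.+1%:R^-1).
  have := qm ((2^-1)%:C *: (u j + u k)); have := uP j; have := uP k.
  rewrite (parallelogram ip_norm) /q rnormZr fZ fD ger0_norm ?invr_ge0 //.
  by move: (j.+1%:R^-1) (k.+1%:R^-1) => ej ek; lra.
have [l ul] : exists l : H, u @ \oo --> l.
  apply: rseq_cauchy_cvg => e e0.
  have [n0 n0P] : exists n0 : nat, forall n, (n0 <= n)%N -> n.+1%:R^-1 < e ^+ 2 / 4.
    by apply: exists_inv_lt; rewrite divr_gt0 // exprn_gt0.
  exists n0 => j k /n0P nj /n0P nk.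
  rewrite -(@ltr_pXn2r _ 2) ?nnegrE ?rnorm_ge0 ?ltW //.
  by apply: le_lt_trans (uC j k) _; move: (j.+1%:R^-1) (k.+1%:R^-1) nj nk => ej ek; lra.
exists l => a; apply/eqP; rewrite -subr_eq0 -oppr_eq0 opprB; apply/eqP.
suff: 2 * (rp a l - f a) = 0 by move=> /eqP; rewrite mulf_eq0 pnatr_eq0 => /eqP.
apply: (@ler_quad0 _ _ (N a ^+ 2)) => t; rewrite -subr_ge0.
have -> : t ^+ 2 * N a ^+ 2 - t * (2 * (rp a l - f a)) =
  N a ^+ 2 * t ^+ 2 + 2 * t * (f a - rp a l) by ring.
(* The minimality of [l] is not proved as such: [q (u n)] is compared with [q (u n - t a)] for large
   n, up to an arbitrary error e. *)
suff pos (e : R) : 0 < e -> - e <= N a ^+ 2 * t ^+ 2 + 2 * t * (f a - rp a l).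
  by apply/ler_addgt0Pr => e /pos; rewrite -subr_ge0 opprK.
move=> e0.
(* With this d, replacing [l] by [u n] changes the term in t by at most e / 2; the other e / 2
   bounds q (u n) - m. *)
pose d := e / 2 / (2 * `|t| * N a + 1).
have D0 : 0 < 2 * `|t| * N a + 1.
  by rewrite ltr_wpDl // !mulr_ge0 ?rnorm_ge0.
have d0 : 0 < d by rewrite !divr_gt0.
have [n0 n0P] := exists_inv_lt (divr_gt0 e0 (ltr0n _ 2)).
have /rcvgP/(_ d d0) [n1 _ n1P] := ul.
pose n := maxn n0 n1; have nn0 := n0P n (leq_maxl _ _).
have /= nn1 := n1P n (leq_maxr _ _).
have := qm (u n - t%:C *: a); have := uP n.
rewrite /q (sqr_rnormB ip_norm) (ripZr ip) rnormZr exprMn real_normK ?num_real //.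
have -> : f (u n - t%:C *: a) = f (u n) - t * f a.
  by rewrite fD -scaleNr -rmorphN fZ mulNr.
have := rip_le ip_norm (l - u n) a; rewrite (ripDl ip) (ripNl ip) (ripC ip a l).
set A := rp (u n) a; set B := rp l a => AB.
have : `|t| * `|B - A| <= e / 4.
  have : N (l - u n) * N a <= d * N a by rewrite ler_wpM2r ?rnorm_ge0 // ltW.
  move=> /(le_trans AB)/(ler_wpM2l (normr_ge0 t))/le_trans; apply.
  have -> : e / 4 = d * ((2 * `|t| * N a + 1) / 2) by rewrite /d; field; rewrite gt_eqF.
  rewrite mulrCA ler_pM2l // -[2 * _ * _]mulrA; move: (`|t| * N a) => z; lra.
rewrite -normrM ler_norml => /andP[h1 h2]; move: (n.+1%:R^-1) nn0 => w; lra.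
Qed.

Lemma adj_exists (x : H -> H) : bounded_op x ->
  exists2 y, bounded_op y & forall a b, ip (x a) b = ip a (y b).
Proof.
move=> /bounded_opP[lx [C C0 xC]].
have /choice[y yP] : forall b, exists e, forall a, rp (x a) b = rp a e.
  move=> b; apply: (@real_riesz _ (C * N b)) => [a a'|r a|a].
  - by have := lx 1 a a'; rewrite !scale1r => ->; rewrite (ripDl ip).
  - have := lx r%:C a 0; rewrite (linearB0 lx) !addr0 => ->.
    by rewrite (ripZl ip).
  - apply: le_trans (rip_le1 ip_norm _ _) _; rewrite mulrAC.
    by rewrite ler_wpM2r ?rnorm_ge0.
have xZ c a : x (c *: a) = c *: x a.
  by have := lx c a 0; rewrite (linearB0 lx) !addr0.
(* The Riesz vectors match the real parts only. The imaginary part of [ip] is a real part at a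
   vector multiplied by i, so the complex linearity of [x] gives the rest. *)
have yip a b : ip (x a) b = ip a (y b).
  rewrite !ripE yP; congr Complex.
  have -> : rp (x a) ('i%C *: b) = rp (- 'i%C *: x a) b.
    by rewrite /rip (ipZr ip) (ipZl ip); congr (complex.Re (_ * _)); simpc.
  by rewrite -xZ yP /rip (ipZr ip) (ipZl ip); congr (complex.Re (_ * _)); simpc.
exists y => //; apply/bounded_opP; split.
  move=> c a b; apply: (ip_ext ip_norm) => h.
  by rewrite ipC [RHS]ipC; congr conjc; rewrite (ipDr ip) (ipZr ip) -!yip (ipDr ip) (ipZr ip).
exists C => // b; apply: (rnorm_le_dual ip_norm); first by rewrite mulr_ge0 ?rnorm_ge0.
move=> h; rewrite (ripC ip) -yP.
apply: le_trans (rip_le1 ip_norm _ _) _.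
by rewrite mulrAC ler_wpM2r ?rnorm_ge0.
Qed.

Lemma adj_uniq (x y y' : H -> H) : (forall a b, ip (x a) b = ip a (y b)) ->
  (forall a b, ip (x a) b = ip a (y' b)) -> y = y'.
Proof.
move=> xy xy'; apply: funext => b; apply: (ip_ext ip_norm) => a.
by rewrite ipC [RHS]ipC -xy -xy'.
Qed.

(** The existence of an adjoint rules out the default value in [adj]. *)
Lemma adjP (x : H -> H) : bounded_op x ->
  bounded_op (adj ip x) /\ forall a b, ip (x a) b = ip a (adj ip x b).
Proof.
move=> bx; rewrite /adj; case: xgetP => [y -> [] //|].
have [y by_ yP] := adj_exists bx.
by move=> /(_ y) nP; exfalso; apply: nP.
Qed.

Lemma adj_bounded (x : H -> H) : bounded_op x -> bounded_op (adj ip x).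
Proof. by move=> /adjP[]. Qed.

Lemma adjE (x : H -> H) : bounded_op x ->
  forall a b, ip (x a) b = ip a (adj ip x b).
Proof. by move=> /adjP[]. Qed.

Lemma adjE' (x : H -> H) : bounded_op x ->
  forall a b, ip (adj ip x a) b = ip a (x b).
Proof. by move=> bx a b; rewrite ipC -adjE // -ipC. Qed.

Lemma adj_eq (x y : H -> H) : bounded_op x ->
  (forall a b, ip (x a) b = ip a (y b)) -> adj ip x = y.
Proof. by move=> /adjE xP; exact: adj_uniq. Qed.

Lemma adjK (x : H -> H) : bounded_op x -> adj ip (adj ip x) = x.
Proof.
move=> bx; apply: adj_eq; first exact: adj_bounded.
exact: adjE'.
Qed.

Lemma bounded_comp (x y : H -> H) :
  bounded_op x -> bounded_op y -> bounded_op (x \o y).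
Proof.
move=> [lx cx] [ly cy]; split; first by move=> c a b /=; rewrite ly lx.
by move=> h; apply: continuous_comp; [exact: cy|exact: cx].
Qed.

Lemma adj_comp (x y : H -> H) : bounded_op x -> bounded_op y ->
  adj ip (x \o y) = adj ip y \o adj ip x.
Proof.
move=> bx by_; apply: adj_eq; first exact: bounded_comp.
by move=> a b /=; rewrite !adjE.
Qed.

Lemma opb_adj (x : H -> H) r : 0 <= r -> bounded_op x -> opb r x ->
  opb r (adj ip x).
Proof.
move=> r0 bx xr b; apply: (rnorm_le_dual ip_norm); first by rewrite mulr_ge0 ?rnorm_ge0.
move=> h; rewrite /rip adjE' // -/(rip ip _ _).
apply: le_trans (rip_le1 ip_norm _ _) _.
by rewrite [r * _]mulrC -mulrA ler_wpM2l ?rnorm_ge0 //; exact: xr.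
Qed.

Lemma bounded_id : bounded_op (id : H -> H).
Proof. by split => // h; exact: cvg_id. Qed.

Lemma adj_id : adj ip id = id.
Proof. by apply: adj_eq => //; exact: bounded_id. Qed.

Lemma bounded_add (x y : H -> H) :
  bounded_op x -> bounded_op y -> bounded_op (x + y).
Proof.
move=> [lx cx] [ly cy]; split.
  by move=> c a b; rewrite !fctE lx ly scalerDr addrACA.
by move=> h; apply: cvgD; [exact: cx|exact: cy].
Qed.

Lemma bounded_opp (x : H -> H) : bounded_op x -> bounded_op (- x).
Proof.
move=> [lx cx]; split.
  by move=> c a b; rewrite !fctE lx opprD scalerN.
by move=> h; apply: cvgN; exact: cx.
Qed.

Lemma bounded_sub (x y : H -> H) :
  bounded_op x -> bounded_op y -> bounded_op (x - y).
Proof. by move=> bx /bounded_opp; exact: bounded_add. Qed.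

Lemma bounded0 : bounded_op (0 : H -> H).
Proof.
split; first by move=> c a b; change (0 = c *: 0 + 0 :> H); rewrite scaler0 addr0.
by move=> h; exact: cvg_cst.
Qed.

Lemma adj_add (x y : H -> H) : bounded_op x -> bounded_op y ->
  adj ip (x + y) = adj ip x + adj ip y.
Proof.
move=> bx by_; apply: adj_eq; first exact: bounded_add.
by move=> a b; rewrite !fctE (ipDl ip) (ipDr ip) !adjE.
Qed.

Lemma adj_opp (x : H -> H) : bounded_op x -> adj ip (- x) = - adj ip x.
Proof.
move=> bx; apply: adj_eq; first exact: bounded_opp.
by move=> a b; rewrite !fctE (ipNl ip) linearNr adjE.
Qed.

Lemma adj_sub (x y : H -> H) : bounded_op x -> bounded_op y ->
  adj ip (x - y) = adj ip x - adj ip y.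
Proof. by move=> bx by_; rewrite adj_add ?adj_opp //; exact: bounded_opp. Qed.

Lemma bopD (x : H -> H) : bounded_op x -> forall a b, x (a + b) = x a + x b.
Proof. by move=> [lx _] a b; have := lx 1 a b; rewrite !scale1r. Qed.

Lemma bop0 (x : H -> H) : bounded_op x -> x 0 = 0.
Proof. by move=> [lx _]; exact: linearB0. Qed.

Lemma bopZ (x : H -> H) : bounded_op x -> forall c a, x (c *: a) = c *: x a.
Proof. by move=> [lx _] c a; have := lx c a 0; rewrite (linearB0 lx) !addr0. Qed.

Lemma bopN (x : H -> H) : bounded_op x -> forall a, x (- a) = - x a.
Proof. by move=> bx a; rewrite -scaleN1r bopZ // scaleN1r. Qed.

Lemma bopB (x : H -> H) : bounded_op x -> forall a b, x (a - b) = x a - x b.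
Proof. by move=> bx a b; rewrite bopD // bopN. Qed.

Lemma bop_sum (x : H -> H) : bounded_op x ->
  forall (I : Type) (s : seq I) (Q : pred I) (F : I -> H),
  x (\sum_(i <- s | Q i) F i) = \sum_(i <- s | Q i) x (F i).
Proof.
move=> bx I s Q F; elim: s => [|i s IH]; first by rewrite !big_nil bop0.
by rewrite !big_cons; case: (Q i); rewrite // bopD // IH.
Qed.

Lemma bop_cvg (x : H -> H) : bounded_op x ->
  forall (u : nat -> H) l, u @ \oo --> l -> x (u n) @[n --> \oo] --> x l.
Proof.
by move=> [_ cx] u l ul; apply: (@cvg_comp _ _ _ u x _ _ _ ul); exact: cx.
Qed.

End Adjoint.

(** * Finite rank and compact operators *)

Section FiniteRank.
Context {R : realType} {H : completeNormedModType R[i]}.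
Variable ip : {dot H for Num.conj}.
Hypothesis ip_norm : forall h : H, ip h h = `|h| ^+ 2.
Implicit Types (a b h : H) (c : R[i]) (r : R).
Local Notation N := (@rnorm R H).

(** Finite rank is encoded by a decomposition instead of the dimension of the range, so that sums,
    products and adjoints are immediate. *)
Definition rank_le (n : nat) (x : H -> H) := exists f g : 'I_n -> H,
  forall h, x h = \sum_i ip h (f i) *: g i.

Lemma rank_le_bounded n x : rank_le n x -> bounded_op x.
Proof.
move=> [f [g xE]]; apply/bounded_opP; split.
  move=> c a b; rewrite !xE scaler_sumr -big_split /=; apply: eq_bigr => i _.
  by rewrite (ipDl ip) (ipZl ip) scalerDl scalerA.
exists (\sum_i N (f i) * N (g i)).
  by apply: sumr_ge0 => i _; rewrite mulr_ge0 ?rnorm_ge0.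
move=> h; rewrite xE mulr_suml; apply: le_trans (rnorm_sum _ _ _) _.
apply: ler_sum => i _; rewrite rnormZ mulrAC ler_wpM2r ?rnorm_ge0 // mulrC.
exact: normc_ip_le.
Qed.

Lemma rank_le_comp n x (a b : H -> H) : bounded_op a -> bounded_op b ->
  rank_le n x -> rank_le n (a \o x \o b).
Proof.
move=> ba bb [f [g xE]]; exists (fun i => adj ip b (f i)), (fun i => a (g i)) => h.
rewrite /= xE bop_sum //; apply: eq_bigr => i _.
by rewrite bopZ // adjE.
Qed.

Lemma rank_le_adj n x : rank_le n x -> rank_le n (adj ip x).
Proof.
move=> /[dup] /rank_le_bounded bx [f [g xE]].
have -> : adj ip x = fun h => \sum_i ip h (g i) *: f i.
  apply: adj_eq => // a b; rewrite xE (ip_suml ip) (ip_sumr ip).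
  apply: eq_bigr => i _; rewrite (ipZl ip) (ipZr ip) (ipC ip (g i)).
  by rewrite mulrC.
by exists g, f.
Qed.

Lemma rank_le_add m n x y : rank_le m x -> rank_le n y -> rank_le (m + n) (x + y).
Proof.
move=> [f [g xE]] [f' [g' yE]].
exists (fun i : 'I_(m + n) => match fintype.split i with inl j => f j | inr k => f' k end).
exists (fun i : 'I_(m + n) => match fintype.split i with inl j => g j | inr k => g' k end) => h.
rewrite fctE xE yE big_split_ord /=; congr (_ + _); apply: eq_bigr => i _.
  by rewrite (unsplitK (inl i : 'I_m + 'I_n)).
by rewrite (unsplitK (inr i : 'I_m + 'I_n)).
Qed.

Lemma rank_le_opp n x : rank_le n x -> rank_le n (- x).
Proof.
move=> [f [g xE]]; exists f, (fun i => - g i) => h.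
by rewrite fctE xE -sumrN; apply: eq_bigr => i _; rewrite scalerN.
Qed.

Lemma rank_le_sub m n x y : rank_le m x -> rank_le n y -> rank_le (m + n) (x - y).
Proof. by move=> xm /rank_le_opp; exact: rank_le_add. Qed.

Lemma rank_le0 : rank_le 0 0.
Proof. by exists (fun=> 0), (fun=> 0) => h; rewrite big_ord0. Qed.

Lemma rank_le_zero n : rank_le n 0.
Proof.
exists (fun=> 0), (fun=> 0) => h; rewrite big1 // => i _; by rewrite scaler0.
Qed.

Lemma rank_le_widen m n x : (m <= n)%N -> rank_le m x -> rank_le n x.
Proof.
move=> mn xm; rewrite -(subnKC mn) -(addr0 x).
by apply: rank_le_add => //; exact: rank_le_zero.
Qed.

Lemma rank_le1 f g : rank_le 1 (fun h => ip h f *: g).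
Proof. by exists (fun=> f), (fun=> g) => h; rewrite big_ord1. Qed.

(* The matrix of the functionals defining [x] on the span of [e] is
   [n.+1] by [n], hence has a left kernel. *)
Lemma rank_le_ker n x (e : 'I_n.+1 -> H) : rank_le n x ->
  exists2 c : 'I_n.+1 -> R[i], (exists i, c i != 0) &
    x (\sum_i c i *: e i) = 0.
Proof.
move=> [f [g xE]]; pose M := \matrix_(i < n.+1, j < n) ip (e i) (f j).
have kM : kermx M != 0.
  by rewrite -mxrank_eq0 mxrank_ker subn_eq0 -ltnNge ltnS rank_leq_col.
have [i0 /eqP v0] : exists i, row i (kermx M) <> 0.
  apply/not_existsP => k0; move/eqP: kM; apply; apply/row_matrixP => i.
  by rewrite row0; have := k0 i; rewrite notK.
pose v := row i0 (kermx M).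
have vM : v *m M = 0 by rewrite /v -row_mul mulmx_ker row0.
exists (fun i => v 0 i).
  have [j vj] : exists j, v 0 j <> 0.
    apply/not_existsP => z0; move/eqP: v0; apply; apply/rowP => j.
    by rewrite [RHS]mxE; have := z0 j; rewrite notK.
  by exists j; apply/eqP.
rewrite xE big1 // => j _; rewrite (ip_suml ip).
have vj : \sum_i v 0 i * M i j = 0.
  transitivity ((v *m M) 0 j); first by rewrite [RHS]mxE.
  by rewrite vM mxE.
rewrite (eq_bigr (fun i => v 0 i * M i j)) ?vj ?scale0r // => i _.
by rewrite (ipZl ip) [M _ _]mxE.
Qed.

(** An ultrafilter on the closure of [A] is Cauchy: a choice [r] of nearby points of [K] pushes it
    to an ultrafilter that clusters in [K], and the points sent close to the cluster point form a
    small set of the ultrafilter. *)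
Lemma precompact_approx (A : set H) :
  (forall e : R, 0 < e -> exists2 K, compact K &
     forall a, A a -> exists2 k, K k & N (a - k) < e) ->
  precompact A.
Proof.
move=> AK; rewrite precompactE compact_ultra => U UU UA.
have UC : forall e : R, 0 < e -> exists2 B, U B &
    forall a b, B a -> B b -> N (a - b) < e.
  move=> e e0; have e4 : 0 < e / 8 by rewrite divr_gt0.
  have [K cK KA] := AK _ e4.
  have /choice[r rP] : forall z, exists k, closure A z -> K k /\ N (z - k) < e / 4.
    move=> z; have [zA|nzA] := pselect (closure A z); last by exists 0.
    have [|a [Aa za]] := zA [set a | N (z - a) < e / 8].
      apply/nbhs_ballP; exists (e / 8)%:C; first by rewrite /= ltcR.
      by move=> y; rewrite -ball_normE /= rnormE ltcR.
    have [k Kk ak] := KA _ Aa; exists k => _; split => //.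
    by apply: le_lt_trans (rnorm_triangle a _ _) _; move: za ak => /=; lra.
  have [l [Kl rl]] : K `&` cluster (fmap r U) !=set0.
    by apply: cK; rewrite fmapE; apply: filterS UA => z /rP[].
  (* An ultrafilter contains this set or its complement, and the latter would keep [l] from being a
     cluster point. *)
  have Ul : U [set z | N (l - r z) < e / 8].
    have [//|UnB] := in_ultra_setVsetC [set z | N (l - r z) < e / 8] UU.
    have [||z [/= lz]] := rl [set z | ~ N (l - z) < e / 8] [set z | N (l - z) < e / 8].
    - by rewrite fmapE.
    - apply/nbhs_ballP; exists (e / 8)%:C; first by rewrite /= ltcR.
      by move=> y; rewrite -ball_normE /= rnormE ltcR.
    - by [].
  exists [set z | closure A z /\ N (l - r z) < e / 8]; first exact: filterI.
  move=> a b [/rP[_ ar] la] [/rP[_ br] lb].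
  apply: le_lt_trans (rnorm_triangle (r a) _ _) _.
  have := rnorm_triangle (r b) (r a) b; have := rnorm_triangle l (r a) (r b).
  rewrite (rdistC (r a) l) (rdistC (r b) b); lra.
have [l Ul] := rcauchy_cvg _ UC.
exists l; split => //.
by apply: (@closed_cvg _ _ U _ id (closure A)) => //; exact: closed_closure.
Qed.

Lemma compact_line r h : compact ((fun t : R => t%:C *: h) @` `[- r, r]%classic).
Proof.
apply: continuous_compact; last exact: segment_compact.
apply: continuous_subspaceT => t; apply/rcvgP => e e0.
have Nh1 : 0 < N h + 1 by rewrite ltr_wpDl ?rnorm_ge0.
near=> s; rewrite -scalerBl -rmorphB rnormZr.
apply: (@le_lt_trans _ _ (`|t - s| * (N h + 1))).
  by rewrite ler_wpM2l // lerDl.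
rewrite -ltr_pdivlMr //; near: s.
apply/nbhs_ballP; exists (e / (N h + 1)); first by rewrite /= divr_gt0.
by move=> y.
Unshelve. all: by end_near. Qed.

Lemma compact_addset (A B : set H) : compact A -> compact B ->
  compact [set a + b | a in A & b in B].
Proof.
move=> cA cB; have -> : [set a + b | a in A & b in B] =
    (fun z : H * H => z.1 + z.2) @` (A `*` B).
  apply/seteqP; split => [_ [a Aa [b Bb <-]]|_ [[a b] [/= Aa Bb] <-]].
    by exists (a, b).
  by exists a => //; exists b.
apply: continuous_compact; last exact: compact_setX.
by apply: continuous_subspaceT => z; exact: add_continuous.
Qed.

(** Each coefficient is split into real and imaginary parts, so that a ball is sent into a finite
    sum of compact real segments. *)
Lemma rank_le_precompact n x r : rank_le n x -> exists2 K, compact K &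
  forall h, N h <= r -> K (x h).
Proof.
move=> [f [g xE]].
have [K cK KP] : exists2 K, compact K &
    forall h, N h <= r -> K (\sum_i ip h (f i) *: g i).
  elim: n f g {xE} => [|n IH] f g.
    by exists [set 0]; [exact: compact_set1|move=> h _; rewrite big_ord0].
  have [K cK KP] := IH (fun i => f (widen_ord (leqnSn n) i))
    (fun i => g (widen_ord (leqnSn n) i)).
  pose fn := f ord_max; pose gn := g ord_max; pose C := r * N fn.
  exists [set a + b | a in K & b in
    [set a + b | a in (fun t : R => t%:C *: gn) @` `[- C, C]%classic &
       b in (fun t : R => t%:C *: ('i%C *: gn)) @` `[- C, C]%classic]].
    apply: compact_addset => //; apply: compact_addset; exact: compact_line.
  move=> h hr; rewrite big_ord_recr /=.
  exists (\sum_(i < n) ip h (f (widen_ord (leqnSn n) i)) *: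
     g (widen_ord (leqnSn n) i)); first exact: KP.
  exists (ip h fn *: gn) => //.
  have hC : N h * N fn <= C by rewrite ler_wpM2r ?rnorm_ge0.
  exists ((rip ip h fn)%:C *: gn).
    exists (rip ip h fn) => //=; rewrite in_itv /= -ler_norml.
    exact: le_trans (rip_le ip_norm _ _) hC.
  exists ((rip ip h ('i%C *: fn))%:C *: ('i%C *: gn)).
    exists (rip ip h ('i%C *: fn)) => //=; rewrite in_itv /= -ler_norml.
    apply: le_trans (rip_le ip_norm _ _) _; rewrite rnormZ.
    have -> : Normc.normc 'i%C = 1 :> R by rewrite /= expr0n expr1n add0r sqrtr1.
    by rewrite mul1r.
  rewrite scalerA -scalerDl; congr (_ *: _); rewrite [RHS](ripE ip) [RHS]complexE /=.
  by rewrite mulrC.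
by exists K => // h /KP; rewrite -xE.
Qed.

(** The form of compactness that passes easily to sums, products and adjoints; [compactP] identifies
    the two. *)
Definition approximable (x : H -> H) := bounded_op x /\ forall e : R, 0 < e ->
  exists n F, rank_le n F /\ opb e (x - F).

Lemma approximable_compact x : approximable x -> compact_op x.
Proof.
move=> [bx xF]; split => //; apply: precompact_approx => e e0.
have [n [F [Fn xFe]]] := xF _ (divr_gt0 e0 (ltr0n _ 2)).
have [K cK KP] := rank_le_precompact 1 Fn.
exists K => // _ [h h1 <-]; exists (F h); first exact: KP.
apply: le_lt_trans (xFe h) _; apply: (@le_lt_trans _ _ (e / 2)); last lra.
by rewrite ler_piMr // divr_ge0 ?ltW.
Qed.

End FiniteRank.

(** * Singular values *)

Section Dimension.
Context {K : numFieldType} {V : lmodType K}.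

(** If n < m, the m by n matrix of coordinates of the [e i] has a left kernel. It gives a nontrivial
    relation between the [e i], against the uniqueness of coordinates. *)
Lemma has_dim_leq (S S' : set V) m n : S `<=` S' -> has_dim S m -> has_dim S' n ->
  (m <= n)%N.
Proof.
move=> SS' [e [eS eP]] [e' [e'S e'P]]; rewrite leqNgt; apply/negP => nm.
have /choice[A AP] : forall i, exists c : {ffun 'I_n -> K}, e i = \sum_j c j *: e' j.
  by move=> i; have [c [cE _]] := e'P _ (SS' _ (eS i)); exists c.
pose M := \matrix_(i < m, j < n) A i j.
have kM : kermx M != 0.
  by rewrite -mxrank_eq0 mxrank_ker subn_eq0 -ltnNge (leq_ltn_trans (rank_leq_col _)).
have [i0 /eqP v0] : exists i, row i (kermx M) <> 0.
  apply/not_existsP => k0; move/eqP: kM; apply; apply/row_matrixP => i.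
  by rewrite row0; have := k0 i; rewrite notK.
pose v := row i0 (kermx M).
have vM : v *m M = 0 by rewrite /v -row_mul mulmx_ker row0.
have e0 : \sum_i v 0 i *: e i = 0.
  rewrite (eq_bigr (fun i => \sum_j (v 0 i * M i j) *: e' j)); last first.
    move=> i _; rewrite AP scaler_sumr; apply: eq_bigr => j _.
    by rewrite scalerA [M _ _]mxE.
  rewrite exchange_big big1 //= => j _; rewrite -scaler_suml.
  have -> : \sum_i v 0 i * M i j = (v *m M) 0 j by rewrite [RHS]mxE.
  by rewrite vM mxE scale0r.
have [j vj] : exists j, v 0 j <> 0.
  apply/not_existsP => z0; move/eqP: v0; apply; apply/rowP => j.
  by rewrite [RHS]mxE; have := z0 j; rewrite notK.
have m0 : (0 < m)%N by apply: leq_ltn_trans nm.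
have [c [cE cU]] := eP _ (eS (Ordinal m0)).
have : c = [ffun i => c i + v 0 i].
  apply: cU; rewrite (eq_bigr (fun i => c i *: e i + v 0 i *: e i)).
    by rewrite big_split /= e0 addr0.
  by move=> i _; rewrite ffunE scalerDl.
move=> /ffunP/(_ j); rewrite ffunE => /eqP; rewrite -subr_eq0 opprD addNKr oppr_eq0.
by move/eqP.
Qed.

Lemma has_dim_uniq (S : set V) m n : has_dim S m -> has_dim S n -> m = n.
Proof. by move=> Sm Sn; apply/eqP; rewrite eqn_leq !(@has_dim_leq S S). Qed.

End Dimension.

(** * Orthonormal families and maximizing vectors *)

Section SingularValues.
Context {R : realType} {H : completeNormedModType R[i]}.
Variable ip : {dot H for Num.conj}.
Hypothesis ip_norm : forall h : H, ip h h = `|h| ^+ 2.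
Hypothesis H_infinite : ~ finite_dim [set: H].
Implicit Types (a b h : H) (c : R[i]) (r : R).
Local Notation N := (@rnorm R H).

Definition orthonormal_upto (e : nat -> H) (k : nat) :=
  forall i j, (i < k)%N -> (j < k)%N -> ip (e i) (e j) = (i == j)%:R.

(** For an orthonormal family, the orthogonal projection on its span. *)
Definition comb (e : nat -> H) k h := \sum_(i < k) ip h (e i) *: e i.

Lemma ip_comb e k h j : orthonormal_upto e k -> (j < k)%N ->
  ip (comb e k h) (e j) = ip h (e j).
Proof.
move=> eo jk; rewrite (ip_suml ip) (bigD1 (Ordinal jk)) //= big1 ?addr0.
  by rewrite (ipZl ip) eo // eqxx mulr1.
move=> i /negPf ij; rewrite (ipZl ip) eo //.
by rewrite -val_eqE /= in ij; rewrite ij mulr0.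
Qed.

Lemma ortho_comb e k h j : orthonormal_upto e k -> (j < k)%N ->
  ip (h - comb e k h) (e j) = 0.
Proof. by move=> eo jk; rewrite (ipBl ip) ip_comb // subrr. Qed.

(** This is where infinite dimension enters: otherwise the family would be a basis of [H]. *)
Lemma exists_unit_ortho e k : orthonormal_upto e k ->
  exists2 h, N h = 1 & forall j, (j < k)%N -> ip h (e j) = 0.
Proof.
move=> eo; have [[h0 /eqP h0k]|/forallNP ek] := pselect (exists h, h - comb e k h <> 0); last first.
  exfalso; apply: H_infinite; exists k, (fun i : 'I_k => e i); split => // v _.
  have vE : v = comb e k v by apply/eqP; rewrite -subr_eq0; have := ek v; rewrite notK => ->.
  exists [ffun i : 'I_k => ip v (e i)]; split.
    by rewrite [LHS]vE; apply: eq_bigr => i _; rewrite ffunE.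
  move=> c vc; apply/ffunP => i; rewrite ffunE {1}vc (ip_suml ip) (bigD1 i) //= big1 ?addr0.
    by rewrite (ipZl ip) eo // eqxx mulr1.
  move=> j /negPf ij; rewrite (ipZl ip) eo //.
  by rewrite -val_eqE /= in ij; rewrite ij mulr0.
have Nh := rnorm_gt0 h0k.
exists ((N (h0 - comb e k h0))^-1%:C *: (h0 - comb e k h0)).
  by rewrite rnormZr gtr0_norm ?invr_gt0 // mulVf // gt_eqF.
by move=> j jk; rewrite (ipZl ip) ortho_comb // mulr0.
Qed.

(** A cluster point of the images suffices: [phi] is not made increasing, [k <= phi k] is all that
    is used later. *)
Lemma compact_subseq (x : H -> H) (u : nat -> H) : compact_op x ->
  (forall n, N (u n) <= 1) -> exists (phi : nat -> nat) (l : H),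
    forall k, (k <= phi k)%N /\ N (l - x (u (phi k))) < k.+1%:R^-1.
Proof.
move=> [_]; rewrite precompactE => cx u1.
have [l [_ lP]] : closure (x @` [set h : H | rnorm h <= 1]) `&`
    cluster (x (u n) @[n --> \oo]) !=set0.
  apply: cx; exists 0 => // n _ /=; apply: subset_closure.
  by exists (u n) => //; exact: u1.
suff /choice[phi phiP] : forall k, exists n, (k <= n)%N /\ N (l - x (u n)) < k.+1%:R^-1.
  by exists phi, l.
move=> k; have [||_ [[n /= kn <-] ln]] := lP ((x \o u) @` [set n | (k <= n)%N])
    [set y | N (l - y) < k.+1%:R^-1].
- by exists k => // n /= kn; exists n.
- apply/nbhs_ballP; exists (k.+1%:R^-1)%:C; first by rewrite /= ltcR invr_gt0.
  by move=> y; rewrite -ball_normE /= rnormE ltcR.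
- by exists n.
Qed.

(* A maximizing sequence whose image converges is Cauchy by the parallelogram
   identity. *)
Lemma max_attained (x : H -> H) (M : set H) : compact_op x -> closed M ->
  (forall c a b, M a -> M b -> M (c *: a + b)) -> (exists2 h, M h & N h = 1) ->
  exists e, [/\ M e, N e = 1 & forall h, M h -> N (x h) <= N (x e) * N h].
Proof.
move=> cx clM linM [h1 Mh1 Nh1].
have [bx _] := cx; have [_ [C C0 xC]] := (bounded_opP x).1 bx.
pose A := [set N (x h) | h in [set h | M h /\ N h <= 1]].
have MZ c h : M h -> M (c *: h).
  have M0 : M 0 by have := linM (-1) _ _ Mh1 Mh1; rewrite scaleN1r addNr.
  by move=> Mh; have := linM c _ _ Mh M0; rewrite addr0.
have MD h h' : M h -> M h' -> M (h + h').
  by move=> Mh Mh'; have := linM 1 _ _ Mh Mh'; rewrite scale1r.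
have supA : has_sup A.
  split; first by exists (N (x h1)), h1 => //; split => //; rewrite Nh1.
  exists C => _ [h [_ hle] <-]; apply: le_trans (xC h) _.
  by rewrite ler_piMr.
pose s := sup A.
have sP h : M h -> N (x h) <= s * N h.
  move=> Mh; have [->|h0] := eqVneq h 0; first by rewrite bop0 // rnorm0 mulr0.
  have Nh := rnorm_gt0 h0; rewrite -ler_pdivrMr //.
  have -> : N (x h) / N h = N (x ((N h)^-1%:C *: h)).
    by rewrite bopZ // rnormZr gtr0_norm ?invr_gt0 // mulrC.
  apply: ub_le_sup; first by case: supA.
  exists ((N h)^-1%:C *: h) => //; split; first exact: MZ.
  by rewrite rnormZr gtr0_norm ?invr_gt0 // mulVf // gt_eqF.
(* If s <= 0, then [x] vanishes on [M] and any unit vector of [M] will do. *)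
have [s0|s0] := leP s 0.
  exists h1; split => // h Mh; apply: le_trans (sP _ Mh) _.
  apply: (@le_trans _ _ 0); first by rewrite mulr_le0_ge0 ?rnorm_ge0.
  by rewrite mulr_ge0 ?rnorm_ge0.
have /choice[u uP] : forall n : nat, exists h, [/\ M h, N h <= 1 & s - n.+1%:R^-1 < N (x h)].
  move=> n; have n0 : 0 < n.+1%:R^-1 :> R by rewrite invr_gt0.
  by have [_ [h [Mh hle] <-] lth] := sup_adherent n0 supA; exists h.
have [phi [l phiP]] := compact_subseq cx (fun n => let: And3 _ p _ := uP n in p).
pose v k := u (phi k).
have Mv k : M (v k) by case: (uP (phi k)).
have Nv k : N (v k) <= 1 by case: (uP (phi k)).
have xv k : s - k.+1%:R^-1 < N (x (v k)).
  case: (uP (phi k)) => _ _; apply: le_lt_trans.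
  by rewrite lerD2l lerN2 lef_pV2 ?posrE // ler_nat; case: (phiP k).
have lv k : N (l - x (v k)) < k.+1%:R^-1 by case: (phiP k).
have xvs k : N (x (v k)) <= s.
  by apply: le_trans (sP _ (Mv k)) _; rewrite ler_piMr // ltW.
(* The images are 2d-close and of norm at least s - d, so |x (v j + v k)| is nearly 2 s, and |v j +
   v k| nearly 2. *)
have vC (d : R) j k : 0 < d -> d < s -> j.+1%:R^-1 < d -> k.+1%:R^-1 < d ->
    N (v j - v k) ^+ 2 * s ^+ 2 <= 12 * s * d.
  move=> d0 ds jd kd; rewrite (parallelogram ip_norm).
  have vjk := sP _ (MD _ _ (Mv j) (Mv k)).
  have := parallelogram ip_norm (x (v j)) (x (v k)).
  rewrite -bopD //.
  have Z2 : N (x (v j + v k)) ^+ 2 <= s ^+ 2 * N (v j + v k) ^+ 2.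
    by rewrite -exprMn ler_pXn2r ?nnegrE ?rnorm_ge0 // mulr_ge0 ?rnorm_ge0 // ltW.
  have W2 : N (x (v j) - x (v k)) ^+ 2 <= (2 * d) ^+ 2.
    rewrite ler_pXn2r ?nnegrE ?rnorm_ge0 ?mulr_ge0 ?(ltW d0) //.
    have := rnorm_triangle l (x (v j)) (x (v k)); rewrite (rdistC (x (v j)) l).
    by move: (lv j) (lv k) jd kd; move: (j.+1%:R^-1) (k.+1%:R^-1) => ej ek; lra.
  have J2 : (s - d) ^+ 2 <= N (x (v j)) ^+ 2.
    rewrite ler_pXn2r ?nnegrE ?rnorm_ge0 ?subr_ge0 ?(ltW ds) //.
    by move: (xv j) jd; move: (j.+1%:R^-1) => ej; lra.
  have K2 : (s - d) ^+ 2 <= N (x (v k)) ^+ 2.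
    rewrite ler_pXn2r ?nnegrE ?rnorm_ge0 ?subr_ge0 ?(ltW ds) //.
    by move: (xv k) kd; move: (k.+1%:R^-1) => ek; lra.
  have j1 : N (v j) ^+ 2 <= 1 by rewrite expr_le1 // rnorm_ge0.
  have k1 : N (v k) ^+ 2 <= 1 by rewrite expr_le1 // rnorm_ge0.
  move: (N (v j) ^+ 2) (N (v k) ^+ 2) (N (x (v j)) ^+ 2) (N (x (v k)) ^+ 2)
    (N (x (v j) - x (v k)) ^+ 2) (N (x (v j + v k)) ^+ 2) (N (v j + v k) ^+ 2)
    j1 k1 J2 K2 W2 Z2 => aj ak bj bk w z y j1 k1 J2 K2 W2 Z2 wE.
  have ss : 0 < s ^+ 2 by rewrite exprn_gt0.
  have : aj * s ^+ 2 <= s ^+ 2 by rewrite ler_piMl // ltW.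
  have : ak * s ^+ 2 <= s ^+ 2 by rewrite ler_piMl // ltW.
  have : 0 <= s * d by rewrite mulr_ge0 ?ltW.
  by clear jd kd; lra.
have [e ve] : exists e : H, v @ \oo --> e.
  apply: rseq_cauchy_cvg => eps eps0.
  (* The first bound keeps d < s; the second makes 12 s d at most half of eps^2 s^2. *)
  pose d := Num.min (s / 2) (eps ^+ 2 * s / 24).
  have d0 : 0 < d by rewrite /d lt_min !divr_gt0 // mulr_gt0 // exprn_gt0.
  have ds : d < s by rewrite /d gt_min; apply/orP; left; lra.
  have de : d <= eps ^+ 2 * s / 24 by rewrite /d ge_min lexx orbT.
  have [n0 n0P] := exists_inv_lt d0.
  exists n0 => j k /n0P nj /n0P nk.
  rewrite -(@ltr_pXn2r _ 2) ?nnegrE ?rnorm_ge0 ?ltW //.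
  have s2 : 0 < s ^+ 2 by rewrite exprn_gt0.
  rewrite -(ltr_pM2r s2); apply: le_lt_trans (vC d _ _ d0 ds nj nk) _.
  have : 12 * s * d <= 12 * s * (eps ^+ 2 * s / 24).
    by rewrite ler_pM2l // mulr_gt0.
  have : 0 < eps ^+ 2 * s ^+ 2 by rewrite mulr_gt0 // exprn_gt0.
  move=> p0 /le_lt_trans; apply.
  have -> : 12 * s * (eps ^+ 2 * s / 24) = eps ^+ 2 * s ^+ 2 / 2 by field.
  by rewrite ltr_pdivrMr // ltr_pMr // ltr1n.
have Me : M e.
  apply: (@closed_cvg _ _ \oo _ v M) => //; by apply: nearW => n; exact: Mv.
have xve := bop_cvg bx ve.
have close (d : R) : 0 < d -> exists k,
    [/\ N (e - v k) < d, N (x e - x (v k)) < d & k.+1%:R^-1 < d].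
  move=> d0; have /rcvgP/(_ d d0)[n1 _ n1P] := ve.
  have /rcvgP/(_ d d0)[n2 _ n2P] := xve.
  have [n0 n0P] := exists_inv_lt d0.
  exists (maxn n0 (maxn n1 n2)); split.
  - by apply: n1P; rewrite /= !leq_max leqnn !orbT.
  - by apply: n2P; rewrite /= !leq_max leqnn !orbT.
  - by apply: n0P; rewrite leq_max leqnn.
have Ne1 : N e <= 1.
  apply/ler_addgt0Pl => d /close[k [ek _ _]].
  have := rnormD (e - v k) (v k); rewrite subrK => /le_trans; apply.
  by rewrite lerD // ltW.
have xes : s <= N (x e).
  apply/ler_addgt0Pl => d d0; have d2 : 0 < d / 2 by rewrite divr_gt0.
  have [k [_ ek kd]] := close _ d2.
  have := rnormD (x (v k) - x e) (x e); rewrite subrK rdistC => h.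
  have := xv k; rewrite ltrBlDr => /ltW/le_trans; apply.
  apply: le_trans (lerD h (ltW kd)) _; rewrite addrAC lerD2r.
  apply: le_trans (lerD (ltW ek) (lexx _)) _; by rewrite -splitr.
exists e; split => //.
  apply/eqP; rewrite eq_le Ne1 /= -(ler_pM2l s0) mulr1.
  exact: le_trans xes (sP _ Me).
by move=> h Mh; apply: le_trans (sP _ Mh) _; rewrite ler_wpM2r ?rnorm_ge0.
Qed.

End SingularValues.

(** * Singular values as approximation numbers *)

Section SVD.
Context {R : realType} {H : completeNormedModType R[i]}.
Variable ip : {dot H for Num.conj}.
Hypothesis ip_norm : forall h : H, ip h h = `|h| ^+ 2.
Hypothesis H_infinite : ~ finite_dim [set: H].
Implicit Types (a b h : H) (c : R[i]) (r : R).
Local Notation N := (@rnorm R H).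

Lemma sqr_normcC c : (Normc.normc c ^+ 2)%:C = c * c^*%C.
Proof. by rewrite rmorphXn -sqr_normc. Qed.

Lemma closed_ortho (S : set H) : closed [set h | forall b, S b -> ip h b = 0].
Proof.
move=> h hcl b Sb; suff : Normc.normc (ip h b) <= 0.
  move=> n0; apply: Normc.eq0_normc; apply/eqP; rewrite eq_le n0 /=.
  by rewrite -lecR -[(Normc.normc _)%:C]/`|ip h b| normr_ge0.
apply/ler_addgt0Pl => e e0; rewrite addr0.
have Nb : 0 < N b + 1 by rewrite ltr_wpDl ?rnorm_ge0.
have [|h' [h'S hh']] := hcl [set h' | N (h - h') < e / (N b + 1)].
  apply/nbhs_ballP; exists (e / (N b + 1))%:C; first by rewrite /= ltcR divr_gt0.
  by move=> y; rewrite -ball_normE /= rnormE ltcR.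
have -> : ip h b = ip (h - h') b by rewrite (ipBl ip) h'S // subr0.
apply: le_trans (normc_ip_le ip_norm _ _) _.
apply: (@le_trans _ _ (e / (N b + 1) * N b)); first by rewrite ler_wpM2r ?rnorm_ge0 ?ltW.
by rewrite mulrAC ler_pdivrMr // ler_pM2l // lerDl.
Qed.

(* [e k] maximizes [|x h|] over the unit vectors orthogonal to [e 0], ...,
   [e (k-1)]. *)
Lemma singular_vectors (x : H -> H) : compact_op x -> exists e : nat -> H,
  (forall k, orthonormal_upto ip e k) /\
  forall k h, (forall j, (j < k)%N -> ip h (e j) = 0) ->
    N (x h) <= N (x (e k)) * N h.
Proof.
(* [F] computes the next vector from the list of the previous ones. Orthonormality is a premise
   inside the choice, so that the recursion can be defined before the list is known to be
   orthonormal. *)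
move=> cx; have /choice[F FP] : forall s : seq H, exists e,
    orthonormal_upto ip (nth 0 s) (size s) -> [/\ N e = 1,
      forall j, (j < size s)%N -> ip e (nth 0 s j) = 0 &
      forall h, (forall j, (j < size s)%N -> ip h (nth 0 s j) = 0) ->
        N (x h) <= N (x e) * N h].
  move=> s; have [so|nso] := pselect (orthonormal_upto ip (nth 0 s) (size s)); last by exists 0.
  pose M := [set h | forall b, [set` s] b -> ip h b = 0].
  have ME h : M h <-> forall j, (j < size s)%N -> ip h (nth 0 s j) = 0.
    split=> [Mh j js|hs b /= /(nthP 0)[j js <-]]; last exact: hs.
    by apply: Mh => /=; rewrite mem_nth.
  have [||e [/ME Me Ne eP]] := max_attained ip_norm cx (@closed_ortho [set` s]).
  - by move=> c a b aM bM d ds; rewrite (ipDl ip) (ipZl ip) aM // bM // mulr0 addr0.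
  - have [h Nh hs] := exists_unit_ortho H_infinite so.
    by exists h => //; apply/ME.
  by exists e => _; split => // h /ME; exact: eP.
pose fix pre k := if k is k'.+1 then rcons (pre k') (F (pre k')) else [::].
pose e k := F (pre k).
have preE k : pre k = mkseq e k.
  by elim: k => //= k IH; rewrite {1}IH mkseqS.
have eo k : orthonormal_upto ip e k.
  elim: k => [|k IH] i j //.
  have so : orthonormal_upto ip (nth 0 (pre k)) (size (pre k)).
    by rewrite preE size_mkseq => i' j' ik jk; rewrite !nth_mkseq // IH.
  have [Ne eP _] := FP _ so; rewrite preE size_mkseq in eP.
  have eP' i' : (i' < k)%N -> ip (e k) (e i') = 0.
    by move=> ik; rewrite -[in X in ip _ X](nth_mkseq 0 e ik) /e preE eP.
  rewrite ltnS leq_eqVlt => /orP[/eqP ->|ik]; rewrite ltnS leq_eqVlt => /orP[/eqP ->|jk].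
  - by rewrite (ip_normr ip_norm) Ne expr1n eqxx.
  - by rewrite eP' // gtn_eqF.
  - by rewrite (ipC ip) eP' // conjc0 ltn_eqF.
  - exact: IH.
exists e; split => // k h hk.
have so : orthonormal_upto ip (nth 0 (pre k)) (size (pre k)).
  by rewrite preE size_mkseq => i' j' ik jk; rewrite !nth_mkseq // (eo k).
have [_ _ eP] := FP _ so; apply: eP; rewrite preE size_mkseq => j jk.
by rewrite nth_mkseq // hk.
Qed.

Section Fixed.
Variables (x : H -> H) (e : nat -> H).
Hypothesis cx : compact_op x.
Hypothesis eo : forall k, orthonormal_upto ip e k.
Hypothesis emax : forall k h, (forall j, (j < k)%N -> ip h (e j) = 0) ->
  N (x h) <= N (x (e k)) * N h.
Let s k := N (x (e k)).
Let bx : bounded_op x. Proof. by case: cx. Qed.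

Let eE i j : ip (e i) (e j) = (i == j)%:R.
Proof. by apply: (eo (k := (maxn i j).+1)); rewrite ltnS ?leq_maxl ?leq_maxr. Qed.

Let Ne k : N (e k) = 1.
Proof.
have := eE k k; rewrite (ip_normr ip_norm) eqxx => /complexI/eqP.
by rewrite pexpr_eq1 ?rnorm_ge0 // => /eqP.
Qed.

Let comb_split k h : exists2 h', (forall j, (j < k)%N -> ip h' (e j) = 0) &
  h = h' + comb ip e k h.
Proof.
exists (h - comb ip e k h); last by rewrite subrK.
by move=> j jk; rewrite ortho_comb.
Qed.

(** The first-order condition for [e k]: the quotient |x h| / |h| is maximal there, so its
    derivative in the direction of [h] vanishes. Complex multiples of [h] give the imaginary
    part. *)
Let x_ortho_gt k h : (forall j, (j <= k)%N -> ip h (e j) = 0) -> ip (x h) (x (e k)) = 0.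
Proof.
move=> hk; rewrite -[LHS]conjcK -(ipC ip); apply/eqP; rewrite conjc_eq0; apply/eqP.
apply: (ip_eq0_rip) => c; rewrite -bopZ //.
have {hk} : forall j, (j <= k)%N -> ip (c *: h) (e j) = 0.
  by move=> j jk; rewrite (ipZl ip) hk // mulr0.
move: (c *: h) => {c}h hk.
suff : 2 * rip ip (x (e k)) (x h) = 0 by move=> /eqP; rewrite mulf_eq0 pnatr_eq0 => /eqP.
apply: (@ler_quad0 _ _ (s k ^+ 2 * N h ^+ 2 - N (x h) ^+ 2)) => t.
have kh : rip ip (e k) h = 0 by rewrite ripC /rip hk.
have : N (x (e k + t%:C *: h)) ^+ 2 <= (s k * N (e k + t%:C *: h)) ^+ 2.
  rewrite ler_pXn2r ?nnegrE ?mulr_ge0 ?rnorm_ge0 //; apply: emax => j jk.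
  by rewrite (ipDl ip) (ipZl ip) hk 1?ltnW // mulr0 addr0 eE gtn_eqF.
rewrite bopD // bopZ // exprMn !(sqr_rnormD ip_norm) !(ripZr ip) kh !rnormZr.
rewrite Ne !exprMn -/(s k) real_normK ?num_real //.
move: (N h ^+ 2) (N (x h) ^+ 2) (rip ip (x (e k)) (x h)) (s k) => A B C D; lra.
Qed.

Let x_ortho i j : i <> j -> ip (x (e i)) (x (e j)) = 0.
Proof.
wlog ij : i j / (j < i)%N.
  move=> W ij; have [ji|ji|//] := ltngtP i j; last exact: W.
  by rewrite (ipC ip) (W j i) ?conjc0 //; exact: nesym.
move=> _; apply: x_ortho_gt => k kj; rewrite eE gtn_eqF //.
exact: leq_ltn_trans kj ij.
Qed.

(** The components of [h] along e_0, ..., e_k are handled by the orthogonality of the [x (e i)], the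
    remainder by [x_ortho_gt]. It follows that each [e k] is an eigenvector of x^* x. *)
Let x_orthoC k h : ip h (e k) = 0 -> ip (x h) (x (e k)) = 0.
Proof.
move=> hk; have [h' h'P ->] := comb_split k.+1 h.
rewrite bopD // (ipDl ip) x_ortho_gt ?add0r; last by move=> j; rewrite -ltnS; exact: h'P.
rewrite bop_sum // (ip_suml ip) big1 // => i _; rewrite bopZ // (ipZl ip).
have [->|/eqP/x_ortho ->] := eqVneq (i : nat) k; first by rewrite hk mul0r.
by rewrite mulr0.
Qed.

Let x_orthoE k h : ip (x h) (x (e k)) = (s k ^+ 2)%:C * ip h (e k).
Proof.
have -> : ip (x h) (x (e k)) =
    ip (x (h - ip h (e k) *: e k)) (x (e k)) + ip h (e k) * ip (x (e k)) (x (e k)).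
  by rewrite bopB // bopZ // (ipBl ip) (ipZl ip) subrK.
rewrite x_orthoC ?add0r; last by rewrite (ipBl ip) (ipZl ip) eE eqxx mulr1 subrr.
by rewrite (ip_normr ip_norm) mulrC.
Qed.

Let s_decr : {homo s : j k / (j <= k)%N >-> k <= j}.
Proof.
move=> j k jk; apply: le_trans (emax (k := j) _) _; last by rewrite Ne mulr1.
by move=> i ij; rewrite eE gtn_eqF // (leq_trans ij jk).
Qed.

(** The [x (e k)] are mutually orthogonal; if all had norm at least r they would be at mutual
    distance at least r, against compactness. *)
Let s_cvg0 r : 0 < r -> exists k, s k < r.
Proof.
move=> r0; apply/not_existsP => sr.
have eN n : N (e n) <= 1 by rewrite Ne.
have [phi [l phiP]] := compact_subseq cx eN.
have [n0 n0P] := exists_inv_lt (divr_gt0 r0 (ltr0n _ 2)).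
(* The second index is taken beyond j, which makes k different from j. *)
pose j := phi n0; pose k := phi (maxn n0 j.+1).
have lj : N (l - x (e j)) < r / 2.
  by apply: lt_trans (n0P n0 (leqnn _)); case: (phiP n0).
have lk : N (l - x (e k)) < r / 2.
  by apply: lt_trans (n0P _ (leq_maxl n0 j.+1)); case: (phiP (maxn n0 j.+1)).
have jk : j <> k.
  move=> jk; have [le_k _] := phiP (maxn n0 j.+1).
  by have := leq_trans (leq_maxr n0 j.+1) le_k; rewrite -/k -jk ltnn.
have : N (x (e j) - x (e k)) < r.
  apply: le_lt_trans (rnorm_triangle l _ _) _; rewrite (rdistC _ l); lra.
rewrite -(@ltr_pXn2r _ 2) ?nnegrE ?rnorm_ge0 ?ltW // (sqr_rnormB ip_norm).
rewrite /rip x_ortho // mulr0 subr0 -!/(s _) ltNge => /negP; apply.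
have /negP := sr j; rewrite -leNgt => rj.
apply: le_trans (_ : s j ^+ 2 <= _); last by rewrite lerDl sqr_ge0.
by rewrite ler_pXn2r ?nnegrE ?(ltW r0) //; exact: rnorm_ge0.
Qed.

Let adjxx k : adj ip x (x (e k)) = (s k ^+ 2)%:C *: e k.
Proof.
apply: (ip_ext ip_norm) => h; rewrite (adjE' ip_norm bx) (ipZl ip).
rewrite (ipC ip (x _)) x_orthoE (ipC ip (e k)) rmorphM; congr (_ * _).
exact: conjc_real.
Qed.

Let eigen_ortho (l : R) h k : 0 < l -> adj ip x (x h) = (l ^+ 2)%:C *: h ->
  s k <> l -> ip h (e k) = 0.
Proof.
move=> l0 hE kl; have := x_orthoE k h.
rewrite -(adjE' ip_norm bx) hE (ipZl ip) => /eqP; rewrite -subr_eq0 -mulrBl.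
rewrite mulf_eq0 -rmorphB => /orP[|/eqP //].
move=> /eqP/complexI/eqP; rewrite subr_eq0 eqrXn2 ?(ltW l0) ?rnorm_ge0 //.
by move=> /eqP lk; exfalso; exact: kl.
Qed.

(** Such an [h] satisfies |x h| <= s_k |h| for every k, hence x h = 0, whereas l > 0. *)
Let eigen0 (l : R) h : 0 < l -> adj ip x (x h) = (l ^+ 2)%:C *: h ->
  (forall k, ip h (e k) = 0) -> h = 0.
Proof.
move=> l0 hE h0; have xh : x h = 0.
  apply: rnorm_eq0; apply/eqP; rewrite eq_le rnorm_ge0 andbT.
  rewrite leNgt; apply/negP => xh.
  have Nh : 0 < N h.
    by apply: rnorm_gt0; apply/eqP => h00; move: xh; rewrite h00 (bop0 bx) rnorm0 ltxx.
  have [k] := s_cvg0 (divr_gt0 xh Nh); rewrite ltr_pdivlMr // ltNge => /negP; apply.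
  by apply: emax => j _; exact: h0.
move: hE; rewrite xh (bop0 (adj_bounded ip_norm bx)) => /eqP; rewrite eq_sym.
rewrite scaler_eq0 => /orP[/eqP|/eqP //].
by move=> /complexI/eqP; rewrite expf_eq0 /= gt_eqF.
Qed.

(** The [e k] with s_k = l form a basis of the eigenspace of l^2: an eigenvector minus its component
    along them is orthogonal to all the [e k], so [eigen0] applies. *)
Lemma is_singular_values_max : is_singular_values ip x s.
Proof.
split=> [k||l l0]; [exact: rnorm_ge0|exact: s_decr|].
have [K sK] := s_cvg0 l0.
have finA : finite_set [set k | s k = l].
  apply: sub_finite_set (finite_II K) => k /= kl; rewrite ltnNge; apply/negP => Kk.
  by have := s_decr Kk; rewrite kl leNgt sK.
have /finite_setP[n nA] := finA; exists n; split => //.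
have := nA; rewrite card_eq_sym => /card_set_bijP[f [fA finj fsurj]].
exists (fun i : 'I_n => e (f i)); split=> [i|v /= vE].
  by rewrite /= adjxx; have := fA i (ltn_ord i) => /= ->.
have fI (i j : 'I_n) : ip (e (f i)) (e (f j)) = (i == j)%:R.
  have [->|/eqP ij] := eqVneq i j; first by rewrite eE eqxx.
  rewrite eE; case: eqP => // fij; case: ij; apply: val_inj.
  by apply: finj fij; rewrite inE /=.
have sumE (c : 'I_n -> R[i]) (j : 'I_n) : ip (\sum_i c i *: e (f i)) (e (f j)) = c j.
  rewrite (ip_suml ip) (bigD1 j) //= big1 ?addr0; first by rewrite (ipZl ip) fI eqxx mulr1.
  by move=> i /negPf ij; rewrite (ipZl ip) fI ij mulr0.
exists [ffun i : 'I_n => ip v (e (f i))]; split; last first.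
  by move=> c vc; apply/ffunP => j; rewrite ffunE; have := sumE c j; rewrite -vc.
apply/eqP; rewrite -subr_eq0; apply/eqP; set v' := _ - _.
have v'E : adj ip x (x v') = (l ^+ 2)%:C *: v'.
  rewrite /v' bopB // (bopB (adj_bounded ip_norm bx)) vE scalerBr; congr (_ - _).
  rewrite bop_sum // (bop_sum (adj_bounded ip_norm bx)) scaler_sumr.
  apply: eq_bigr => i _; rewrite bopZ // (bopZ (adj_bounded ip_norm bx)) adjxx.
  by have := fA i (ltn_ord i) => /= ->; rewrite !scalerA mulrC.
apply: (eigen0 l0 v'E) => k; have [kl|kl] := pselect (s k = l); last exact: eigen_ortho kl.
have [i /= ni <-] := fsurj k kl.
rewrite /v' (ipBl ip) (sumE [ffun i : 'I_n => ip v (e (f i))] (Ordinal ni)).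
by rewrite ffunE subrr.
Qed.

Lemma singular_values_cvg0 r : 0 < r -> exists k, N (x (e k)) < r.
Proof. exact: s_cvg0. Qed.

Lemma singular_value_approx k h : N (x h - x (comb ip e k h)) <= s k * N h.
Proof.
rewrite -bopB //; have hk j : (j < k)%N -> ip (h - comb ip e k h) (e j) = 0.
  by move=> jk; rewrite ortho_comb.
apply: le_trans (emax hk) _; rewrite ler_wpM2l ?rnorm_ge0 //.
rewrite -(@ler_pXn2r _ 2) ?nnegrE ?rnorm_ge0 //.
have o : rip ip (h - comb ip e k h) (comb ip e k h) = 0.
  rewrite /rip {2}/comb (ip_sumr ip) big1 // => i _.
  by rewrite (ipZr ip) hk // mulr0.
rewrite -[X in _ <= N X ^+ 2](subrK (comb ip e k h)).
rewrite [X in _ <= X](sqr_rnormD ip_norm) o mulr0 addr0.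
by rewrite lerDl sqr_ge0.
Qed.

(** An operator of rank k annihilates some nonzero [h] in the span of e_0, ..., e_k, and |x h| >=
    s_k |h| on that span. *)
Lemma singular_value_min k F r : rank_le ip k F -> 0 <= r -> opb r (x - F) ->
  s k <= r.
Proof.
move=> Fk r0 xF; have [c [i0 ci0] Fc] := rank_le_ker (fun i : 'I_k.+1 => e i) Fk.
have [h hE] : exists h, h = \sum_(i < k.+1) c i *: e i by eexists.
rewrite -hE in Fc.
have sumE (d : 'I_k.+1 -> R[i]) (j : 'I_k.+1) : ip (\sum_i d i *: e i) (e j) = d j.
  rewrite (ip_suml ip) (bigD1 j) //= big1 ?addr0; first by rewrite (ipZl ip) eE eqxx mulr1.
  by move=> i /negPf ij; rewrite (ipZl ip) eE -val_eqE /= in ij *; rewrite ij mulr0.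
have h0 : h != 0.
  by apply: contraNneq ci0 => h0; rewrite -(sumE c) -hE h0 (ip0l ip).
have Nh := rnorm_gt0 h0.
have Nh2 : N h ^+ 2 = \sum_i Normc.normc (c i) ^+ 2.
  apply: complexI; rewrite -(ip_normr ip_norm) rmorph_sum /= [X in ip _ X]hE (ip_sumr ip).
  by apply: eq_bigr => i _; rewrite (ipZr ip) hE sumE sqr_normcC mulrC.
have Nxh2 : N (x h) ^+ 2 = \sum_(i < k.+1) s i ^+ 2 * Normc.normc (c i) ^+ 2.
  apply: complexI; rewrite -(ip_normr ip_norm) rmorph_sum /= [X in ip _ (x X)]hE (bop_sum bx) (ip_sumr ip).
  apply: eq_bigr => i _; rewrite (bopZ bx) (ipZr ip) x_orthoE hE sumE.
  have -> : (s i ^+ 2 * Normc.normc (c i) ^+ 2)%:C = (s i ^+ 2)%:C * (c i * (c i)^*%C).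
    by rewrite -sqr_normcC -rmorphM.
  by rewrite mulrCA [(c i)^*%C * _]mulrC.
have : (s k * N h) ^+ 2 <= (r * N h) ^+ 2.
  apply: (@le_trans _ _ (N (x h) ^+ 2)).
    rewrite exprMn Nh2 Nxh2 mulr_sumr; apply: ler_sum => i _.
    rewrite ler_wpM2r ?sqr_ge0 // ler_pXn2r ?nnegrE ?rnorm_ge0 //.
    by apply: s_decr; rewrite -ltnS.
  rewrite ler_pXn2r ?nnegrE ?mulr_ge0 ?rnorm_ge0 //.
  by have := xF h; rewrite !fctE Fc subr0.
by rewrite ler_pXn2r ?nnegrE ?mulr_ge0 ?rnorm_ge0 // ler_pM2r.
Qed.

End Fixed.

(** Both sequences take a value l > 0 equally often. At a first difference with t k > t' k, the
    indices where t' equals t k all lie before k, hence are such indices for t as well; by equal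
    cardinality k would be one of them. *)
Lemma singular_values_unique (x : H -> H) s s' :
  is_singular_values ip x s -> is_singular_values ip x s' -> s = s'.
Proof.
suff W t t' k : is_singular_values ip x t -> is_singular_values ip x t' ->
    (forall j, (j < k)%N -> t j = t' j) -> t k <= t' k.
  move=> xs xs'; apply: funext; elim/ltn_ind => k IH.
  apply/eqP; rewrite eq_le !(W _ _ k) // => j /IH //.
move=> [t0 tdec tP] [t0' tdec' tP'] tt; rewrite leNgt; apply/negP => tk.
have l0 : 0 < t k by exact: le_lt_trans (t0' k) tk.
have [n [tn nd]] := tP _ l0; have [n' [tn' nd']] := tP' _ l0.
rewrite (has_dim_uniq nd' nd) in tn'.
pose A := [set j | t j = t k]; pose B := [set j | t' j = t k].
have BA : B `<=` A.
  move=> j jk; rewrite /A /= tt // ltnNge; apply/negP => kj.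
  by have := tdec' _ _ kj; rewrite jk leNgt tk.
have finA : finite_set A by apply/finite_setP; exists n.
have finB : finite_set B by apply/finite_setP; exists n.
have : fset_set B == fset_set A.
  rewrite eqEfcard (card_fset_set tn) (card_fset_set tn') leqnn andbT.
  by rewrite -fset_set_sub.
move=> /eqP/fset_set_inj -/(_ finB finA) BAE.
have : B k by rewrite BAE.
by rewrite /B /= => tk'; rewrite tk' ltxx in tk.
Qed.

(** Existence and uniqueness identify the value chosen by [xget] with |x (e k)|. The first two
    clauses say that it is the distance to the operators of rank at most k, and that this distance
    is attained. *)
Lemma singular_valueP (x : H -> H) : compact_op x ->
  [/\ forall k, exists2 F, rank_le ip k F & opb (singular_value ip x k) (x - F),
      forall k F r, rank_le ip k F -> 0 <= r -> opb r (x - F) -> singular_value ip x k <= r,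
      forall k, 0 <= singular_value ip x k,
      {homo singular_value ip x : j k / (j <= k)%N >-> k <= j} &
      forall r, 0 < r -> exists k, singular_value ip x k < r].
Proof.
move=> cx; have [bx _] := cx; have [e [eo emax]] := singular_vectors cx.
have sx := is_singular_values_max cx eo emax.
have -> : singular_value ip x = fun k => N (x (e k)).
  rewrite /singular_value; case: xgetP => [s _ /singular_values_unique|/(_ _ sx) //].
  by apply.
split.
- move=> k; exists (x \o comb ip e k); last first.
    by move=> h; exact: singular_value_approx.
  exists (fun i => e i), (fun i => x (e i)) => h.
  by rewrite /= /comb bop_sum //; apply: eq_bigr => i _; rewrite bopZ.
- by move=> k F r; exact: singular_value_min.
- by move=> k; exact: rnorm_ge0.
- by case: sx.
- by move=> r; exact: singular_values_cvg0.
Qed.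

Lemma compactP (x : H -> H) : compact_op x <-> approximable ip x.
Proof.
split=> [cx|]; last exact: approximable_compact.
have [bx _] := cx; split => // r r0.
have [xF _ _ _ s0] := singular_valueP cx; have [k sk] := s0 _ r0.
have [F Fk xFs] := xF k; exists k, F; split => // h.
by apply: le_trans (xFs h) _; rewrite ler_wpM2r ?rnorm_ge0 // ltW.
Qed.

End SVD.

(** * Symmetrically normed ideals *)

Section Phi.
Context {R : realType}.
Variable Phi : (nat -> R) -> R.
Hypothesis Phi_sn : symmetric_norming Phi.
Implicit Types (a b s : nat -> R).

Definition trunc s k : nat -> R := nth 0 (mkseq s k).

Lemma truncE s k i : trunc s k i = if (i < k)%N then s i else 0.
Proof.
rewrite /trunc; case: ltnP => ik; first by rewrite nth_mkseq.
by rewrite nth_default // size_mkseq.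
Qed.

Lemma c_hat_nth (s : seq R) : c_hat (nth 0 s).
Proof. by exists (size s) => k; exact: nth_default. Qed.

Lemma c_hat_trunc s k : c_hat (trunc s k). Proof. exact: c_hat_nth. Qed.

Lemma c_hatE a : c_hat a -> exists n, a = trunc a n.
Proof.
move=> [n an]; exists n; apply: funext => i; rewrite truncE.
by case: ltnP => // /an.
Qed.

Lemma Phi_abs s k : Phi (trunc s k) = Phi (trunc (fun i => `|s i|) k).
Proof.
rewrite {1}/trunc (sn_symmetric Phi_sn (perm_refl _)) /mkseq -map_comp.
by congr Phi.
Qed.

Lemma Phi_norm_eq a b : c_hat a -> (forall i, `|a i| = `|b i|) -> Phi a = Phi b.
Proof.
move=> /c_hatE[n aE] ab.
have bE : b = trunc b n.
  apply: funext => i; rewrite truncE; case: ltnP => // ni.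
  by apply/eqP; rewrite -normr_eq0 -ab aE truncE ltnNge ni /= normr0.
rewrite aE bE Phi_abs [RHS]Phi_abs; congr (Phi (trunc _ _)).
by apply: funext => i; rewrite ab.
Qed.

Lemma Phi_perm (s t : seq R) : perm_eq s t -> Phi (nth 0 s) = Phi (nth 0 t).
Proof.
move=> st; rewrite (sn_symmetric Phi_sn st).
by rewrite -(sn_symmetric Phi_sn (perm_refl _)).
Qed.

Lemma c_hat_sub a b : c_hat b -> (forall i, `|a i| <= `|b i|) -> c_hat a.
Proof.
move=> [n bn] ab; exists n => k nk; apply/eqP; rewrite -normr_le0.
by rewrite (le_trans (ab k)) // bn // normr0.
Qed.

Lemma c_hat_scale (t : R) a : c_hat a -> c_hat (fun i => t * a i).
Proof. by move=> [n an]; exists n => k /an ->; rewrite mulr0. Qed.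

(* Replacing the coordinate [b k] by [t b k], [|t| <= 1], is a convex
   combination of [b] and of [b] with the sign of [b k] changed. *)
Lemma Phi_mono a b : c_hat b -> (forall i, `|a i| <= `|b i|) -> Phi a <= Phi b.
Proof.
(* [c k] has its first k coordinates from [a] and the others from [b], so one coordinate changes at
   a time. *)
move=> cb ab; pose c k i := if (i < k)%N then a i else b i.
have cc k : c_hat (c k).
  apply: (c_hat_sub cb) => i; rewrite /c; by case: ifP.
have step k : Phi (c k.+1) <= Phi (c k).
  have [t [t1 tE]] : exists t, -1 <= t <= 1 /\ a k = t * b k.
    have [bk|bk] := eqVneq (b k) 0.
      exists 0; rewrite mul0r lerN10 ler01; split => //.
      by apply/eqP; rewrite -normr_le0 (le_trans (ab k)) // bk normr0.
    exists (a k / b k); rewrite divfK //; split => //; rewrite -ler_norml.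
    by rewrite normrM normfV ler_pdivrMr ?normr_gt0 // mul1r.
  have /andP[t1l t1r] := t1.
  pose c' i := if i == k then - b k else c k i.
  have cc'E : Phi c' = Phi (c k).
    apply: Phi_norm_eq => [|i].
      apply: (c_hat_sub (cc k)) => i; rewrite /c' /c; case: eqP => // ->.
      by rewrite normrN ltnn.
    by rewrite /c' /c; case: eqP => // ->; rewrite normrN ltnn.
  have cc' : c_hat c'.
    apply: (c_hat_sub (cc k)) => i; rewrite /c' /c; case: eqP => // ->.
    by rewrite normrN ltnn.
  have -> : c k.+1 = (fun i => (1 + t) / 2 * c k i) + (fun i => (1 - t) / 2 * c' i).
    apply: funext => i; rewrite fctE /c' /c ltnS leq_eqVlt.
    case: eqP => [->|ik] /=; first by rewrite ltnn tE; field.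
    by case: ifP => _; field.
  apply: le_trans (sn_triangle Phi_sn (c_hat_scale _ (cc k)) (c_hat_scale _ cc')) _.
  rewrite !(sn_scale Phi_sn) // cc'E !ger0_norm; try lra.
have [n [bn an]] : exists n, (forall i, (n <= i)%N -> b i = 0) /\ (forall i, (n <= i)%N -> a i = 0).
  have [n bn] := cb; exists n; split => // i /bn bi.
  by apply/eqP; rewrite -normr_le0 (le_trans (ab i)) // bi normr0.
have -> : a = c n.
  by apply: funext => i; rewrite /c; case: ltnP => // ni; rewrite bn ?an.
have -> : b = c 0%N by apply: funext => i; rewrite /c ltn0.
by elim: n {bn an} => // n; exact: le_trans (step n).
Qed.

Lemma Phi_trunc_mono s t k : (forall i, (i < k)%N -> 0 <= s i <= t i) ->
  Phi (trunc s k) <= Phi (trunc t k).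
Proof.
move=> st; apply: Phi_mono; first exact: c_hat_trunc.
move=> i; rewrite !truncE; case: ifP => // /st /andP[s0 sti].
by rewrite !ger0_norm // (le_trans s0).
Qed.

Lemma Phi_trunc_leq s j k : (j <= k)%N -> Phi (trunc s j) <= Phi (trunc s k).
Proof.
move=> jk; apply: Phi_mono; first exact: c_hat_trunc.
move=> i; rewrite !truncE; case: ltnP => ij; last by rewrite normr0.
by rewrite (leq_trans ij jk).
Qed.

Lemma Phi_truncZ (r : R) s k : 0 <= r -> Phi (trunc (fun i => r * s i) k) = r * Phi (trunc s k).
Proof.
move=> r0; rewrite -{2}(ger0_norm r0) -(sn_scale Phi_sn) //; last exact: c_hat_trunc.
by congr Phi; apply: funext => i; rewrite !truncE; case: ifP; rewrite ?mulr0.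
Qed.

Lemma Phi_truncD s t k :
  Phi (trunc (fun i => s i + t i) k) <= Phi (trunc s k) + Phi (trunc t k).
Proof.
apply: le_trans (sn_triangle Phi_sn (c_hat_trunc _ _) (c_hat_trunc _ _)).
rewrite le_eqVlt; apply/orP; left; apply/eqP; congr Phi; apply: funext => i.
by rewrite fctE !truncE; case: ifP; rewrite ?addr0.
Qed.

Lemma Phi_trunc0 s : Phi (trunc s 0) = 0.
Proof.
have := sn_scale Phi_sn 0 (c_hat_trunc s 0); rewrite normr0 mul0r => <-.
by congr Phi; apply: funext => i; rewrite truncE mul0r.
Qed.

Lemma Phi_trunc_ge0 s k : 0 <= Phi (trunc s k).
Proof. by apply: (sn_ge0 Phi_sn); exact: c_hat_trunc. Qed.

Lemma Phi_trunc_head s k : 0 <= s 0%N -> s 0%N <= Phi (trunc s k.+1).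
Proof.
move=> s0; apply: le_trans (Phi_trunc_leq s (ltn0Sn k)).
rewrite -[leLHS]mulr1 -[in leLHS](sn_normalized Phi_sn) -[X in X * _](ger0_norm s0).
rewrite -(sn_scale Phi_sn); last exact: c_hat_nth.
rewrite le_eqVlt; apply/orP; left; apply/eqP; congr Phi; apply: funext => -[|i].
  by rewrite truncE mulr1.
by rewrite truncE /= nth_nil mulr0.
Qed.

Lemma perm_interleave s n : perm_eq
  (mkseq (fun i => if odd i then 0 else s i./2) n.*2) (mkseq s n ++ nseq n 0).
Proof.
elim: n => // n IH; rewrite doubleS !mkseqS /= odd_double /= doubleK.
apply/permP => q; have /permP/(_ q) := IH; rewrite -!cats1 /= !count_cat /= => ->.
rewrite ?count_cat ?addn0; lia.
Qed.

Lemma perm_interleave' s n : perm_eq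
  (mkseq (fun i => if odd i then s i./2 else 0) n.*2) (mkseq s n ++ nseq n 0).
Proof.
elim: n => // n IH; rewrite doubleS !mkseqS /= odd_double /= uphalf_double.
apply/permP => q; have /permP/(_ q) := IH; rewrite -!cats1 /= !count_cat /= => ->.
rewrite ?count_cat ?addn0; lia.
Qed.

Lemma nth_cat_nseq0 s n m : nth 0 (mkseq s n ++ nseq m 0) = trunc s n.
Proof.
apply: funext => i; rewrite nth_cat size_mkseq nth_nseq if_same truncE.
by case: ifP => // ik; rewrite nth_mkseq.
Qed.

(** The sequence s_0, s_0, s_1, s_1, ... is the sum of its even and its odd indexed terms, and each
    of these is a permutation of s_0, ..., s_(n-1) padded with zeros. *)
Lemma Phi_double s n : Phi (trunc (fun i => s i./2) n.*2) <= 2 * Phi (trunc s n).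
Proof.
have -> : trunc (fun i => s i./2) n.*2 =
    trunc (fun i => (if odd i then 0 else s i./2) + (if odd i then s i./2 else 0)) n.*2.
  by apply: funext => i; rewrite !truncE; case: ifP => // _; case: odd; rewrite ?add0r ?addr0.
apply: le_trans (Phi_truncD _ _ _) _; rewrite {1 2}/trunc.
rewrite (Phi_perm (perm_interleave s n)) (Phi_perm (perm_interleave' s n)).
by rewrite !nth_cat_nseq0 mulr2n mulrDl mul1r.
Qed.

Lemma Phi_delta n : Phi (trunc (fun i => (i == n)%:R) n.+1) = 1.
Proof.
rewrite -[RHS](sn_normalized Phi_sn) /trunc mkseqS eqxx.
rewrite [mkseq _ n](_ : _ = nseq n 0); last first.
  apply: (@eq_from_nth _ 0); rewrite size_mkseq ?size_nseq // => i ik.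
  by rewrite nth_mkseq // nth_nseq ik ltn_eqF.
have -> : nth 0 [:: 1] = nth 0 (1 :: nseq n (0 : R)).
  by apply: funext => -[|i] //=; rewrite nth_nil nth_nseq if_same.
by apply: Phi_perm => //; rewrite perm_rcons.
Qed.

(** The sequence is a sum of n coordinate vectors, each of norm 1. *)
Lemma Phi_ones n : Phi (trunc (fun=> 1) n) <= n%:R.
Proof.
elim: n => [|n IH]; first by rewrite Phi_trunc0.
rewrite -addn1 natrD; apply: le_trans (lerD IH (lexx _)).
rewrite -[X in _ <= _ + X](Phi_delta n) addn1.
have -> : trunc (fun=> 1) n.+1 = trunc (fun=> 1) n + trunc (fun i => (i == n)%:R) n.+1.
  apply: funext => i; rewrite fctE !truncE ltnS leq_eqVlt.
  by case: eqP => [->|_] /=; rewrite ?ltnn ?add0r //; case: ifP; rewrite addr0.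
by apply: (sn_triangle Phi_sn); exact: c_hat_trunc.
Qed.

End Phi.

(** * The norm of the ideal *)

Section PhiNorm.
Context {R : realType} {H : completeNormedModType R[i]}.
Variable ip : {dot H for Num.conj}.
Hypothesis ip_norm : forall h : H, ip h h = `|h| ^+ 2.
Hypothesis H_infinite : ~ finite_dim [set: H].
Variable Phi : (nat -> R) -> R.
Hypothesis Phi_sn : symmetric_norming Phi.
Implicit Types (x y a b : H -> H) (h : H) (c : R[i]) (r : R).
Local Notation N := (@rnorm R H).
Local Notation sv := (singular_value ip).

(** The bound |x|_Phi <= r for a real r. Taking all [k], zero included, changes nothing since the
    terms increase with [k]. *)
Definition Phi_le (x : H -> H) (r : R) :=
  compact_op x /\ forall k, Phi (trunc (sv x) k) <= r.

Lemma Phi_normP x r : (Phi_norm ip Phi x <= r%:E)%E <-> Phi_le x r.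
Proof.
rewrite /Phi_norm; case: asboolP => cx; last by split=> // -[].
split=> [xr|[_ xr]].
  split => // k; rewrite -lee_fin; apply: le_trans xr.
  apply: (@le_trans _ _ (Phi (trunc (sv x) k.+1))%:E).
    by rewrite lee_fin; exact: Phi_trunc_leq.
  by apply: ereal_sup_ubound; exists k.+1.
by apply: ge_ereal_sup => _ [k _ <-]; rewrite lee_fin; exact: xr.
Qed.

Lemma Phi_norm_ge0 x : (0 <= Phi_norm ip Phi x)%E.
Proof.
rewrite /Phi_norm; case: asboolP => // cx.
apply: (@le_trans _ _ (Phi (trunc (sv x) 1))%:E).
  by rewrite lee_fin; exact: Phi_trunc_ge0.
by apply: ereal_sup_ubound; exists 1%N.
Qed.

Lemma S_PhiP x : S_Phi ip Phi x <-> exists r, Phi_le x r.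
Proof.
split=> [[cx xoo]|[r xr]].
  have := Phi_norm_ge0 x; case E : (Phi_norm ip Phi x) xoo => [r| |] // _ _.
  by exists r; apply/Phi_normP; rewrite E.
split; first by case: xr.
by apply: le_lt_trans (_ : (_ <= r%:E)%E) (ltry _); exact/Phi_normP.
Qed.

Lemma Phi_le_ge0 x r : Phi_le x r -> 0 <= r.
Proof. by move=> [_ /(_ 0%N)]; rewrite Phi_trunc0. Qed.

Lemma Phi_le_widen x r r' : Phi_le x r -> r <= r' -> Phi_le x r'.
Proof. by move=> [cx xr] rr'; split => // k; exact: le_trans (xr k) rr'. Qed.

Lemma Phi_le_opb x r : Phi_le x r -> opb r x.
Proof.
move=> [cx xr]; have [xF _ s0 _ _] := singular_valueP ip_norm H_infinite cx.
have [F [f [g FE]] xF0] := xF 0%N.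
have x0 : opb (sv x 0%N) x.
  by move=> h; have := xF0 h; rewrite !fctE FE big_ord0 subr0.
move=> h; apply: le_trans (x0 h) _; rewrite ler_wpM2r ?rnorm_ge0 //.
by apply: le_trans (xr 1%N); exact: Phi_trunc_head.
Qed.

Lemma approx_comp (x a b : H -> H) : bounded_op a -> bounded_op b ->
  approximable ip x -> approximable ip (a \o x \o b).
Proof.
move=> ba bb [bx xF]; split; first by apply: bounded_comp => //; exact: bounded_comp.
move=> e e0; have [_ [ra ra0 aP]] := (bounded_opP a).1 ba.
have [_ [rb rb0 bP]] := (bounded_opP b).1 bb.
have D0 : 0 < ra * rb + 1 by rewrite ltr_wpDl // mulr_ge0.
have [n [F [Fn xFe]]] := xF _ (divr_gt0 e0 D0).
exists n, (a \o F \o b); split; first exact: rank_le_comp.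
move=> h; rewrite !fctE /= -bopB //; apply: le_trans (aP _) _.
have -> : x (b h) - F (b h) = (x - F) (b h) by [].
apply: le_trans (ler_wpM2l ra0 (xFe _)) _.
apply: le_trans (ler_wpM2l ra0 (ler_wpM2l _ (bP h))) _.
  by rewrite divr_ge0 // ltW.
rewrite !mulrA ler_wpM2r ?rnorm_ge0 //.
have -> : ra * e / (ra * rb + 1) * rb = e * ((ra * rb) / (ra * rb + 1)).
  by field; rewrite gt_eqF.
by rewrite ler_piMr ?(ltW e0) // ler_pdivrMr // mul1r lerDl.
Qed.

(** If [F] approximates [x], then [a \o F \o b] approximates [a \o x \o b] with no larger rank; so
    s_i (a x b) <= ra rb s_i (x) for each i. *)
Lemma Phi_le_comp x a b r ra rb : bounded_op a -> bounded_op b ->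
  0 <= ra -> 0 <= rb -> opb ra a -> opb rb b -> Phi_le x r ->
  Phi_le (a \o x \o b) (ra * r * rb).
Proof.
move=> ba bb ra0 rb0 aP bP [cx xr].
have cy : compact_op (a \o x \o b).
  apply: (approximable_compact ip_norm); apply: approx_comp => //.
  exact/(compactP ip_norm H_infinite).
split => // k; have [xF _ s0 _ _] := singular_valueP ip_norm H_infinite cx.
have [_ ymin y0 _ _] := singular_valueP ip_norm H_infinite cy.
apply: (@le_trans _ _ (Phi (trunc (fun i => ra * rb * sv x i) k))).
  apply: Phi_trunc_mono => // i _; rewrite y0 /=.
  have [F Fi xFs] := xF i; apply: (ymin _ (a \o F \o b)).
  - exact: rank_le_comp.
  - by rewrite !mulr_ge0.
  - move=> h; rewrite !fctE /= -bopB //; apply: le_trans (aP _) _.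
    have -> : x (b h) - F (b h) = (x - F) (b h) by [].
    apply: le_trans (ler_wpM2l ra0 (xFs _)) _.
    apply: le_trans (ler_wpM2l ra0 (ler_wpM2l (s0 i) (bP h))) _.
    rewrite le_eqVlt; apply/orP; left; apply/eqP; ring.
rewrite Phi_truncZ ?mulr_ge0 // [leRHS]mulrAC.
by rewrite ler_wpM2l ?mulr_ge0.
Qed.

Lemma Phi_le_compl x a r ra : bounded_op a -> 0 <= ra -> opb ra a ->
  Phi_le x r -> Phi_le (a \o x) (ra * r).
Proof.
move=> ba ra0 aP xr; have -> : a \o x = a \o x \o id by [].
rewrite -[_ * r]mulr1; apply: Phi_le_comp => //; first exact: bounded_id.
by move=> h; rewrite mul1r.
Qed.

Lemma Phi_le_compr x b r rb : bounded_op b -> 0 <= rb -> opb rb b ->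
  Phi_le x r -> Phi_le (x \o b) (r * rb).
Proof.
move=> bb rb0 bP xr; have -> : x \o b = id \o x \o b by [].
rewrite -[r]mul1r; apply: Phi_le_comp => //; first exact: bounded_id.
by move=> h; rewrite mul1r.
Qed.

(* [s_(2k) (x + y) <= s_k x + s_k y] counts each value twice, hence the factor
   [2]; it spares Ky Fan's inequality. *)
Lemma Phi_le_add x y r r' : Phi_le x r -> Phi_le y r' -> Phi_le (x + y) (2 * (r + r')).
Proof.
move=> [cx xr] [cy yr].
have [xF _ sx0 sxd _] := singular_valueP ip_norm H_infinite cx.
have [yF _ sy0 syd _] := singular_valueP ip_norm H_infinite cy.
have cxy : compact_op (x + y).
  apply: (approximable_compact ip_norm).
  have /(compactP ip_norm H_infinite)[bx xA] := cx.
  have /(compactP ip_norm H_infinite)[by_ yA] := cy.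
  split; first exact: bounded_add.
  move=> e e0; have e2 : 0 < e / 2 by rewrite divr_gt0.
  have [n [F [Fn xFe]]] := xA _ e2; have [m [G [Gm yGe]]] := yA _ e2.
  exists (n + m)%N, (F + G); split; first exact: rank_le_add.
  move=> h; have -> : (x + y - (F + G)) h = (x - F) h + (y - G) h.
    by rewrite !fctE opprD addrACA.
  apply: le_trans (rnormD _ _) _; apply: le_trans (lerD (xFe h) (yGe h)) _.
  by rewrite -mulrDl -splitr.
split => // k.
have [_ zmin z0 zd _] := singular_valueP ip_norm H_infinite cxy.
apply: (@le_trans _ _ (Phi (trunc (fun i => sv x i./2 + sv y i./2) k.*2))).
  apply: le_trans (Phi_trunc_leq Phi_sn _ (_ : k <= k.*2)%N) _.
    by rewrite -addnn leq_addr.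
  apply: Phi_trunc_mono => // i _; rewrite z0 /=.
  have [F Fi xFs] := xF i./2; have [G Gi yGs] := yF i./2.
  apply: (zmin _ (F + G)).
  - apply: (rank_le_widen _ (rank_le_add Fi Gi)).
    by rewrite addnn -[leqRHS]odd_double_half leq_addl.
  - by rewrite addr_ge0.
  - move=> h; have -> : (x + y - (F + G)) h = (x - F) h + (y - G) h.
      by rewrite !fctE opprD addrACA.
    by apply: le_trans (rnormD _ _) _; rewrite mulrDl lerD.
apply: le_trans (Phi_double Phi_sn (fun i => sv x i + sv y i) k) _.
by rewrite ler_pM2l //; apply: le_trans (Phi_truncD Phi_sn _ _ _) (lerD _ _).
Qed.

Lemma Phi_le_adj x r : Phi_le x r -> Phi_le (adj ip x) r.
Proof.
move=> [cx xr]; have [xF _ sx0 sxd _] := singular_valueP ip_norm H_infinite cx.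
have [bx _] := cx.
have adjF k F : rank_le ip k F -> forall e, 0 <= e -> opb e (x - F) ->
    rank_le ip k (adj ip F) /\ opb e (adj ip x - adj ip F).
  move=> Fk e e0 xFe; split; first exact: rank_le_adj.
  have bF := rank_le_bounded ip_norm Fk.
  by rewrite -adj_sub //; apply: opb_adj => //; exact: bounded_sub.
have cy : compact_op (adj ip x).
  apply: (approximable_compact ip_norm); split; first exact: adj_bounded.
  have /(compactP ip_norm H_infinite)[_ xA] := cx.
  move=> e e0; have [n [F [Fn xFe]]] := xA e e0.
  by exists n, (adj ip F); exact: adjF (ltW e0) xFe.
split => // k; have [_ ymin y0 _ _] := singular_valueP ip_norm H_infinite cy.
apply: le_trans (xr k); apply: Phi_trunc_mono => // i _; rewrite y0 /=.
by have [F Fi xFs] := xF i; have [Fi' ?] := adjF _ _ Fi _ (sx0 i) xFs; exact: ymin Fi' _ _.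
Qed.

Lemma rank_le_approx n x : rank_le ip n x -> approximable ip x.
Proof.
move=> xn; split; first exact: (rank_le_bounded ip_norm xn).
move=> e e0; exists n, x; split => // h; rewrite subrr.
by rewrite [X in N X](_ : _ = 0) // rnorm0 mulr_ge0 ?rnorm_ge0 ?ltW.
Qed.

(** At most n singular values are nonzero and each is at most r. A bound [M] replaces n so that it
    may be uniform in the rank. *)
Lemma Phi_le_bound n M x r : rank_le ip n x -> 0 <= r -> opb r x ->
  Phi (trunc (fun=> 1) n) <= M -> Phi_le x (M * r).
Proof.
move=> xn r0 xr nM.
have cx : compact_op x by apply: (approximable_compact ip_norm); exact: rank_le_approx xn.
split => // k; have [_ xmin x0 _ _] := singular_valueP ip_norm H_infinite cx.
apply: (@le_trans _ _ (r * Phi (trunc (fun=> 1) n))); last by rewrite mulrC ler_wpM2r.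
rewrite -Phi_truncZ //; apply: Phi_mono => //; first exact: c_hat_trunc.
move=> i; rewrite !truncE mulr1.
have sr : `|sv x i| <= r.
  rewrite ger0_norm //; apply: (xmin _ 0) => //; first exact: rank_le_zero.
  by rewrite subr0.
case: ltnP => _; last by rewrite normr0.
case: ltnP => ni; first by rewrite (ger0_norm r0).
rewrite normr0 ger0_norm //; apply: (xmin _ x) => //; first exact: rank_le_widen xn.
by move=> h; rewrite subrr [X in N X](_ : _ = 0) // rnorm0 mul0r.
Qed.

Lemma Phi_le_rank n x r : rank_le ip n x -> 0 <= r -> opb r x -> Phi_le x (n%:R * r).
Proof. by move=> xn r0 xr; apply: Phi_le_bound xn r0 xr _; exact: Phi_ones. Qed.

(** If [Phi] is bounded on the sequences (1, ..., 1, 0, ...), the ideal norm is at most a multiple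
    of the operator norm. *)
Lemma Phi_le_compact M x r : compact_op x -> 0 <= r -> opb r x ->
  (forall n, Phi (trunc (fun=> 1) n) <= M) -> Phi_le x (M * r).
Proof.
move=> cx r0 xr nM.
split => // k; have [_ xmin x0 _ _] := singular_valueP ip_norm H_infinite cx.
apply: (@le_trans _ _ (r * Phi (trunc (fun=> 1) k))); last by rewrite mulrC ler_wpM2r.
rewrite -Phi_truncZ //; apply: Phi_trunc_mono => // i _; rewrite x0 mulr1 /=.
apply: (xmin _ 0) => //; first exact: rank_le_zero.
by rewrite subr0.
Qed.

Lemma Phi_leN x r : Phi_le x r -> Phi_le (- x) r.
Proof.
move=> xr; have -> : - x = (fun h => - h) \o x by [].
rewrite -[r]mul1r; apply: Phi_le_compl => //.
  by have := bounded_opp (bounded_id (H := H)).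
by move=> h; rewrite rnormN mul1r.
Qed.

End PhiNorm.

(** * Strong limits of operators *)

Section Limits.
Context {R : realType} {H : completeNormedModType R[i]}.
Local Notation N := (@rnorm R H).

Lemma rcvg_le (u : nat -> H) l (h : H) (r : R) : u @ \oo --> l ->
  (forall n, N (h - u n) <= r) -> N (h - l) <= r.
Proof.
move=> ul ur; apply/ler_addgt0Pr => e e0.
have /rcvgP/(_ e e0)[n _ nP] := ul.
apply: le_trans (rnorm_triangle (u n) _ _) _; rewrite lerD // rdistC ltW //.
by apply: nP => /=.
Qed.

Lemma rcvg_eq (u : nat -> H) l l' : u @ \oo --> l ->
  (forall e : R, 0 < e -> exists n0, forall n, (n0 <= n)%N -> N (l' - u n) <= e) -> l = l'.
Proof.
move=> ul ul'; apply/eqP; rewrite -subr_eq0; apply/eqP/rnorm_eq0/eqP.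
rewrite eq_le rnorm_ge0 andbT; apply/ler_addgt0Pr => e e0; rewrite add0r.
have e2 : 0 < e / 2 by rewrite divr_gt0.
have [n0 n0P] := ul' _ e2; have /rcvgP/(_ _ e2)[n1 _ n1P] := ul.
apply: le_trans (rnorm_triangle (u (maxn n0 n1)) _ _) _.
rewrite [X in _ <= X]splitr; apply: lerD.
  by apply: ltW; apply: n1P; rewrite /= leq_maxr.
by rewrite rdistC; apply: n0P; rewrite leq_maxl.
Qed.

Lemma half_pow_lt (C e : R) : 0 <= C -> 0 < e -> exists n0, forall n, (n0 <= n)%N ->
  C * 2^-1 ^+ n < e.
Proof.
move=> C0 e0; have C1 : 0 < C + 1 by rewrite ltr_wpDl.
have [n0 n0P] := exists_inv_lt (divr_gt0 e0 C1); exists n0 => n /n0P.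
rewrite ltr_pdivlMr // => /(le_lt_trans _); apply.
rewrite mulrC; apply: ler_pM => //; rewrite ?exprn_ge0 ?lerDl //.
rewrite exprVn lef_pV2 ?posrE ?exprn_gt0 // -natrX ler_nat.
exact: ltn_expl.
Qed.

Lemma geometric_cvg (u : nat -> H) (C : R) : 0 <= C ->
  (forall n, N (u n.+1 - u n) <= C * 2^-1 ^+ n) ->
  exists2 l : H, u @ \oo --> l & forall n, N (u n - l) <= 2 * C * 2^-1 ^+ n.
Proof.
move=> C0 uC; have ub n k : N (u n - u (n + k)%N) <= 2 * C * 2^-1 ^+ n.
  suff : N (u n - u (n + k)%N) <= 2 * C * (2^-1 ^+ n - 2^-1 ^+ (n + k)).
    move=> /le_trans; apply; rewrite mulrBr gerBl.
    by rewrite !mulr_ge0 ?exprn_ge0 ?invr_ge0.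
  elim: k => [|k IH]; first by rewrite addn0 !subrr rnorm0 mulr0.
  apply: le_trans (rnorm_triangle (u (n + k)%N) _ _) _.
  have := uC (n + k)%N; rewrite rdistC addnS exprS => h.
  apply: le_trans (lerD IH h) _.
  move: (2^-1 ^+ n) (2^-1 ^+ (n + k)) => a b; lra.
have [l ul] : exists l : H, u @ \oo --> l.
  apply: rseq_cauchy_cvg => e e0.
  have [n0 n0P] := half_pow_lt (mulr_ge0 (ler0n _ 2) C0) (divr_gt0 e0 (ltr0n _ 2)).
  exists n0 => m n mn nn.
  apply: le_lt_trans (rnorm_triangle (u n0) _ _) _; rewrite [ltRHS]splitr rdistC.
  by rewrite -(subnKC mn) -(subnKC nn) ltrD // (le_lt_trans (ub _ _)) // n0P.
exists l => // n; have ul' : u (n + k)%N @[k --> \oo] --> l.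
  by apply: cvg_comp ul; under eq_cvg do rewrite addnC; exact: cvg_addnr.
exact: rcvg_le ul' (ub n).
Qed.

(** Completeness of the bounded operators, for sequences whose steps decrease geometrically; the
    limit is built pointwise. *)
Lemma limit_op (y : nat -> H -> H) (C : R) : 0 <= C ->
  (forall n, bounded_op (y n)) ->
  (forall n, opb (C * 2^-1 ^+ n) (y n.+1 - y n)) ->
  exists y', [/\ bounded_op y', forall h, y n h @[n --> \oo] --> y' h &
    forall n, opb (2 * C * 2^-1 ^+ n) (y n - y')].
Proof.
move=> C0 by_ yC.
have /choice[y' y'P] : forall h, exists l : H, y n h @[n --> \oo] --> l /\
    forall n, N (y n h - l) <= 2 * (C * N h) * 2^-1 ^+ n.
  move=> h; have [|n|l yl lP] := @geometric_cvg (fun n => y n h) (C * N h).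
  - by rewrite mulr_ge0 ?rnorm_ge0.
  - by have := yC n h; rewrite !fctE mulrAC.
  - by exists l.
have y'b n : opb (2 * C * 2^-1 ^+ n) (y n - y').
  move=> h; have [_ /(_ n)] := y'P h; rewrite fctE => /le_trans; apply.
  by rewrite le_eqVlt; apply/orP; left; apply/eqP; ring.
exists y'; split => //; last by move=> h; case: (y'P h).
apply/bounded_opP; split.
  move=> c a b; apply: cvg_unique (proj1 (y'P _)) _ => //.
  rewrite (_ : (fun n => _) = (fun n => c *: y n a + y n b)); last first.
    by apply: funext => n; case: (by_ n) => lin _; rewrite lin.
  by apply: cvgD; [apply: cvgZr|]; case: (y'P a); case: (y'P b).
have [_ [r r0 yr]] := (bounded_opP (y 0%N)).1 (by_ 0%N).
exists (r + 2 * C * 2^-1 ^+ 0); first by rewrite addr_ge0 ?mulr_ge0.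
move=> h; have := y'b 0%N h; rewrite fctE rdistC => h1.
have := rnormD (y' h - y 0%N h) (y 0%N h); rewrite subrK => /le_trans; apply.
by rewrite addrC mulrDl lerD.
Qed.

End Limits.

(** * When the ideal consists of all compact operators *)

Section CompactIdeal.
Context {R : realType} {H : completeNormedModType R[i]}.
Variable ip : {dot H for Num.conj}.
Hypothesis ip_norm : forall h : H, ip h h = `|h| ^+ 2.
Hypothesis H_infinite : ~ finite_dim [set: H].
Variable Phi : (nat -> R) -> R.
Hypothesis Phi_sn : symmetric_norming Phi.
Local Notation N := (@rnorm R H).

Lemma rip_comb (e : nat -> H) k h : orthonormal_upto ip e k ->
  N (comb ip e k h) ^+ 2 = rip ip (comb ip e k h) h.
Proof.
move=> eo; rewrite -(rip_norm ip_norm) /rip {2}/comb (ip_sumr ip) /comb (ip_suml ip).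
congr (complex.Re _); apply: eq_bigr => i _.
rewrite (ipZr ip) -/(comb ip e k h) ip_comb // (ipZl ip) (ipC ip h (e i)) mulrC.
by rewrite conjcK (ipC ip (e i) h).
Qed.

Lemma comb_contract (e : nat -> H) k : orthonormal_upto ip e k -> opb 1 (comb ip e k).
Proof.
move=> eo h; rewrite mul1r.
have := rip_le1 ip_norm (comb ip e k h) h; rewrite -rip_comb // expr2.
have [->|n0] := eqVneq (N (comb ip e k h)) 0; first by rewrite rnorm_ge0.
by rewrite ler_pM2l // lt_neqAle eq_sym n0 rnorm_ge0.
Qed.

(** For the zero operator every unit vector is maximal, so [singular_vectors] just produces an
    orthonormal sequence. *)
Lemma orthonormal_seq : exists e : nat -> H, forall k, orthonormal_upto ip e k.
Proof.
have c0 : compact_op (0 : H -> H).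
  by apply: (approximable_compact ip_norm); exact: rank_le_approx (rank_le0 ip).
by have [e [eo _]] := singular_vectors ip_norm H_infinite c0; exists e.
Qed.

(* Otherwise let [e_k] be a projection of rank [n_k], [Phi (1_{n_k}) > 4^k];
   then [sum_k 2^{-k} e_k] is compact but not in the ideal. *)
Lemma compact_ideal_bound : S_Phi ip Phi = @compact_op R H ->
  exists M, forall n, Phi (trunc (fun=> 1) n) <= M.
Proof.
move=> SK; apply/not_existsP => nM.
have /choice[m mP] : forall k, exists n, 4 ^+ k < Phi (trunc (fun=> 1) n).
  move=> k; have /existsNP[n /negP] := nM (4 ^+ k).
  by rewrite -ltNge => lt_n; exists n.
have [e eo] := orthonormal_seq.
pose y n h := \sum_(k < n) (2^-1 ^+ k)%:C *: comb ip e (m k) h.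
have yS n h : y n.+1 h = y n h + (2^-1 ^+ n)%:C *: comb ip e (m n) h.
  by rewrite /y big_ord_recr.
have yrank n : rank_le ip (\sum_(k < n) m k) (y n).
  elim: n => [|n IH].
    rewrite big_ord0; have -> : y 0%N = 0; last exact: rank_le0.
    by apply: funext => h; rewrite /y big_ord0.
  rewrite big_ord_recr /=; have -> : y n.+1 = y n + ( *:%R (2^-1 ^+ n)%:C \o comb ip e (m n)).
    by apply: funext => h; rewrite fctE yS.
  apply: rank_le_add => //; exists (fun i => e i), (fun i => (2^-1 ^+ n)%:C *: e i) => h.
  by rewrite /= /comb scaler_sumr; apply: eq_bigr => i _; rewrite !scalerA mulrC.
have yb n : bounded_op (y n) by exact: rank_le_bounded (yrank n).
have [x [bx yx xP]] : exists y', [/\ bounded_op y', forall h, y n h @[n --> \oo] --> y' h &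
    forall n, opb (2 * 1 * 2^-1 ^+ n) (y n - y')].
  apply: limit_op => // n h; rewrite !fctE yS addrC addKr rnormZr mul1r.
  rewrite ger0_norm ?exprn_ge0 ?invr_ge0 // ler_wpM2l ?exprn_ge0 ?invr_ge0 //.
  by have := comb_contract (eo (m n)) h; rewrite mul1r.
have cx : compact_op x.
  apply: (approximable_compact ip_norm); split => // eps eps0.
  have [n nP] := half_pow_lt (mulr_ge0 (ler0n R 2) ler01) eps0.
  exists (\sum_(k < n) m k)%N, (y n); split => // h.
  rewrite !fctE rdistC; apply: le_trans (xP n h) _.
  by rewrite ler_wpM2r ?rnorm_ge0 // ltW // nP.
have : S_Phi ip Phi x by rewrite SK.
move=> /(S_PhiP ip Phi_sn)[r [_ xr]].
have r0 : 0 <= r by apply: le_trans (xr 0%N); rewrite Phi_trunc0.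
have [xF _ s0 _ _] := singular_valueP ip_norm H_infinite cx.
(* An operator of rank j annihilates some [h] in the span of e_0, ..., e_j. The k-th summand of [x]
   multiplies [h] by 2^-k and the other summands are positive, so <x h, h> >= 2^-k |h|^2. *)
have sk k j : (j < m k)%N -> 2^-1 ^+ k <= singular_value ip x j.
  move=> jm; have [F Fj xFs] := xF j.
  have [c [i0 ci0] Fc] := rank_le_ker (fun i : 'I_j.+1 => e i) Fj.
  have [h hE] : exists h, h = \sum_(i < j.+1) c i *: e i by eexists.
  rewrite -hE in Fc.
  have eE i i' : ip (e i) (e i') = (i == i')%:R.
    by apply: (eo (maxn i i').+1); rewrite ltnS ?leq_maxl ?leq_maxr.
  have hei (i : nat) (ij : (i < j.+1)%N) : ip h (e i) = c (Ordinal ij).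
    rewrite hE (ip_suml ip) (bigD1 (Ordinal ij)) //= big1 ?addr0.
      by rewrite (ipZl ip) eE eqxx mulr1.
    by move=> i' /negPf ii'; rewrite (ipZl ip) eE -val_eqE /= in ii' *; rewrite ii' mulr0.
  have hei0 (i : nat) : (j < i)%N -> ip h (e i) = 0.
    move=> ji; rewrite hE (ip_suml ip) big1 // => i' _.
    by rewrite (ipZl ip) eE ltn_eqF ?mulr0 // (leq_trans (ltn_ord i')).
  have h0 : h != 0.
    have ce : c i0 = ip h (e i0) by case: i0 {ci0} => i ij; rewrite hei.
    by apply: contraNneq ci0 => h0; rewrite ce h0 (ip0l ip).
  have combh : comb ip e (m k) h = h.
    rewrite /comb -(subnKC jm) big_split_ord /= [X in _ + X]big1 ?addr0.
      rewrite [RHS]hE; apply: eq_bigr => -[i ij] _ /=; by rewrite hei.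
    by move=> i _; rewrite hei0 ?scale0r // leq_addr.
  have Nh := rnorm_gt0 h0.
  have yh n : (k < n)%N -> 2^-1 ^+ k * N h ^+ 2 <= rip ip (y n h) h.
    move=> kn; rewrite /y /rip (ip_suml ip) raddf_sum /= (bigD1 (Ordinal kn)) //=.
    rewrite combh -/(rip ip _ _) (ripZl ip) (rip_norm ip_norm) lerDl.
    apply: sumr_ge0 => i _; rewrite -/(rip ip _ _) (ripZl ip) -rip_comb //.
    by rewrite mulr_ge0 ?sqr_ge0 // exprn_ge0 ?invr_ge0.
  have xh : 2^-1 ^+ k * N h ^+ 2 <= rip ip (x h) h.
    apply/ler_addgt0Pr => d d0; have dN := divr_gt0 d0 Nh.
    have /rcvgP/(_ _ dN)[n1 _ n1P] := yx h.
    have := yh (maxn k.+1 n1) (leq_maxl _ _).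
    set n := maxn k.+1 n1 => /le_trans; apply.
    have -> : y n h = x h - (x h - y n h) by rewrite subKr.
    rewrite (ripDl ip) (ripNl ip) lerD2l; apply: le_trans (ler_norm _) _.
    rewrite normrN; apply: le_trans (rip_le ip_norm _ _) _.
    by rewrite -ler_pdivlMr // ltW // n1P //= leq_maxr.
  have : 2^-1 ^+ k * N h ^+ 2 <= singular_value ip x j * N h ^+ 2.
    apply: le_trans xh _; apply: le_trans (rip_le1 ip_norm _ _) _.
    rewrite expr2 mulrA ler_wpM2r ?rnorm_ge0 //.
    by have := xFs h; rewrite !fctE Fc subr0.
  by rewrite ler_pM2r // exprn_gt0.
(* For 2^k > r + 1, the first m_k singular values give norm at least 2^-k 4^k = 2^k > r. *)
have r1 : 0 < (r + 1)^-1 by rewrite invr_gt0 ltr_wpDl.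
have [k kP] := half_pow_lt ler01 r1.
have := kP k (leqnn k); rewrite mul1r exprVn ltf_pV2 ?posrE ?exprn_gt0 ?ltr_wpDl // => rk.
have : 2 ^+ k <= r.
  apply: le_trans (xr (m k)).
  apply: (@le_trans _ _ (Phi (trunc (fun i => 2^-1 ^+ k * (fun=> 1) i) (m k)))).
    rewrite Phi_truncZ ?exprn_ge0 ?invr_ge0 // -ler_pdivrMl ?exprn_gt0 ?invr_gt0 //.
    rewrite exprVn invrK -exprMn; apply: ltW; have := mP k.
    by have -> : 2 * 2 = 4 :> R by rewrite -natrM.
  apply: Phi_trunc_mono => // i im; rewrite mulr1 sk // andbT.
  by rewrite exprn_ge0 ?invr_ge0.
by move=> /(lt_le_trans rk); rewrite ltNge lerDl ler01.
Qed.

End CompactIdeal.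

(** * The unitary part of an operator close to the identity *)

Section Polar.
Context {R : realType} {H : completeNormedModType R[i]}.
Variable ip : {dot H for Num.conj}.
Hypothesis ip_norm : forall h : H, ip h h = `|h| ^+ 2.
Local Notation N := (@rnorm R H).
Implicit Types (h : H) (r d : R).

Definition self_adjoint (x : H -> H) := forall a b, ip (x a) b = ip a (x b).

Section InvSqrt.
Variables (t : H -> H) (tau : R).
Hypothesis bt : bounded_op t.
Hypothesis ta : self_adjoint t.
Hypothesis tau0 : 0 <= tau.
Hypothesis tau1 : tau <= 8^-1.
Hypothesis ttau : opb tau t.

(* [1 + t b] is [(1 - t)^(-1/2)] iff [b] is a fixed point of this map. *)
Definition sqrt_step (b : H -> H) h : H :=
  (2^-1)%:C *: (h + t (b h) + t (b (h + t (b h))) - t (b (b h))).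

(** The invariants of the iteration. The last clause makes [b] commute with [t], and later with the
    projections. *)
Definition good (b : H -> H) := [/\ bounded_op b, opb 1 b, self_adjoint b &
  forall q, bounded_op q -> q \o t = t \o q -> q \o b = b \o q].

Lemma good_opb b h : good b -> N (b h) <= N h.
Proof. by move=> [_ b1 _ _]; have := b1 h; rewrite mul1r. Qed.

Lemma half_norm h : N ((2^-1)%:C *: h) = N h / 2.
Proof. by rewrite rnormZr ger0_norm ?invr_ge0 // mulrC. Qed.

(** The bound 1/8 on [t] makes the five terms below add up to at most 34/64 of d |h|, which leaves
    room for the contraction factor 1/2. *)
Lemma sqrt_step_contract b b' d : 0 <= d -> good b -> good b' -> opb d (b - b') ->
  opb (d / 2) (sqrt_step b - sqrt_step b').
Proof.
move=> d0 gb gb' bd h; rewrite fctE /sqrt_step.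
have [bb _ _ _] := gb; have [bb' _ _ _] := gb'.
have tb := bopB bt.
(* The difference is telescoped so that each term contains b - b' exactly once. *)
rewrite -[X in N X](_ : (2^-1)%:C *: (t (b h - b' h) + t (b (t (b h - b' h)))
   + t (b (h + t (b' h)) - b' (h + t (b' h))) - t (b (b h - b' h)) - t (b (b' h) - b' (b' h))) = _);
    last first.
  rewrite -[RHS]scalerBr; congr (_ *: _).
  rewrite !(bopD bb, bopN bb, bopD bb', bopN bb', bopD bt, bopN bt).
  apply: (rip_ext ip_norm) => y; by rewrite !(ripDl ip, ripNl ip); ring.
rewrite half_norm; set dh := N (b h - b' h).
have dhE : dh <= d * N h by have := bd h; rewrite fctE.
have dh0 : 0 <= dh by exact: rnorm_ge0.
have tN a : N (t a) <= 8^-1 * N a.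
  by apply: le_trans (ttau a) _; rewrite ler_wpM2r ?rnorm_ge0.
have e1 : N (t (b h - b' h)) <= 8^-1 * dh by exact: tN.
have e2 : N (t (b (t (b h - b' h)))) <= 64^-1 * dh.
  by have := tN (b (t (b h - b' h))); have := good_opb (t (b h - b' h)) gb; lra.
have e3 : N (t (b (h + t (b' h)) - b' (h + t (b' h)))) <= 9 / 64 * (d * N h).
  have h1 := tN (b (h + t (b' h)) - b' (h + t (b' h))).
  have h2 := bd (h + t (b' h)); rewrite fctE in h2.
  have h3 := rnormD h (t (b' h)); have h4 := tN (b' h); have h5 := good_opb h gb'.
  have h6 : d * N (h + t (b' h)) <= d * (9 / 8 * N h) by rewrite ler_wpM2l //; lra.
  by move: h1 h2 h6; lra.
have e4 : N (t (b (b h - b' h))) <= 8^-1 * dh.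
  by have := tN (b (b h - b' h)); have := good_opb (b h - b' h) gb; lra.
have e5 : N (t (b (b' h) - b' (b' h))) <= 8^-1 * (d * N h).
  have h1 := tN (b (b' h) - b' (b' h)).
  have h2 := bd (b' h); rewrite fctE in h2.
  have h3 : d * N (b' h) <= d * N h by rewrite ler_wpM2l // good_opb.
  by lra.
apply: (@le_trans _ _ ((N (t (b h - b' h)) + N (t (b (t (b h - b' h)))) +
   N (t (b (h + t (b' h)) - b' (h + t (b' h)))) + N (t (b (b h - b' h))) +
   N (t (b (b' h) - b' (b' h)))) / 2)).
  rewrite ler_pM2r ?invr_gt0 //.
  apply: le_trans (rnormB _ _) (lerD _ (lexx _)).
  apply: le_trans (rnormB _ _) (lerD _ (lexx _)).
  apply: le_trans (rnormD _ _) (lerD _ (lexx _)).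
  exact: rnormD.
have dN0 : 0 <= d * N h by rewrite mulr_ge0 ?rnorm_ge0.
by rewrite mulrAC; lra.
Qed.

Lemma good0 : good 0.
Proof.
split.
- exact: bounded0.
- by move=> h; rewrite [X in N X](_ : _ = 0) // rnorm0 mul1r rnorm_ge0.
- by move=> a b; rewrite [X in ip X b](_ : _ = 0) // [X in ip a X](_ : _ = 0) // (ip0l ip) (ip0r ip).
- by move=> q bq _; apply: funext => h /=; rewrite [RHS](_ : _ = 0) // [X in q X](_ : _ = 0) // bop0.
Qed.

Lemma good_step b : good b -> good (sqrt_step b).
Proof.
move=> gb; have [bb b1 ba bq] := gb.
have tN a : N (t a) <= 8^-1 * N a.
  by apply: le_trans (ttau a) _; rewrite ler_wpM2r ?rnorm_ge0.
have lin : linear (sqrt_step b).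
  move=> c x y; rewrite /sqrt_step !(bopD bb, bopZ bb, bopD bt, bopZ bt).
  rewrite scalerA [c * _]mulrC -scalerA -scalerDr; congr (_ *: _).
  rewrite !scalerDr !scalerN.
  apply: (rip_ext ip_norm) => z; rewrite !(ripDl ip, ripNl ip); ring.
have o1 : opb 1 (sqrt_step b).
  move=> h; rewrite mul1r /sqrt_step half_norm.
  have h1 := good_opb h gb; have h2 := tN (b h).
  have h3 := tN (b (h + t (b h))); have h4 := good_opb (h + t (b h)) gb.
  have h5 := rnormD h (t (b h)).
  have h6 := tN (b (b h)); have h7 := good_opb (b h) gb.
  have h8 := rnormB (h + t (b h) + t (b (h + t (b h)))) (t (b (b h))).
  have h9 := rnormD (h + t (b h)) (t (b (h + t (b h)))).
  have h0 := rnorm_ge0 h; lra.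
have btq : b \o t = t \o b by apply/esym; exact: bq bt _.
have tbE a : t (b a) = b (t a) by have := congr1 (fun f => f a) btq.
split.
- by apply/bounded_opP; split => //; exists 1.
- exact: o1.
- have taa : self_adjoint (fun a => t (b a)).
    by move=> x y; rewrite ta ba tbE.
  move=> x y; rewrite /sqrt_step (ipZl ip) (ipZr ip).
  have -> : ((2^-1)%:C)^*%C = (2^-1)%:C :> R[i] by exact: conjc_real.
  congr (_ * _); rewrite !(ipBl ip, ipDl ip, ipBr ip, ipDr ip) !(bopD bb, bopD bt, ipDl ip, ipDr ip).
  have e1 : ip (t (b x)) y = ip x (t (b y)) by exact: taa.
  have e2 : ip (t (b (t (b x)))) y = ip x (t (b (t (b y)))) by rewrite (taa (t (b x))) taa.
  have e3 : ip (t (b (b x))) y = ip x (t (b (b y))).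
    by rewrite (taa (b x)) ba -!tbE.
  by rewrite e1 e2 e3.
- move=> q bdq qt; have qb := bq q bdq qt.
  have qtE a : q (t a) = t (q a) by have := congr1 (fun f => f a) qt.
  have qbE a : q (b a) = b (q a) by have := congr1 (fun f => f a) qb.
  apply: funext => h; rewrite /= /sqrt_step (bopZ bdq) !(bopB bdq, bopD bdq).
  by rewrite !(qtE, qbE, bopD bdq).
Qed.

(* [b] is [((1 - t)^(-1/2) - 1) / t]. *)
Lemma inv_sqrt : exists b, good b /\
  forall h, let z h' := h' + t (b h') in z (z h) - t (z (z h)) = h.
Proof.
pose bn n := iter n sqrt_step 0.
have gn n : good (bn n) by elim: n => [|n IH]; [exact: good0|exact: good_step].
have dn n : opb (2^-1 ^+ n) (bn n.+1 - bn n).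
  elim: n => [|n IH].
    rewrite expr0 subr0; by have [] := gn 1%N.
  rewrite exprSr; apply: (sqrt_step_contract _ (gn n.+1) (gn n) IH).
  by rewrite exprn_ge0 ?invr_ge0.
have [b [bb bnb bP]] : exists y', [/\ bounded_op y',
    forall h, bn n h @[n --> \oo] --> y' h &
    forall n, opb (2 * 1 * 2^-1 ^+ n) (bn n - y')].
  by apply: limit_op => // n; [case: (gn n)|rewrite mul1r].
rewrite mulr1 in bP.
have gb : good b.
  split => //.
  - move=> h; rewrite mul1r -rnormN -sub0r; apply: rcvg_le (bnb h) _ => n.
    by rewrite sub0r rnormN good_opb.
  - move=> x y; apply/eqP; rewrite -subr_eq0; apply/eqP/Normc.eq0_normc/eqP.
    have nc_ge0 (z : R[i]) : 0 <= Normc.normc z.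
      by rewrite -ler0c -[(Normc.normc z)%:C]/`|z| normr_ge0.
    rewrite eq_le nc_ge0 andbT; apply/ler_addgt0Pr => e e0; rewrite add0r.
    have [n nP] := half_pow_lt (mulr_ge0 (ler0n R 4) (mulr_ge0 (rnorm_ge0 x) (rnorm_ge0 y))) e0.
    have {nP} := nP n (leqnn n).
    have [_ _ ba _] := gn n.
    have -> : ip (b x) y - ip x (b y) = ip x (bn n y - b y) - ip (bn n x - b x) y.
      by rewrite (ipBl ip) (ipBr ip) ba opprB addrCA addrAC subrr add0r addrC.
    move=> lt_e; apply: le_trans (ltW lt_e).
    apply: le_trans (le_normcD _ _) _; rewrite normcN.
    have h1 := normc_ip_le ip_norm x (bn n y - b y).
    have h2 := normc_ip_le ip_norm (bn n x - b x) y.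
    have h3 := ler_wpM2l (rnorm_ge0 x) (bP n y).
    have h4 := ler_wpM2r (rnorm_ge0 y) (bP n x).
    rewrite !fctE in h3 h4; move: (2^-1 ^+ n) h1 h2 h3 h4 => w; lra.
  - move=> q bq qt; apply: funext => h /=.
    apply: cvg_unique (bop_cvg bq (bnb h)) _ => //.
    have -> : (fun n => q (bn n h)) = (fun n => bn n (q h)); last exact: bnb.
    apply: funext => n; have [_ _ _ /(_ q bq qt) qb] := gn n.
    by have := congr1 (fun f => f h) qb.
have fixb h : b h = sqrt_step b h.
  apply: (@rcvg_eq _ _ (fun n => bn n.+1 h)).
    by have := bnb h; rewrite -(cvg_shiftS (fun n => bn n h)).
  move=> e e0; have [n0 n0P] := half_pow_lt (rnorm_ge0 h) e0.
  exists n0 => n /n0P /ltW; apply: le_trans.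
  have bnP : opb (2 * 2^-1 ^+ n) (b - bn n).
    by move=> h'; have := bP n h'; rewrite !fctE rdistC.
  have d0 : 0 <= 2 * 2^-1 ^+ n :> R by rewrite mulr_ge0 ?exprn_ge0 ?invr_ge0.
  have := sqrt_step_contract d0 gb (gn n) bnP h; rewrite fctE => /le_trans; apply.
  by rewrite mulrC mulrAC divff // mul1r.
exists b; split => // h z.
have [_ _ _ bq] := gb.
have btq : b \o t = t \o b by apply/esym; exact: bq bt _.
have tbE a : t (b a) = b (t a) by have := congr1 (fun f => f a) btq.
(* Twice the fixed point equation, composed with [t]: this is (1 - t) (1 + t b)^2 = 1 expanded, once
   [t] and [b] commute. *)
have tb2 : t (b h) + t (b h) = t (h + t (b h) + t (b (h + t (b h))) - t (b (b h))).
  rewrite -bopD // [in LHS]fixb /sqrt_step -scalerDl -rmorphD /=.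
  have -> : 2^-1 + 2^-1 = 1 :> R by field.
  by rewrite scale1r.
rewrite /z !(bopD bb, bopN bb, bopD bt, bopN bt) in tb2 *.
rewrite -!tbE in tb2 *; apply: (rip_ext ip_norm) => y.
move/(congr1 (fun a => rip ip a y)): tb2.
by rewrite !(ripDl ip, ripNl ip); lra.
Qed.

End InvSqrt.
End Polar.

(** * The polar decomposition inside the ideal *)

Section PolarUnitary.
Context {R : realType} {H : completeNormedModType R[i]}.
Variable ip : {dot H for Num.conj}.
Hypothesis ip_norm : forall h : H, ip h h = `|h| ^+ 2.
Hypothesis H_infinite : ~ finite_dim [set: H].
Variable Phi : (nat -> R) -> R.
Hypothesis Phi_sn : symmetric_norming Phi.
Local Notation N := (@rnorm R H).
Implicit Types (h : H) (r d : R).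

Lemma opbD r r' (x y : H -> H) : opb r x -> opb r' y -> opb (r + r') (x + y).
Proof.
move=> xr yr h; rewrite fctE mulrDl; apply: le_trans (rnormD _ _) _.
exact: lerD (xr h) (yr h).
Qed.

Lemma opbN r (x : H -> H) : opb r x -> opb r (- x).
Proof. by move=> xr h; rewrite fctE rnormN. Qed.

Lemma opbM r r' (x y : H -> H) : 0 <= r -> opb r x -> opb r' y -> opb (r * r') (x \o y).
Proof.
move=> r0 xr yr h /=; apply: le_trans (xr _) _; rewrite -mulrA.
exact: ler_wpM2l.
Qed.

Lemma opb_widen r r' (x : H -> H) : r <= r' -> opb r x -> opb r' x.
Proof. by move=> rr' xr h; apply: le_trans (xr h) _; rewrite ler_wpM2r ?rnorm_ge0. Qed.

(** A vector [h0] orthogonal to the range of the isometry [w] is orthogonal to w h0, which has the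
    same norm; so |w h0 - h0|^2 = 2 |h0|^2, and the bound 1 forces h0 = 0. *)
Lemma isometry_near_id_unitary (w : H -> H) : bounded_op w ->
  adj ip w \o w = id -> opb 1 (w - id) -> unitary_op ip w.
Proof.
move=> bw ww w1; split => //; apply: funext => h /=; apply/eqP.
have wwE a : adj ip w (w a) = a by have := congr1 (fun f => f a) ww.
rewrite eq_sym -subr_eq0; set h0 := h - _; apply/eqP/rnorm_eq0.
have o : rip ip (w h0) h0 = 0.
  rewrite (ripC ip) /rip -(adjE' ip_norm bw) /h0 (bopB (adj_bounded ip_norm bw)) wwE.
  by rewrite subrr (ip0l ip).
have Nw : N (w h0) ^+ 2 = N h0 ^+ 2.
  by rewrite -!(rip_norm ip_norm) /rip -(adjE' ip_norm bw) wwE.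
have := w1 h0; rewrite !fctE mul1r -(@ler_pXn2r _ 2) ?nnegrE ?rnorm_ge0 //.
rewrite (sqr_rnormB ip_norm) o mulr0 subr0 Nw gerDl => h00.
by apply/eqP; rewrite -[_ == _](expf_eq0 _ 2) eq_le h00 sqr_ge0.
Qed.

(** Here z = (v^* v)^(-1/2) = 1 + t b with t = 1 - v^* v, which is in the ideal along with v - 1;
    hence so is v z - 1 = v t b + (v - 1). The bound 1/32 on d gives |t| <= 4 d <= 1/8 as [inv_sqrt]
    requires, and 64 is a generous constant. The last clause will show that [z] commutes with the
    p_i. *)
Lemma polar_unitary (v : H -> H) (d k : R) : bounded_op v -> 0 <= d -> d <= 32^-1 ->
  opb d (v - id) -> Phi_le ip Phi (v - id) k ->
  exists z, [/\ bounded_op z, unitary_op ip (v \o z),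
    Phi_le ip Phi (v \o z - id) (64 * k),
    (exists r, Phi_le ip Phi (z - id) r) &
    forall q, bounded_op q -> q \o (adj ip v \o v) = (adj ip v \o v) \o q -> q \o z = z \o q].
Proof.
move=> bv d0 d32 vd vk; pose r := v - id.
have br : bounded_op r by apply: bounded_sub => //; exact: bounded_id.
have bv' := adj_bounded ip_norm bv; have br' := adj_bounded ip_norm br.
have vE h : v h = h + r h by rewrite -[r h]/(v h - h) addrC subrK.
have v'E h : adj ip v h = h + adj ip r h.
  have -> : adj ip r = adj ip v - id.
    by rewrite -[X in _ = _ - X](adj_id ip_norm) -adj_sub //; exact: bounded_id.
  by rewrite -[(_ - _) h]/(adj ip v h - h) addrC subrK.
pose t := - (r + adj ip r + (adj ip r \o r)).
have bt : bounded_op t.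
  by apply: bounded_opp; apply: bounded_add; [apply: bounded_add|apply: bounded_comp].
have tE h : t h = h - adj ip v (v h).
  rewrite v'E [in adj _ _ _]vE (bopD br') [in RHS]vE /t !fctE /=.
  by apply: (rip_ext ip_norm) => y; rewrite !(ripDl ip, ripNl ip); ring.
have vvE h : adj ip v (v h) = h - t h by rewrite tE subKr.
have r'd : opb d (adj ip r) by exact: opb_adj.
have td : opb (4 * d) t.
  apply: (@opb_widen (d + d + d * d)); first nra.
  by apply/opbN/opbD; [exact: opbD|exact: opbM].
have ta : self_adjoint ip t.
  move=> a b; rewrite !tE (ipBl ip) (ipBr ip); congr (_ - _).
  by rewrite (adjE' ip_norm bv) (adjE ip_norm bv).
have d4 : 0 <= 4 * d by rewrite mulr_ge0.
have d4' : 4 * d <= 8^-1 by lra.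
have [b [[bb b1 ba bq] zP]] := inv_sqrt ip_norm bt ta d4' td.
pose z := id + (t \o b).
have btb : bounded_op (t \o b) by exact: bounded_comp.
have bz : bounded_op z by apply: bounded_add => //; exact: bounded_id.
have zE h : z h = h + t (b h) by [].
have btq : b \o t = t \o b by apply/esym; exact: bq bt _.
have tbE a : t (b a) = b (t a) by have := congr1 (fun f => f a) btq.
have za a c : ip (z a) c = ip a (z c).
  by rewrite !zE (ipDl ip) (ipDr ip) ta ba tbE.
have zt h : z (t h) = t (z h) by rewrite !zE (bopD bt) -tbE.
have adjz : adj ip z = z by exact: adj_eq.
have vb2 : opb 2 v.
  have -> : v = id + r by apply: funext => h; rewrite fctE vE.
  by apply: (@opb_widen (1 + d)); [lra|apply: opbD => // h; rewrite mul1r].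
have tbd : opb (4 * d * 1) (t \o b) by exact: opbM.
have WE : v \o z - id = v \o (t \o b) + r.
  apply: funext => h; change (v (z h) - h = v (t (b h)) + (v h - h)).
  by rewrite zE (bopD bv) [v h + _]addrC -addrA.
have Pt : Phi_le ip Phi t (10 * k).
  have k0 := Phi_le_ge0 Phi_sn vk.
  have Pr' := Phi_le_adj ip_norm H_infinite Phi_sn vk.
  apply: (Phi_le_widen (r := 2 * (2 * (k + k) + d * k))); last nra.
  apply: Phi_leN => //; apply: Phi_le_add => //; first exact: Phi_le_add.
  exact: Phi_le_compl.
have Ptb : Phi_le ip Phi (t \o b) (10 * k).
  by rewrite -[10 * k]mulr1; apply: Phi_le_compr.
exists z; split => //.
- apply: isometry_near_id_unitary; first exact: bounded_comp.
    rewrite (adj_comp ip_norm bv bz) adjz; apply: funext => h /=.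
    by rewrite vvE bopB // zt; exact: zP.
  rewrite WE; apply: (@opb_widen (2 * (4 * d * 1) + d)); first lra.
  by apply: opbD => //; apply: opbM.
- rewrite WE; have k0 := Phi_le_ge0 Phi_sn vk.
  apply: (Phi_le_widen (r := 2 * (2 * (10 * k) + k))); last lra.
  by apply: Phi_le_add => //; apply: Phi_le_compl.
- exists (10 * k); have -> : z - id = t \o b; last by [].
  by apply: funext => h; rewrite -[LHS]/(z h - h) zE addrC addKr.
- move=> q bq' qv; have qt : q \o t = t \o q.
    apply: funext => h /=; rewrite !tE (bopB bq'); congr (_ - _).
    by have := congr1 (fun f => f h) qv.
  have qb := bq q bq' qt; apply: funext => h /=; rewrite !zE (bopD bq'); congr (_ + _).
  have := congr1 (fun f => f (b h)) qt; rewrite /= => ->.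
  by have := congr1 (fun f => f h) qb; rewrite /= => ->.
Qed.

End PolarUnitary.

(** * Coverings of homogeneous spaces *)

Section EdistTopology.
Context {R : realType} {T : Type} {d : T -> T -> \bar R} {K : R}.
Hypothesis K0 : 0 < K.
Hypothesis dxx : forall x, d x x = 0%E.
Hypothesis d_triangle : forall x y z (e : R), 0 < e ->
  (d x y < e%:E)%E -> (d y z < e%:E)%E -> (d x z < (K * e)%:E)%E.

(** An open set of the subspace has to be extended to the whole space: [B] collects the points, in
    [S] or not, with a ball that meets [S] inside [A]. A triangle inequality with a constant is
    enough to make [B] open. *)
Lemma edist_open_subspace (S : set (edist_space d)) (A : set (set_type S)) :
  open A <-> forall x : set_type S, A x ->
    exists2 e : R, 0 < e & forall y : set_type S, (d (val x) (val y) < e%:E)%E -> A y.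
Proof.
split=> [[B oB <-] x Bx|Aop].
  by have [e e0 eB] := oB _ Bx; exists e => // y xy; exact: eB.
pose B : set (edist_space d) := [set y | exists2 e : R, 0 < e &
  forall z (zS : z \in S), (d y z < e%:E)%E -> A (exist _ z zS)].
exists B.
  move=> y [e e0 eA]; exists (e / K) => [|y' yy']; first by rewrite divr_gt0.
  exists (e / K) => [|z zS y'z]; first by rewrite divr_gt0.
  apply: eA; have := d_triangle (divr_gt0 e0 K0) yy' y'z.
  by rewrite mulrC divfK ?gt_eqF.
apply/seteqP; split=> x.
  move=> [e e0 eA]; case: x eA => x xS /= eA; apply: eA.
  by rewrite set_valE /= dxx lte_fin.
move=> /Aop[e e0 eA]; exists e => // z zS xz; exact: eA.
Qed.

End EdistTopology.

(** * Maps between quotients of a group *)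

Section Covering.
Context {G X Y : topologicalType}.
Variables (mul : G -> G -> G) (inv : G -> G) (one : G).
Hypothesis mulA : forall a b c, mul a (mul b c) = mul (mul a b) c.
Hypothesis mul1g : forall a, mul one a = a.
Hypothesis mulg1 : forall a, mul a one = a.
Hypothesis mulVg : forall a, mul (inv a) a = one.
Hypothesis mulgV : forall a, mul a (inv a) = one.
Hypothesis open_mulr : forall (A : set G) g, open A -> open [set u | A (mul u g)].

Let mulKg a b : mul (inv a) (mul a b) = b.
Proof. by rewrite mulA mulVg mul1g. Qed.
Let mulVKg a b : mul a (mul (inv a) b) = b.
Proof. by rewrite mulA mulgV mul1g. Qed.
Let mulgK a b : mul (mul a b) (inv b) = a.
Proof. by rewrite -mulA mulgV mulg1. Qed.
Let mulgVK a b : mul (mul a (inv b)) b = a.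
Proof. by rewrite -mulA mulVg mulg1. Qed.

Section Orbit.
Context {Z : topologicalType}.
Variable q : G -> Z.
Hypothesis q_open : forall A, open A <-> open (q @^-1` A).
Hypothesis q_mul : forall u v g, q u = q v -> q (mul g u) = q (mul g v).

Definition translates (M : set G) (x : Z) : set Z :=
  [set z | exists m u, [/\ M m, q u = x & z = q (mul m u)]].

(** The preimage in [G] is the union of the right translates M u over the fiber of x. *)
Lemma open_translates M x : open M -> open (translates M x).
Proof.
move=> oM; apply/q_open.
have -> : q @^-1` translates M x =
    \bigcup_(u in [set u | q u = x]) [set v | M (mul v (inv u))].
  apply/seteqP; split=> [v [m [u [Mm ux vE]]]|v [u /= ux Mvu]].
    have wE : q (mul (inv m) v) = x by rewrite (q_mul (inv m) vE) mulKg.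
    exists (mul (inv m) v) => //=.
    by rewrite -{1}(mulVKg m v) mulgK.
  by exists (mul v (inv u)), u; split => //; rewrite mulgVK.
by apply: bigcup_open => u _; exact: open_mulr.
Qed.

End Orbit.

Variables (qX : G -> X) (qY : G -> Y) (f : X -> Y) (M : set G).
Hypothesis qX_surj : forall x, exists u, qX u = x.
Hypothesis qY_surj : forall y, exists u, qY u = y.
Hypothesis qX_open : forall A, open A <-> open (qX @^-1` A).
Hypothesis qY_open : forall A, open A <-> open (qY @^-1` A).
Hypothesis qX_mul : forall u v g, qX u = qX v -> qX (mul g u) = qX (mul g v).
Hypothesis qY_mul : forall u v g, qY u = qY v -> qY (mul g u) = qY (mul g v).
Hypothesis fE : forall u, f (qX u) = qY u.
Hypothesis open_M : open M.
Hypothesis M1 : M one.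
(* The stabilizer of a point of [X] is open in the stabilizer of its image. *)
Hypothesis M_small : forall m m' u, M m -> M m' ->
  qY (mul m u) = qY (mul m' u) -> qX (mul m u) = qX (mul m' u).

Let qYX u v : qX u = qX v -> qY u = qY v.
Proof. by rewrite -!fE => ->. Qed.

Let f_continuous : continuous f.
Proof.
apply/continuousP => A oA; apply/qX_open.
rewrite (_ : _ @^-1` _ = qY @^-1` A); first exact/qY_open.
by apply/seteqP; split=> u /=; rewrite fE.
Qed.

Let f_open (B : set X) : open B -> open (f @` B).
Proof.
move=> /qX_open oB; apply/qY_open.
(* The saturation of the preimage of [B] is a union of right translates by the inverses of elements
   v^-1 w with qY v = qY w. *)
have -> : qY @^-1` (f @` B) = \bigcup_(vw in [set vw : G * G | qY vw.1 = qY vw.2])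
    [set v | (qX @^-1` B) (mul v (mul (inv vw.1) vw.2))].
  apply/seteqP; split=> [v [x Bx fx]|v' [[v w] /= vw Bv']].
    have [w wx] := qX_surj x; exists (v, w) => /=.
      by rewrite -fx -wx fE.
    by rewrite mulVKg wx.
  exists (qX (mul v' (mul (inv v) w))) => //; rewrite fE.
  by rewrite !mulA (qY_mul _ (esym vw)) mulgVK.
by apply: bigcup_open => u _; exact: open_mulr.
Qed.

(** The neighborhood of y is the image of M u for u over y, and its sheets are the images of M u in
    [X], indexed by the points of the fiber. [M_small] makes the sheets disjoint and f injective on
    each; the openness of f makes the inverses continuous. *)
Lemma covering_quotient : covering_map f.
Proof.
split => //.
  apply/seteqP; split => // y _; have [u <-] := qY_surj y.
  by exists (qX u).
move=> y; pose U := translates qY M y.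
have oU : open U by exact: open_translates.
have [u0 u0y] := qY_surj y.
exists U; split; first by split => //; exists one, u0; split => //; rewrite mul1g.
exists {x : X | f x = y}, (fun x => translates qX M (sval x)).
have fib u : qY u = y -> f (qX u) = y by rewrite fE.
split.
- by move=> x; exact: open_translates.
- move=> [x1 x1y] [x2 x2y] _ _ [_ [[m1 [u1 [Mm1 /= u1x ->]]] [m2 [u2 [Mm2 /= u2x e]]]]].
  apply/eq_sig_hprop => /=; first by move=> *; exact: Prop_irrelevance.
  (* A representative of x2 chosen so that m2 u2' = m1 u1. It and u1 lie over y, so m1 u1 and m2 u1
     agree in [Y], hence in [X] by [M_small]. *)
  pose u2' := mul (inv m2) (mul m1 u1).
  have u2'E : qX u2' = x2 by rewrite -u2x (qX_mul _ e) mulKg.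
  have y1 : qY u1 = y by rewrite -fE u1x.
  have y2 : qY u2' = y by rewrite -fE u2'E.
  have : qY (mul m1 u1) = qY (mul m2 u1).
    by rewrite (qY_mul m2 (etrans y1 (esym y2))) mulVKg.
  move=> /(M_small Mm1 Mm2) e'; rewrite -u1x -u2'E /u2' (qX_mul _ e').
  by rewrite mulKg.
- apply/seteqP; split=> [x [m [u [Mm uy]]]|x [[x0 x0y] _ [m [u [Mm /= ux ->]]]]].
    have [v <-] := qX_surj x; rewrite fE => e.
    have vy : qY (mul (inv m) v) = y by rewrite (qY_mul _ e) mulKg.
    exists (exist (fun x => f x = y) _ (fib _ vy)) => //=.
    by exists m, (mul (inv m) v); split => //; rewrite mulVKg.
  by exists m, u; split => //; rewrite -?fE ?ux // fE.
move=> [x xy] /=; have [ux uxx] := qX_surj x; set V := translates qX M x.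
have uxy : qY ux = y by rewrite -fE uxx.
have /choice[g gP] : forall y', exists x', U y' ->
    exists m u, [/\ M m, qY u = y, y' = qY (mul m u) & x' = qX (mul m ux)].
  move=> y'; have [[m [u [Mm uy y'E]]]|nUy'] := pselect (U y').
    by exists (qX (mul m ux)) => _; exists m, u.
  by exists x.
have fV x' : V x' -> U (f x') /\ g (f x') = x'.
  move=> [m [u [Mm ux' ->]]].
  have Ufx : U (f (qX (mul m u))).
    by exists m, u; split; rewrite -?fE ?ux' // fE.
  split => //; have [m' [u' [Mm' u'y e ->]]] := gP _ Ufx.
  rewrite (qX_mul m (etrans ux' (esym uxx))); apply/esym/M_small => //.
  rewrite (qY_mul m' (etrans uxy (esym u'y))) -e fE; apply: qY_mul.
  by apply: qYX; rewrite ux' uxx.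
have gU y' : U y' -> V (g y') /\ f (g y') = y'.
  move=> /gP[m [u [Mm uy -> ->]]]; split; first by exists m, ux.
  by rewrite fE; apply: qY_mul; rewrite uxy uy.
exists g; split => //; first exact: continuous_subspaceT.
rewrite continuous_open_subspace // => y' /set_mem Uy' A.
rewrite nbhsE => -[A0 [oA0 A0g] A0A].
have oV : open V by exact: open_translates.
rewrite /= nbhsE; exists (f @` (A0 `&` V)).
  split; first by apply: f_open; exact: openI.
  by have [Vg fg] := gU _ Uy'; exists (g y').
move=> _ [x' [A0x Vx] <-] /=; apply: A0A.
by have [_ ->] := fV _ Vx.
Qed.

End Covering.

(** * Pinchings *)

Section Projections.
Context {R : realType} {H : completeNormedModType R[i]}.
Variable ip : {dot H for Num.conj}.
Hypothesis ip_norm : forall h : H, ip h h = `|h| ^+ 2.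
Local Notation N := (@rnorm R H).
Implicit Types (h : H).

Lemma rcvg_cst (u : nat -> H) l a n0 : u @ \oo --> l ->
  (forall n, (n0 <= n)%N -> u n = a) -> l = a.
Proof.
move=> ul ua; apply: (rcvg_eq ul) => e e0.
by exists n0 => n /ua ->; rewrite subrr rnorm0 ltW.
Qed.

Lemma proj_contract (q : H -> H) : bounded_op q -> q \o q = q -> self_adjoint ip q ->
  opb 1 q.
Proof.
move=> bq qq qa h; rewrite mul1r.
have qqE : q (q h) = q h by have := congr1 (fun f => f h) qq.
have : N (q h) ^+ 2 <= N h * N (q h).
  have -> : N (q h) ^+ 2 = rip ip h (q h) by rewrite -(rip_norm ip_norm) /rip qa qqE.
  exact: rip_le1.
have [->|n0] := eqVneq (N (q h)) 0; first by rewrite rnorm_ge0.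
by rewrite expr2 ler_pM2r // lt_neqAle eq_sym n0 rnorm_ge0.
Qed.

Lemma hermitian_projectionP (q : H -> H) : hermitian_projection ip q ->
  [/\ bounded_op q, forall h, q (q h) = q h, self_adjoint ip q & opb 1 q].
Proof.
move=> [bq qq qa]; have sq : self_adjoint ip q by move=> a b; rewrite (adjE ip_norm bq) qa.
by split => // [h|]; [exact: (congr1 (fun f => f h) qq)|exact: proj_contract].
Qed.

Variables (w : option nat) (p : nat -> H -> H).
Hypothesis p_proj : orthogonal_projections ip w p.
Hypothesis p0E : complement_projection w p.
Local Notation fam := (in_family w).

Let bp i : fam i -> bounded_op (p i).
Proof. by move=> /(proj1 p_proj)/hermitian_projectionP[]. Qed.
Let pp i h : fam i -> p i (p i h) = p i h.
Proof. by move=> /(proj1 p_proj)/hermitian_projectionP[]. Qed.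
Let pa i : fam i -> self_adjoint ip (p i).
Proof. by move=> /(proj1 p_proj)/hermitian_projectionP[]. Qed.
Let pij i j h : fam i -> fam j -> i <> j -> p i (p j h) = 0.
Proof. by move=> fi fj ij; have := congr1 (fun f => f h) ((proj2 p_proj) i j fi fj ij). Qed.

Definition psum n h := \sum_(1 <= i < n.+1 | fam i) p i h.

Lemma psum_proj n j h : fam j -> (j <= n)%N -> p j (psum n h) = p j h.
Proof.
move=> fj jn; have j1 : (1 <= j)%N by case/andP: fj.
rewrite /psum (bop_sum (bp fj)) big_mkcond (bigD1_seq j) ?iota_uniq //=; last first.
  by rewrite mem_index_iota j1.
rewrite fj pp // big1 ?addr0 // => i /eqP ij; case: ifP => // fi.
by apply: pij => //; exact: nesym.
Qed.

Lemma proj_psum n j h : fam j -> (j <= n)%N -> psum n (p j h) = p j h.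
Proof.
move=> fj jn; have j1 : (1 <= j)%N by case/andP: fj.
rewrite /psum big_mkcond (bigD1_seq j) ?iota_uniq //=; last first.
  by rewrite mem_index_iota j1.
by rewrite fj pp // big1 ?addr0 // => i /eqP ij; case: ifP => // fi; exact: pij.
Qed.

Lemma bounded_psum n : bounded_op (psum n).
Proof.
rewrite (_ : psum n = \sum_(1 <= i < n.+1 | fam i) p i).
  elim/big_ind : _ => [|x y|i fi]; [exact: bounded0|exact: bounded_add|exact: bp].
by apply: funext => h; rewrite /psum fct_sumE.
Qed.

Lemma psum_idem n h : psum n (psum n h) = psum n h.
Proof.
rewrite {1}/psum big_seq_cond [RHS]/psum [RHS]big_seq_cond.
apply: eq_bigr => j /andP[]; rewrite mem_index_iota ltnS => /andP[_ jn] fj.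
exact: psum_proj.
Qed.

Lemma psum_self_adjoint n : self_adjoint ip (psum n).
Proof.
by move=> a b; rewrite /psum (ip_suml ip) (ip_sumr ip); apply: eq_bigr => i fi; exact: pa.
Qed.

Lemma psum_contract n : opb 1 (psum n).
Proof.
apply: proj_contract; [exact: bounded_psum| |exact: psum_self_adjoint].
by apply: funext => h /=; exact: psum_idem.
Qed.

Let p0 := p 0%N.

Lemma psum_cvg h : psum n h @[n --> \oo] --> h - p0 h.
Proof. exact: p0E. Qed.
Arguments psum_cvg : clear implicits.

(** [p 0] is given only through a strong limit; this and the next lemmas derive from the partial
    sums that it is an orthogonal projection. *)
Lemma p0_linear : linear p0.
Proof.
move=> c a b; suff : c *: a + b - p0 (c *: a + b) = c *: (a - p0 a) + (b - p0 b).
  rewrite scalerBr addrACA -opprD => /addrI/oppr_inj //.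
apply: cvg_unique (psum_cvg _) _ => //.
rewrite (_ : (fun n => _) = (fun n => c *: psum n a + psum n b)); last first.
  by apply: funext => n; case: (bounded_psum n) => lin _; rewrite lin.
by apply: cvgD; [apply: cvgZr|]; exact: psum_cvg.
Qed.

Lemma p0C_le h : N (h - p0 h) <= N h.
Proof.
rewrite -rnormN -sub0r; apply: rcvg_le (psum_cvg h) _ => n.
by rewrite sub0r rnormN; have := @psum_contract n h; rewrite mul1r.
Qed.

Lemma p0_bounded : bounded_op p0.
Proof.
apply/bounded_opP; split; first exact: p0_linear.
exists 2 => // h; have -> : p0 h = h - (h - p0 h) by rewrite subKr.
apply: le_trans (rnormB _ _) _; rewrite mulrDl mul1r lerD2l; exact: p0C_le.
Qed.

Lemma p0_pj j h : fam j -> p0 (p j h) = 0.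
Proof.
move=> fj; apply/eqP; rewrite -oppr_eq0 -[- _](addKr (p j h)) addrC subr_eq0; apply/eqP.
by apply: (rcvg_cst (n0 := j) (psum_cvg _)) => n jn; exact: proj_psum.
Qed.

Lemma pj_p0 j h : fam j -> p j (p0 h) = 0.
Proof.
move=> fj; have e : p j (h - p0 h) = p j h.
  apply: (rcvg_cst (n0 := j) (bop_cvg (bp fj) (psum_cvg h))) => n jn.
  exact: psum_proj.
have -> : p0 h = h - (h - p0 h) by rewrite subKr.
by rewrite (bopB (bp fj)) e subrr.
Qed.

Lemma psum_p0 n h : psum n (p0 h) = 0.
Proof. by rewrite /psum big1 // => i fi; exact: pj_p0. Qed.

Lemma p0_idem h : p0 (p0 h) = p0 h.
Proof.
have : p0 h - p0 (p0 h) = 0.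
  by apply: (rcvg_cst (n0 := 0%N) (psum_cvg _)) => n _; exact: psum_p0.
by move=> /eqP; rewrite subr_eq0 => /eqP.
Qed.

Lemma ip_cvgl (u : nat -> H) l b : u @ \oo --> l ->
  forall c, (forall n, ip (u n) b = c) -> ip l b = c.
Proof.
move=> ul c uc; apply/eqP; rewrite -subr_eq0; apply/eqP/Normc.eq0_normc/eqP.
have nc_ge0 (z : R[i]) : 0 <= Normc.normc z.
  by rewrite -ler0c -[(Normc.normc z)%:C]/`|z| normr_ge0.
rewrite eq_le nc_ge0 andbT; apply/ler_addgt0Pr => e e0; rewrite add0r.
have b1 : 0 < N b + 1 by rewrite ltr_wpDl ?rnorm_ge0.
have /rcvgP/(_ _ (divr_gt0 e0 b1))[n _ nP] := ul.
rewrite -(uc n) -(ipBl ip); apply: le_trans (normc_ip_le ip_norm _ _) _.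
have /= := nP n (leqnn n); rewrite ltr_pdivlMr // => /ltW; apply: le_trans.
by rewrite ler_wpM2l ?rnorm_ge0 // lerDl.
Qed.

(** The partial sums are self-adjoint and annihilate p_0 b, so in the limit (1 - p_0) a is
    orthogonal to p_0 b. *)
Lemma p0_self_adjoint : self_adjoint ip p0.
Proof.
suff o a b : ip (a - p0 a) (p0 b) = 0.
  move=> a b; have h1 := o a b; have h2 := o b a.
  rewrite (ipBl ip) in h1; rewrite (ipBl ip) in h2.
  have e1 : ip a (p0 b) = ip (p0 a) (p0 b) by apply/eqP; rewrite -subr_eq0 h1.
  have e2 : ip b (p0 a) = ip (p0 b) (p0 a) by apply/eqP; rewrite -subr_eq0 h2.
  by rewrite e1 (ipC ip) e2 -(ipC ip).
apply: (ip_cvgl (psum_cvg a)) => n.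
by rewrite psum_self_adjoint psum_p0 (ip0r ip).
Qed.

Lemma p0_contract : opb 1 p0.
Proof.
apply: proj_contract; [exact: p0_bounded| |exact: p0_self_adjoint].
by apply: funext => h; exact: p0_idem.
Qed.

(** The blocks determine a vector; identities involving infinite sums are reduced to single blocks
    by this lemma. *)
Lemma proj_ext a b : (forall j, fam j -> p j a = p j b) -> p0 a = p0 b -> a = b.
Proof.
move=> pab p0ab; apply/eqP; rewrite -subr_eq0; apply/eqP; set c := a - b.
have c0 : p0 c = 0 by rewrite (bopB p0_bounded) p0ab subrr.
have : c - p0 c = 0.
  apply: (rcvg_cst (n0 := 0%N) (psum_cvg c)) => n _.
  rewrite /psum big1 // => i fi; rewrite (bopB (bp fi)) pab ?subrr //.
by rewrite c0 subr0.
Qed.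

(** For a bounded [g], commutation with [p 0] follows, by [commutes_p0]. *)
Definition commutes (g : H -> H) := forall j, fam j -> forall h, g (p j h) = p j (g h).

Lemma commutes_p0 g h : bounded_op g -> commutes g -> g (p0 h) = p0 (g h).
Proof.
move=> bg cg; have : g (h - p0 h) = g h - p0 (g h).
  apply: cvg_unique (bop_cvg bg (psum_cvg h)) _ => //.
  rewrite (_ : (fun n => _) = (fun n => psum n (g h))); first exact: psum_cvg.
  by apply: funext => n; rewrite /psum (bop_sum bg); apply: eq_bigr => j fj; exact: cg.
by rewrite (bopB bg) => /addrI/oppr_inj.
Qed.

Lemma commutes_adj g : bounded_op g -> commutes g -> commutes (adj ip g).
Proof.
move=> bg cg j fj h; apply: (ip_ext ip_norm) => y.
by rewrite (adjE' ip_norm bg) !pa // (adjE' ip_norm bg) cg.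
Qed.

End Projections.

(** * The pinching and its module property *)

Section Pinch.
Context {R : realType} {H : completeNormedModType R[i]}.
Variable ip : {dot H for Num.conj}.
Hypothesis ip_norm : forall h : H, ip h h = `|h| ^+ 2.
Hypothesis H_infinite : ~ finite_dim [set: H].
Variable Phi : (nat -> R) -> R.
Hypothesis Phi_sn : symmetric_norming Phi.
Local Notation N := (@rnorm R H).
Local Notation SP := (S_Phi ip Phi).
Implicit Types (h : H).

Lemma S_Phi_bounded x : SP x -> bounded_op x.
Proof. by move=> [[]]. Qed.

Lemma S_Phi_comp a x b : bounded_op a -> bounded_op b -> SP x -> SP (a \o x \o b).
Proof.
move=> ba bb /(S_PhiP ip Phi_sn)[r xr]; apply/(S_PhiP ip Phi_sn).
have [_ [ra ra0 aP]] := (bounded_opP a).1 ba.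
have [_ [rb rb0 bP]] := (bounded_opP b).1 bb.
by exists (ra * r * rb); apply: Phi_le_comp.
Qed.

Lemma S_Phi_compl a x : bounded_op a -> SP x -> SP (a \o x).
Proof. by move=> ba; apply: (S_Phi_comp ba (bounded_id (H := H))). Qed.

Lemma S_Phi_compr x b : bounded_op b -> SP x -> SP (x \o b).
Proof. by move=> bb; apply: (S_Phi_comp (bounded_id (H := H)) bb). Qed.

Lemma S_Phi_add x y : SP x -> SP y -> SP (x + y).
Proof.
move=> /(S_PhiP ip Phi_sn)[r xr] /(S_PhiP ip Phi_sn)[r' yr]; apply/(S_PhiP ip Phi_sn).
by exists (2 * (r + r')); apply: Phi_le_add.
Qed.

Lemma S_Phi_adj x : SP x -> SP (adj ip x).
Proof.
move=> /(S_PhiP ip Phi_sn)[r xr]; apply/(S_PhiP ip Phi_sn).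
by exists r; exact: Phi_le_adj.
Qed.

Lemma S_Phi_rank n x : rank_le ip n x -> SP x.
Proof.
move=> xn; apply/(S_PhiP ip Phi_sn).
have [_ [r r0 xr]] := (bounded_opP x).1 (rank_le_bounded ip_norm xn).
by exists (n%:R * r); exact: Phi_le_rank xn r0 xr.
Qed.

Definition to_S x (Sx : SP x) : SP := exist _ x (mem_set Sx).

Lemma to_SE x (Sx : SP x) : set_val (to_S Sx) = x.
Proof. by []. Qed.

Lemma S_PhiV (y : SP) : SP (set_val y).
Proof. exact: (set_mem (svalP y)). Qed.

Lemma S_bounded (y : SP) : bounded_op (set_val y).
Proof. exact: S_Phi_bounded (S_PhiV y). Qed.

Lemma S_inj (y z : SP) : set_val y = set_val z -> y = z.
Proof. by move=> yz; apply: val_inj. Qed.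

Lemma LmulE a (y : SP) : bounded_op a -> set_val (Lmul a y) = a \o set_val y.
Proof.
move=> ba; rewrite /Lmul set_valE insubdK //.
by apply: mem_set; apply: S_Phi_compl => //; exact: S_PhiV.
Qed.

Lemma AdE a (y : SP) : bounded_op a -> set_val (Ad a y) = a \o set_val y \o adj ip a.
Proof.
move=> ba; rewrite /Ad set_valE insubdK //.
by apply: mem_set; apply: S_Phi_comp => //; [exact: adj_bounded|exact: S_PhiV].
Qed.

Lemma op_norm_le (x : H -> H) r : bounded_op x -> 0 <= r -> (op_norm x <= r%:E)%E ->
  opb r x.
Proof.
move=> bx r0 xr h; have [->|h0] := eqVneq h 0; first by rewrite bop0 // rnorm0 mulr0.
have Nh := rnorm_gt0 h0; rewrite -ler_pdivrMr //.
have -> : N (x h) / N h = N (x ((N h)^-1%:C *: h)).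
  by rewrite bopZ // rnormZr gtr0_norm ?invr_gt0 // mulrC.
rewrite -lee_fin; apply: le_trans xr; apply: ereal_sup_ubound.
exists ((N h)^-1%:C *: h) => //=.
by rewrite rnormZr gtr0_norm ?invr_gt0 // mulVf // gt_eqF.
Qed.

Variables (w : option nat) (p : nat -> H -> H).
Hypothesis p_proj : orthogonal_projections ip w p.
Hypothesis p0E : complement_projection w p.
Variable P : SP -> SP.
Hypothesis PE : is_pinching w p P.
Local Notation fam := (in_family w).
Local Notation p0 := (p 0%N).

Let bp i : fam i -> bounded_op (p i).
Proof. by move=> /(proj1 p_proj)/(hermitian_projectionP ip_norm)[]. Qed.
Let pp i h : fam i -> p i (p i h) = p i h.
Proof. by move=> /(proj1 p_proj)/(hermitian_projectionP ip_norm)[]. Qed.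
Let pij i j h : fam i -> fam j -> i <> j -> p i (p j h) = 0.
Proof. by move=> fi fj ij; have := congr1 (fun f => f h) ((proj2 p_proj) i j fi fj ij). Qed.

(** From here on the pinching is used through its values on vectors. *)
Lemma pinch_cvg (x : SP) h :
  \sum_(1 <= i < n.+1 | fam i) p i (set_val x (p i h)) @[n --> \oo] --> set_val (P x) h.
Proof.
have bS n : bounded_op (\sum_(1 <= i < n.+1 | fam i) (p i \o set_val x \o p i)).
  elim/big_ind : _ => [|a b|i fi]; [exact: bounded0|exact: bounded_add|].
  have := S_bounded x; have := bp fi => b1 b2.
  by apply: bounded_comp => //; exact: bounded_comp.
apply/rcvgP => e e0; have Nh1 : 0 < N h + 1 by rewrite ltr_wpDl ?rnorm_ge0.
have epos : (0 < (e / (N h + 1))%:E)%E by rewrite lte_fin divr_gt0.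
have [n0 _ n0P] := PE x (open_ereal_lt' epos).
exists n0 => // n /n0P /= /ltW.
move=> /(op_norm_le (bounded_sub (S_bounded _) (bS n))).
rewrite divr_ge0 ?(ltW e0) ?(ltW Nh1) // => /(_ isT h).
rewrite !fctE fct_sumE /= => /le_lt_trans; apply.
by rewrite mulrAC ltr_pdivrMr // ltr_pM2l // ltrDl.
Qed.
Arguments pinch_cvg : clear implicits.

Lemma proj_pinch_sum j n (x : SP) h : fam j -> (j <= n)%N ->
  p j (\sum_(1 <= i < n.+1 | fam i) p i (set_val x (p i h))) = p j (set_val x (p j h)).
Proof.
move=> fj jn; have j1 : (1 <= j)%N by case/andP: fj.
rewrite (bop_sum (bp fj)) big_mkcond (bigD1_seq j) ?iota_uniq //=; last first.
  by rewrite mem_index_iota j1.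
rewrite fj pp // big1 ?addr0 // => i /eqP ij; case: ifP => // fi.
by apply: pij => //; exact: nesym.
Qed.

Lemma pj_pinch j (x : SP) h : fam j -> p j (set_val (P x) h) = p j (set_val x (p j h)).
Proof.
move=> fj; apply: (rcvg_cst (n0 := j) (bop_cvg (bp fj) (pinch_cvg x h))) => n jn.
exact: proj_pinch_sum.
Qed.

Lemma pinch_pj j (x : SP) h : fam j -> set_val (P x) (p j h) = p j (set_val x (p j h)).
Proof.
move=> fj; have j1 : (1 <= j)%N by case/andP: fj.
apply: (rcvg_cst (n0 := j) (pinch_cvg x _)) => n jn.
rewrite big_mkcond (bigD1_seq j) ?iota_uniq //=; last by rewrite mem_index_iota j1.
rewrite fj pp // big1 ?addr0 // => i /eqP ij; case: ifP => // fi.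
by rewrite pij // (bop0 (S_bounded x)) (bop0 (bp fi)).
Qed.

Lemma p0_pinch (x : SP) h : p0 (set_val (P x) h) = 0.
Proof.
apply: (rcvg_cst (n0 := 0%N) (bop_cvg (p0_bounded ip_norm p_proj p0E) (pinch_cvg x h))).
move=> n _; rewrite (bop_sum (p0_bounded ip_norm p_proj p0E)) big1 // => i fi.
exact: (p0_pj ip_norm p_proj p0E).
Qed.

Lemma pinch_p0 (x : SP) h : set_val (P x) (p0 h) = 0.
Proof.
apply: (rcvg_cst (n0 := 0%N) (pinch_cvg x _)) => n _; rewrite big1 // => i fi.
by rewrite (pj_p0 ip_norm p_proj p0E) // (bop0 (S_bounded x)) (bop0 (bp fi)).
Qed.

Let ext := proj_ext ip_norm p_proj p0E.

(** [P] is a bimodule map over the commutant of the p_i. The product enters as an element [x'] with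
    an equation, so that the lemma serves [Lmul] and [Ad] alike. *)
Lemma pinch_bimodule a b (x x' : SP) : bounded_op a -> bounded_op b ->
  commutes w p a -> commutes w p b -> set_val x' = a \o set_val x \o b ->
  set_val (P x') = a \o set_val (P x) \o b.
Proof.
move=> ba bb ca cb x'E; apply: funext => h; apply: ext => [j fj|].
  by rewrite pj_pinch // x'E /= cb // -ca // -ca // pj_pinch.
rewrite p0_pinch /= -(commutes_p0 p0E _ ba ca) p0_pinch.
by rewrite (bop0 ba).
Qed.

Definition rank1 (a b : H) h := ip h b *: a.

Lemma S_rank1 a b : SP (rank1 a b).
Proof. exact: S_Phi_rank (rank_le1 ip b a). Qed.

(** For e in the range of p_j, the pinching of the rank one operator <., e> h sends e to |e|^2 p_j
    h. Comparing [h] with [g h] gives g p_j h = p_j g h. *)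
Lemma pinch_left_commutes g : bounded_op g ->
  (forall x x' : SP, set_val x' = g \o set_val x -> set_val (P x') = g \o set_val (P x)) ->
  commutes w p g.
Proof.
move=> bg gP j fj h; pose q := p j h.
have [q0|q0] := eqVneq (p j) 0; first by rewrite q0 (bop0 bg).
have [z zq] : exists z, p j z <> 0.
  apply/not_existsP => z0; move/eqP: q0; apply; apply: funext => z.
  by have := z0 z; rewrite notK.
pose e := p j z; pose x := to_S (S_rank1 h e); pose x' := to_S (S_rank1 (g h) e).
have := gP x x'; rewrite !to_SE => /(_ _)/(congr1 (fun f => f e)) /=.
have pe : p j e = e by rewrite /e pp.
rewrite -{1}pe -{2}pe !pinch_pj // pe !to_SE /rank1 !(bopZ (bp fj)) (bopZ bg).
have ee : ip e e != 0.
  rewrite (ip_normr ip_norm); apply/eqP => /complexI/eqP; rewrite expf_eq0 /= => /eqP.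
  by move/rnorm_eq0.
move=> E; apply/eqP; rewrite -subr_eq0; apply/eqP; apply: (scalerI ee).
rewrite scaler0 scalerBr -E ?subrr //; apply: funext => y.
by rewrite /rank1 /= (bopZ bg).
Qed.

End Pinch.

(** * The unitary group and its actions *)

Section UnitaryGroup.
Context {R : realType} {H : completeNormedModType R[i]}.
Variable ip : {dot H for Num.conj}.
Hypothesis ip_norm : forall h : H, ip h h = `|h| ^+ 2.
Hypothesis H_infinite : ~ finite_dim [set: H].
Variable Phi : (nat -> R) -> R.
Hypothesis Phi_sn : symmetric_norming Phi.
Local Notation N := (@rnorm R H).
Local Notation SP := (S_Phi ip Phi).
Local Notation UI := (U_I ip Phi).
Local Notation adj := (adj ip).
Implicit Types (h : H) (u v g : UI).

Definition U_val (u : UI) : H -> H := set_val u.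

Lemma U_valP u : unitary_op ip (U_val u) /\ SP (U_val u - id).
Proof. exact: (set_mem (svalP u)). Qed.

Lemma U_bounded u : bounded_op (U_val u).
Proof. by have [[]] := U_valP u. Qed.

Lemma U_adj_bounded u : bounded_op (adj (U_val u)).
Proof. exact: adj_bounded (U_bounded u). Qed.

Lemma U_adjK u h : adj (U_val u) (U_val u h) = h.
Proof. by have [[_ e _] _] := U_valP u; exact: (congr1 (fun f => f h) e). Qed.

Lemma U_Kadj u h : U_val u (adj (U_val u) h) = h.
Proof. by have [[_ _ e] _] := U_valP u; exact: (congr1 (fun f => f h) e). Qed.

Lemma U_norm u h : N (U_val u h) = N h.
Proof.
apply/eqP; rewrite -(@eqrXn2 _ 2) ?rnorm_ge0 // -!(rip_norm ip_norm) /rip.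
by rewrite -(adjE' ip_norm (U_bounded u)) U_adjK.
Qed.

Lemma U_adj_norm u h : N (adj (U_val u) h) = N h.
Proof. by rewrite -[in RHS](U_Kadj u h) U_norm. Qed.

Lemma U_opb u : opb 1 (U_val u).
Proof. by move=> h; rewrite U_norm mul1r. Qed.

Lemma U_adj_opb u : opb 1 (adj (U_val u)).
Proof. by move=> h; rewrite U_adj_norm mul1r. Qed.

Lemma U_inj u v : (forall h, U_val u h = U_val v h) -> u = v.
Proof. by move=> uv; apply: val_inj; apply: funext. Qed.

Definition to_U x (ux : unitary_op ip x /\ SP (x - id)) : UI := exist _ x (mem_set ux).

Lemma U_one_subproof : unitary_op ip id /\ SP (id - id : H -> H).
Proof.
split; first by split; rewrite ?(adj_id ip_norm) //; exact: bounded_id.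
by rewrite subrr; apply: (S_Phi_rank ip_norm H_infinite Phi_sn (rank_le0 ip)).
Qed.

Lemma U_mul_subproof u v : unitary_op ip (U_val u \o U_val v) /\
  SP ((U_val u \o U_val v) - id).
Proof.
have bu := U_bounded u; have bv := U_bounded v; split.
  split; first exact: bounded_comp.
    by rewrite (adj_comp ip_norm bu bv); apply: funext => h /=; rewrite !U_adjK.
  by rewrite (adj_comp ip_norm bu bv); apply: funext => h /=; rewrite !U_Kadj.
have -> : (U_val u \o U_val v) - id = ((U_val u - id) \o U_val v) + (U_val v - id).
  by apply: funext => h; rewrite -[LHS]/(_ - h) -[RHS]/(U_val u (U_val v h) - U_val v h + (U_val v h - h)) subrKA.
have [_ Su] := U_valP u; have [_ Sv] := U_valP v.
by apply: S_Phi_add => //; apply: S_Phi_compr.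
Qed.

Lemma U_inv_subproof u : unitary_op ip (adj (U_val u)) /\ SP (adj (U_val u) - id).
Proof.
have bu := U_bounded u; split.
  split; [exact: adj_bounded| |]; rewrite (adjK ip_norm bu); apply: funext => h /=.
    exact: U_Kadj.
  exact: U_adjK.
have -> : adj (U_val u) - id = adj (U_val u - id).
  by rewrite (adj_sub ip_norm bu (bounded_id (H := H))) (adj_id ip_norm).
by apply: S_Phi_adj => //; have [] := U_valP u.
Qed.

Definition U_one : UI := to_U U_one_subproof.
Definition U_mul u v : UI := to_U (U_mul_subproof u v).
Definition U_inv u : UI := to_U (U_inv_subproof u).

Lemma U_mulE u v h : U_val (U_mul u v) h = U_val u (U_val v h). Proof. by []. Qed.
Lemma U_invE u : U_val (U_inv u) = adj (U_val u). Proof. by []. Qed.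

Lemma U_mulA a b c : U_mul a (U_mul b c) = U_mul (U_mul a b) c.
Proof. exact: U_inj. Qed.
Lemma U_mul1g a : U_mul U_one a = a. Proof. exact: U_inj. Qed.
Lemma U_mulg1 a : U_mul a U_one = a. Proof. exact: U_inj. Qed.
Lemma U_mulVg a : U_mul (U_inv a) a = U_one.
Proof. by apply: U_inj => h; rewrite U_mulE U_invE U_adjK. Qed.
Lemma U_mulgV a : U_mul a (U_inv a) = U_one.
Proof. by apply: U_inj => h; rewrite U_mulE U_invE U_Kadj. Qed.

Variables (w : option nat) (p : nat -> H -> H).
Hypothesis p_proj : orthogonal_projections ip w p.
Hypothesis p0E : complement_projection w p.
Variable P : SP -> SP.
Hypothesis PE : is_pinching w p P.
Local Notation fam := (in_family w).
Local Notation comm := (commutes w p).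

Lemma left_actE u (x : SP) : set_val (left_act P u x) =
  U_val u \o set_val (P (Lmul (adj (U_val u)) x)).
Proof. exact: (LmulE ip_norm H_infinite Phi_sn _ (U_bounded u)). Qed.

Lemma Ad_actE u (x : SP) : set_val (Ad_act P u x) =
  U_val u \o set_val (P (Ad (adj (U_val u)) x)) \o adj (U_val u).
Proof. exact: (AdE ip_norm H_infinite Phi_sn _ (U_bounded u)). Qed.

Lemma Ad_adjE u (x : SP) : set_val (Ad (adj (U_val u)) x) =
  adj (U_val u) \o set_val x \o U_val u.
Proof.
rewrite (AdE ip_norm H_infinite Phi_sn _ (U_adj_bounded u)).
by rewrite (adjK ip_norm (U_bounded u)).
Qed.

Lemma Lmul_adjE u (x : SP) : set_val (Lmul (adj (U_val u)) x) = adj (U_val u) \o set_val x.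
Proof. exact: (LmulE ip_norm H_infinite Phi_sn _ (U_adj_bounded u)). Qed.

Local Opaque Ad_act left_act Ad Lmul.

Lemma U_mul_adj u v : adj (U_val (U_mul u v)) = adj (U_val v) \o adj (U_val u).
Proof. exact: (adj_comp ip_norm (U_bounded u) (U_bounded v)). Qed.

Lemma U_adj_one : adj (U_val U_one) = id.
Proof. exact: adj_id. Qed.

Lemma Ad_one (x : SP) : Ad (adj (U_val U_one)) x = x.
Proof.
apply: S_inj; apply: (etrans (Ad_adjE U_one x)); apply: funext => h /=.
by rewrite U_adj_one.
Qed.

Lemma left_act_mul g u (x : SP) : set_val (left_act P (U_mul g u) x) =
  U_val g \o set_val (left_act P u (Lmul (adj (U_val g)) x)).
Proof.
rewrite !left_actE; apply: funext => h /=.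
congr (U_val g (U_val u (set_val (P _) _))); apply: S_inj.
by rewrite !Lmul_adjE U_mul_adj.
Qed.

Lemma Ad_act_mul g u (x : SP) : set_val (Ad_act P (U_mul g u) x) =
  U_val g \o set_val (Ad_act P u (Ad (adj (U_val g)) x)) \o adj (U_val g).
Proof.
rewrite !Ad_actE; apply: funext => h /=.
rewrite (_ : adj (U_val (U_mul g u)) h = adj (U_val u) (adj (U_val g) h)); last first.
  by rewrite U_mul_adj.
congr (U_val g (U_val u (set_val (P _) _))); apply: S_inj.
by rewrite !Ad_adjE U_mul_adj.
Qed.

Lemma left_act_mull g u v : left_act P u = left_act P v ->
  left_act P (U_mul g u) = left_act P (U_mul g v).
Proof. by move=> uv; apply: funext => x; apply: S_inj; rewrite (left_act_mul g u) (left_act_mul g v) uv. Qed.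

Lemma Ad_act_mull g u v : Ad_act P u = Ad_act P v ->
  Ad_act P (U_mul g u) = Ad_act P (U_mul g v).
Proof.
move=> uv; apply: funext => x; apply: S_inj.
apply: (etrans (Ad_act_mul g u x)); apply: etrans (esym (Ad_act_mul g v x)).
pose F (f : SP -> SP) := U_val g \o set_val (f (Ad (adj (U_val g)) x)) \o adj (U_val g).
exact: (congr1 F uv).
Qed.

(** That [g] fixes [P] means P (g x) = g P x, the hypothesis of [pinch_left_commutes]. *)
Lemma left_act_comm1 g : left_act P g = left_act P U_one -> comm (U_val g).
Proof.
move=> g1; apply: (pinch_left_commutes ip_norm H_infinite Phi_sn p_proj PE (U_bounded g)).
move=> x x' x'E; have := congr1 (fun f => set_val (f x')) g1; rewrite !left_actE.
have -> : Lmul (adj (U_val U_one)) x' = x'.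
  by apply: S_inj; rewrite Lmul_adjE (adj_id ip_norm).
have -> : Lmul (adj (U_val g)) x' = x; last by [].
by apply: S_inj; rewrite Lmul_adjE x'E; apply: funext => h /=; rewrite U_adjK.
Qed.

Lemma comm_left_act u g : comm (U_val g) -> left_act P (U_mul u g) = left_act P u.
Proof.
move=> cg; rewrite -[in RHS](U_mulg1 u); apply: left_act_mull.
apply: funext => x; apply: S_inj; rewrite !left_actE.
have ca := commutes_adj ip_norm p_proj (U_bounded g) cg.
have E := pinch_bimodule ip_norm p_proj p0E PE (U_adj_bounded g) (bounded_id (H := H))
  ca (fun _ _ _ => erefl) (Lmul_adjE g x).
rewrite E (_ : Lmul (adj (U_val U_one)) x = x).
  by apply: funext => h /=; rewrite U_Kadj.
by apply: S_inj; rewrite Lmul_adjE (adj_id ip_norm).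
Qed.

Lemma comm_Ad_act u g : comm (U_val g) -> Ad_act P (U_mul u g) = Ad_act P u.
Proof.
move=> cg; rewrite -[in RHS](U_mulg1 u); apply: Ad_act_mull.
apply: funext => x; apply: S_inj.
apply: (etrans (Ad_actE g x)); apply: (etrans _ (esym (Ad_actE U_one x))).
have ca := commutes_adj ip_norm p_proj (U_bounded g) cg.
have E := pinch_bimodule ip_norm p_proj p0E PE (U_adj_bounded g) (U_bounded g)
  ca cg (Ad_adjE g x).
apply: (etrans (congr1 (fun X => U_val g \o X \o adj (U_val g)) E)).
apply: (etrans _ (esym (congr1 (fun z => U_val U_one \o set_val (P z) \o adj (U_val U_one))
  (Ad_one x)))).
by apply: funext => h /=; rewrite !U_Kadj U_adj_one.
Qed.

Lemma left_act_eqP u v : left_act P u = left_act P v <-> comm (U_val (U_mul (U_inv v) u)).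
Proof.
split=> [uv|/(comm_left_act v)]; last by rewrite U_mulA U_mulgV U_mul1g.
by apply: left_act_comm1; rewrite (left_act_mull _ uv) U_mulVg.
Qed.

(** This makes the map between the orbits well defined. *)
Lemma left_act_Ad_act u v : left_act P u = left_act P v -> Ad_act P u = Ad_act P v.
Proof. by move=> /left_act_eqP/(comm_Ad_act v) <-; rewrite U_mulA U_mulgV U_mul1g. Qed.

(* [Ad_k] fixes [P], so it permutes the ranges of the [p i]; as [k] is close to
   [1], the permutation is trivial. *)
Lemma Ad_act_near1 k r : r < 1 -> opb r (U_val k - id) ->
  Ad_act P k = Ad_act P U_one -> forall j h, fam j ->
  p j (U_val k (p j h)) = U_val k (p j h).
Proof.
move=> r1 kr k1 j h fj.
have [bp pp pa p1] := hermitian_projectionP ip_norm ((proj1 p_proj) j fj).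
set xi := p j h; have pxi : p j xi = xi by rewrite /xi pp.
have [->|xi0] := eqVneq xi 0; first by rewrite (bop0 (U_bounded k)) (bop0 bp).
have Nxi := rnorm_gt0 xi0.
set eta := U_val k xi.
(* Up to scalars, [x] and [y] are the projections on xi and on eta = k xi. [P] fixes [x] as xi is in
   the range of p_j, hence fixes y = k x k^* by the invariance under Ad_k. *)
have [x xE] : exists x : SP, set_val x = rank1 ip xi xi.
  by exists (to_S (S_rank1 ip_norm H_infinite Phi_sn xi xi)).
have [y yE] : exists y : SP, set_val y = rank1 ip eta eta.
  by exists (to_S (S_rank1 ip_norm H_infinite Phi_sn eta eta)).
have Px : P x = x.
  apply: S_inj; apply: funext => h'; apply: (proj_ext ip_norm p_proj p0E) => [i fi|].
    have e := pj_pinch ip_norm p_proj PE x h' fi.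
    rewrite e.
    rewrite xE /rank1.
    have [bpi _ pai _] := hermitian_projectionP ip_norm ((proj1 p_proj) i fi).
    rewrite !(bopZ bpi); have [->|/eqP ij] := eqVneq i j; first by rewrite pa pxi.
    have -> : p i xi = 0; last by rewrite !scaler0.
    by rewrite -pxi; exact: (congr1 (fun f => f xi) ((proj2 p_proj) i j fi fj ij)).
  rewrite (p0_pinch ip_norm p_proj p0E PE) xE /rank1.
  have e0 : p 0%N xi = 0 by rewrite -pxi; exact: (p0_pj ip_norm p_proj p0E xi fj).
  by rewrite (bopZ (p0_bounded ip_norm p_proj p0E)) e0 scaler0.
have Py : P y = y.
  have e := etrans (esym (Ad_actE k y))
    (etrans (congr1 (fun f : SP -> SP => set_val (f y)) k1) (Ad_actE U_one y)).
  have adx : Ad (adj (U_val k)) y = x.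
    apply: S_inj; apply: (etrans (Ad_adjE k y)); rewrite yE xE; apply: funext => h'.
    rewrite /rank1 /= (bopZ (U_adj_bounded k)) /eta U_adjK; congr (_ *: _).
    by rewrite -(adjE' ip_norm (U_bounded k)) U_adjK.
  rewrite adx Ad_one Px U_adj_one in e; apply: S_inj.
  apply: (etrans (esym e)); rewrite xE yE; apply: funext => h'.
  by rewrite /rank1 /= (bopZ (U_bounded k)) (adjE' ip_norm (U_bounded k)).
(* If p_j eta were 0, then |xi| = |p_j (eta - xi)| <= r |xi| with r < 1. *)
have pe0 : p j eta != 0.
  apply/eqP => pe0; have := kr xi; rewrite !fctE -/eta => le1.
  have : N xi <= N (eta - xi).
    have -> : N xi = N (p j (eta - xi)).
      by rewrite (bopB bp) pe0 pxi sub0r rnormN.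
    by have := p1 (eta - xi); rewrite mul1r.
  move=> /le_trans/(_ le1); apply/negP; rewrite -ltNge.
  by rewrite gtr_pMl.
(* At p_j eta the equation P y = y says that <p_j eta, eta> eta is fixed by p_j, and the coefficient
   is |p_j eta|^2. *)
have := pinch_pj ip_norm p_proj PE y eta fj.
rewrite Py yE /rank1 (bopZ bp) => e1.
have ee : ip (p j eta) eta != 0.
  have -> : ip (p j eta) eta = ip (p j eta) (p j eta) by rewrite -pa pp.
  rewrite (ip_normr ip_norm); apply/eqP => /complexI/eqP; rewrite expf_eq0 /= => /eqP.
  by move/rnorm_eq0; exact/eqP.
by apply: (scalerI ee).
Qed.

(** For k = b^-1 a, [Ad_act_near1] gives p_j k p_j = k p_j only. Applied also to k^-1 = k^*, it
    gives by adjunction p_j k p_j = p_j k, hence commutation. *)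
Lemma Ad_act_left_act a b r : r < 1 -> opb r (U_val a - U_val b) ->
  Ad_act P a = Ad_act P b -> left_act P a = left_act P b.
Proof.
move=> r1 abr ab; apply/left_act_eqP.
have near1 (c d : UI) : opb r (U_val c - U_val d) -> Ad_act P c = Ad_act P d ->
    forall j h, fam j -> p j (U_val (U_mul (U_inv d) c) (p j h)) =
      U_val (U_mul (U_inv d) c) (p j h).
  move=> cdr cd; apply: (Ad_act_near1 r1).
    move=> h; rewrite -[(_ - _) h]/(adj (U_val d) (U_val c h) - h).
    rewrite -[X in _ - X](U_adjK d h) -(bopB (U_adj_bounded d)) U_adj_norm.
    exact: cdr.
  have e1 := Ad_act_mull (U_inv d) cd.
  apply: (etrans e1).
  have e2 := U_mulVg d.
  exact: (congr1 (fun g => Ad_act P g) e2).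
have bar : opb r (U_val b - U_val a) by move=> h; rewrite fctE rdistC; exact: abr.
have kE : U_val (U_mul (U_inv a) b) = adj (U_val (U_mul (U_inv b) a)).
  by rewrite U_mul_adj U_invE (adjK ip_norm (U_bounded b)).
have k1 := near1 a b abr ab; have := near1 b a bar (esym ab).
move: k1; rewrite kE; set k := U_mul (U_inv b) a => k1 k2 j fj h.
have [bp pp pa _] := hermitian_projectionP ip_norm ((proj1 p_proj) j fj).
rewrite -(k1 j h fj); apply: (ip_ext ip_norm) => y.
rewrite pa (adjE ip_norm (U_bounded k)) [RHS]pa [RHS](adjE ip_norm (U_bounded k)).
by rewrite -[in RHS](k2 j y fj) -pa.
Qed.

End UnitaryGroup.

(** * Local sections *)

Section LocalSection.
Context {R : realType} {H : completeNormedModType R[i]}.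
Variable ip : {dot H for Num.conj}.
Hypothesis ip_norm : forall h : H, ip h h = `|h| ^+ 2.
Hypothesis H_infinite : ~ finite_dim [set: H].
Variable Phi : (nat -> R) -> R.
Hypothesis Phi_sn : symmetric_norming Phi.
Local Notation N := (@rnorm R H).
Local Notation SP := (S_Phi ip Phi).
Local Notation UI := (U_I ip Phi).
Local Notation adj := (adj ip).
Implicit Types (h : H) (u v g : UI).

Variables (w : option nat) (p : nat -> H -> H).
Hypothesis p_proj : orthogonal_projections ip w p.
Hypothesis p0E : complement_projection w p.
Variable P : SP -> SP.
Hypothesis PE : is_pinching w p P.
Local Notation fam := (in_family w).
Local Notation comm := (commutes w p).
Local Notation p0 := (p 0%N).
Local Notation psum := (psum w p).
Local Notation U_inv := (U_inv ip_norm H_infinite Phi_sn).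

Let bp i : fam i -> bounded_op (p i).
Proof. by move=> /(proj1 p_proj)/(hermitian_projectionP ip_norm)[]. Qed.
Let pp i h : fam i -> p i (p i h) = p i h.
Proof. by move=> /(proj1 p_proj)/(hermitian_projectionP ip_norm)[]. Qed.
Let pij i j h : fam i -> fam j -> i <> j -> p i (p j h) = 0.
Proof. by move=> fi fj ij; have := congr1 (fun f => f h) ((proj2 p_proj) i j fi fj ij). Qed.
Let bp0 : bounded_op p0 := p0_bounded ip_norm p_proj p0E.

Lemma psum_proj_gt n j h : fam j -> (n < j)%N -> p j (psum n h) = 0.
Proof.
move=> fj nj; rewrite /psum (bop_sum (bp fj)) big1_seq // => i /andP[fi].
rewrite mem_index_iota => /andP[_ ij]; apply: pij => //.
by move=> jE; move: nj; rewrite jE ltnNge -ltnS ij.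
Qed.

(* [c_u = sum_(i >= 0) p_i u^* p_i], the block diagonal part of [u^*]. *)
Definition diag_part u h : H :=
  h + set_val (P (to_S (proj2 (U_inv_subproof ip_norm H_infinite Phi_sn u)))) h +
  p0 (adj (U_val u) (p0 h) - p0 h).

Lemma diag_part_bounded u : bounded_op (diag_part u).
Proof.
have -> : diag_part u = id +
   set_val (P (to_S (proj2 (U_inv_subproof ip_norm H_infinite Phi_sn u)))) +
   (p0 \o (adj (U_val u) - id) \o p0) by [].
apply: bounded_add; last first.
  apply: bounded_comp => //; apply: bounded_comp => //.
  by apply: bounded_sub; [exact: U_adj_bounded|exact: bounded_id].
by apply: bounded_add; [exact: bounded_id|exact: S_bounded].
Qed.

Lemma p_diag_part u j h : fam j -> p j (diag_part u h) = p j (adj (U_val u) (p j h)).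
Proof.
move=> fj; rewrite /diag_part !(bopD (bp fj)) (pj_pinch ip_norm p_proj PE) //.
rewrite (pj_p0 ip_norm p_proj p0E) // addr0 to_SE.
rewrite -[(_ - _) (p j h)]/(adj (U_val u) (p j h) - p j h) (bopB (bp fj)) pp //.
by rewrite addrC subrK.
Qed.

Lemma diag_part_p u j h : fam j -> diag_part u (p j h) = p j (adj (U_val u) (p j h)).
Proof.
move=> fj; rewrite /diag_part (pinch_pj ip_norm p_proj PE) //.
rewrite (p0_pj ip_norm p_proj p0E) // (bop0 (U_adj_bounded ip_norm u)) subr0 (bop0 bp0).
rewrite addr0 to_SE -[(_ - _) (p j h)]/(adj (U_val u) (p j h) - p j h) (bopB (bp fj)) pp //.
by rewrite addrC subrK.
Qed.

Lemma p0_diag_part u h : p0 (diag_part u h) = p0 (adj (U_val u) (p0 h)).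
Proof.
rewrite /diag_part !(bopD bp0, bopN bp0) (p0_pinch ip_norm p_proj p0E PE) addr0.
by rewrite !(p0_idem ip_norm p_proj p0E) addrC subrK.
Qed.

Lemma diag_part_p0 u h : diag_part u (p0 h) = p0 (adj (U_val u) (p0 h)).
Proof.
rewrite /diag_part (pinch_p0 ip_norm p_proj p0E PE) addr0.
by rewrite !(p0_idem ip_norm p_proj p0E) (bopB bp0) (p0_idem ip_norm p_proj p0E) addrC subrK.
Qed.

Lemma diag_part_comm u : comm (diag_part u).
Proof. by move=> j fj h; rewrite diag_part_p // p_diag_part. Qed.

Lemma S_diag_part u : SP ((U_val u \o diag_part u) - id).
Proof.
have [_ Su] := U_valP u; have [_ Sa] := U_inv_subproof ip_norm H_infinite Phi_sn u.
pose k := set_val (P (to_S (proj2 (U_inv_subproof ip_norm H_infinite Phi_sn u)))) +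
   (p0 \o (adj (U_val u) - id) \o p0).
have Sk : SP k.
  by apply: S_Phi_add => //; [exact: S_PhiV|apply: S_Phi_comp].
have -> : (U_val u \o diag_part u) - id = (U_val u \o k) + (U_val u - id).
  apply: funext => h; rewrite -[LHS]/(U_val u (h + _ + _) - h).
  rewrite -[RHS]/(U_val u (_ + _) + (U_val u h - h)) -addrA !(bopD (U_bounded u)).
  by rewrite [RHS]addrC [RHS]addrAC.
by apply: S_Phi_add => //; apply: S_Phi_compl => //; exact: U_bounded.
Qed.

(** A consequence of |L_u P L_u^-1 - P| <= d that keeps only the operator norm of the values; the
    local section needs no more. *)
Definition near_P d u := forall (x : SP) r, 0 < r -> Phi_le ip Phi (set_val x) r ->
  opb (r * d) (set_val (left_act P u x) - set_val (P x)).

Let left_actE u (x : SP) h : set_val (left_act P u x) h =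
  U_val u (set_val (P (Lmul (adj (U_val u)) x)) h).
Proof. by have := left_actE ip_norm H_infinite Phi_sn P u x => ->. Qed.

(** The bound for [u] at u x is the bound for u^-1 at x, multiplied by a unitary. *)
Lemma near_P_inv d u : 0 <= d -> near_P d u -> near_P d (U_inv u).
Proof.
move=> d0 ud x r r0 xr h.
have bu := U_bounded u.
have [y yE] : exists y : SP, set_val y = U_val u \o set_val x.
  by exists (Lmul (U_val u) x); apply: LmulE.
have yr : Phi_le ip Phi (set_val y) r.
  rewrite yE -[r]mul1r; apply: Phi_le_compl => //; exact: U_opb.
have := ud y r r0 yr h; rewrite !fctE !left_actE.
have -> : Lmul (adj (U_val u)) y = x.
  apply: S_inj; apply: etrans (Lmul_adjE ip_norm H_infinite Phi_sn u y) _.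
  by rewrite yE; apply: funext => h' /=; rewrite U_adjK.
have -> : Lmul (adj (U_val (U_inv u))) x = y.
  apply: S_inj; apply: etrans (Lmul_adjE ip_norm H_infinite Phi_sn (U_inv u) x) _.
  by rewrite yE U_invE (adjK ip_norm bu).
move=> le_xy; rewrite U_invE -(U_adjK u (set_val (P x) h)).
by rewrite -(bopB (U_adj_bounded ip_norm u)) U_adj_norm // rdistC.
Qed.

(** The homogeneity of [P] is obtained from the bimodule property, with the scalar operator [a]. *)
Lemma near_P_scale d u : 0 <= d ->
  (forall x : SP, Phi_le ip Phi (set_val x) 1 ->
    opb d (set_val (left_act P u x) - set_val (P x))) -> near_P d u.
Proof.
move=> d0 ud x r r0 xr h.
pose a := fun h : H => (r^-1)%:C *: h.
have ab : bounded_op a.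
  apply/bounded_opP; split.
    by move=> c y z; rewrite /a scalerDr !scalerA mulrC.
  by exists r^-1 => [|y]; rewrite ?invr_ge0 ?(ltW r0) // rnormZr gtr0_norm ?invr_gt0.
have ca : comm a by move=> j fj y; rewrite /a (bopZ (bp fj)).
have [y yE] : exists y : SP, set_val y = a \o set_val x.
  by exists (Lmul a x); apply: LmulE.
have y1 : Phi_le ip Phi (set_val y) 1.
  rewrite yE -(mulVf (lt0r_neq0 r0)); apply: Phi_le_compl => //.
    by rewrite invr_ge0 ltW.
  by move=> z; rewrite rnormZr gtr0_norm ?invr_gt0.
have Py : set_val (P y) = a \o set_val (P x).
  have := pinch_bimodule ip_norm p_proj p0E PE ab (bounded_id (H := H)) ca
    (fun _ _ _ => erefl) yE; exact.
have Pluy : set_val (P (Lmul (adj (U_val u)) y)) = a \o set_val (P (Lmul (adj (U_val u)) x)).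
  have E : set_val (Lmul (adj (U_val u)) y) = a \o set_val (Lmul (adj (U_val u)) x) \o id.
    apply: etrans (Lmul_adjE ip_norm H_infinite Phi_sn u y) _.
    rewrite yE; apply: funext => z.
    rewrite -[RHS]/(a (set_val (Lmul (adj (U_val u)) x) z)).
    rewrite (Lmul_adjE ip_norm H_infinite Phi_sn u x) /=.
    by rewrite /a (bopZ (U_adj_bounded ip_norm u)).
  have := pinch_bimodule ip_norm p_proj p0E PE ab (bounded_id (H := H)) ca
    (fun _ _ _ => erefl) E; exact.
have := ud y y1 h; rewrite !fctE !left_actE Pluy Py /= /a (bopZ (U_bounded u)).
rewrite -scalerBr rnormZr gtr0_norm ?invr_gt0 // ler_pdivrMl // => /le_trans; apply.
by rewrite mulrA.
Qed.

End LocalSection.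

(** * Estimates for the block diagonal part *)

Section LocalSectionEstimates.
Context {R : realType} {H : completeNormedModType R[i]}.
Variable ip : {dot H for Num.conj}.
Hypothesis ip_norm : forall h : H, ip h h = `|h| ^+ 2.
Hypothesis H_infinite : ~ finite_dim [set: H].
Variable Phi : (nat -> R) -> R.
Hypothesis Phi_sn : symmetric_norming Phi.
Local Notation N := (@rnorm R H).
Local Notation SP := (S_Phi ip Phi).
Local Notation UI := (U_I ip Phi).
Local Notation adj := (adj ip).
Implicit Types (h : H) (u v g : UI).

Variables (w : option nat) (p : nat -> H -> H).
Hypothesis p_proj : orthogonal_projections ip w p.
Hypothesis p0E : complement_projection w p.
Variable P : SP -> SP.
Hypothesis PE : is_pinching w p P.
Local Notation fam := (in_family w).
Local Notation comm := (commutes w p).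
Local Notation p0 := (p 0%N).
Local Notation psum := (psum w p).
Local Notation U_inv := (U_inv ip_norm H_infinite Phi_sn).
Local Notation U_mul := (U_mul ip_norm H_infinite Phi_sn).

Let bp i : fam i -> bounded_op (p i).
Proof. by move=> /(proj1 p_proj)/(hermitian_projectionP ip_norm)[]. Qed.
Let pp i h : fam i -> p i (p i h) = p i h.
Proof. by move=> /(proj1 p_proj)/(hermitian_projectionP ip_norm)[]. Qed.
Let pa i : fam i -> self_adjoint ip (p i).
Proof. by move=> /(proj1 p_proj)/(hermitian_projectionP ip_norm)[]. Qed.
Let pij i j h : fam i -> fam j -> i <> j -> p i (p j h) = 0.
Proof. by move=> fi fj ij; have := congr1 (fun f => f h) ((proj2 p_proj) i j fi fj ij). Qed.
Let bp0 : bounded_op p0 := p0_bounded ip_norm p_proj p0E.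
Let ext := proj_ext ip_norm p_proj p0E.

Local Notation c_ := (@diag_part R H ip ip_norm H_infinite Phi Phi_sn p P).
Local Notation near_P := (@near_P R H ip Phi P).

Let left_actE u (x : SP) h : set_val (left_act P u x) h =
  U_val u (set_val (P (Lmul (adj (U_val u)) x)) h).
Proof. by have := left_actE ip_norm H_infinite Phi_sn P u x => ->. Qed.

Let p_c u j h : fam j -> p j (c_ u h) = p j (adj (U_val u) (p j h)).
Proof. exact: (p_diag_part ip_norm H_infinite Phi_sn p_proj p0E PE). Qed.
Let p0_c u h : p0 (c_ u h) = p0 (adj (U_val u) (p0 h)).
Proof. exact: (p0_diag_part ip_norm H_infinite Phi_sn p_proj p0E PE). Qed.
Let c_p0 u h : c_ u (p0 h) = p0 (adj (U_val u) (p0 h)).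
Proof. exact: (diag_part_p0 ip_norm H_infinite Phi_sn p_proj p0E PE). Qed.
Let c_comm u : comm (c_ u).
Proof. exact: (diag_part_comm ip_norm H_infinite Phi_sn p_proj p0E PE). Qed.
Let bc u : bounded_op (c_ u).
Proof. exact: (diag_part_bounded ip_norm H_infinite Phi_sn p_proj p0E). Qed.

Let q0 h : p0 (p0 h) = p0 h. Proof. by rewrite (p0_idem ip_norm p_proj p0E). Qed.

(* [x] is the orthogonal projection on the span of [p_1 h, ..., p_n h]. *)
Lemma exists_block_projection n h : exists x : H -> H, [/\ rank_le ip n x, opb 1 x &
  forall j, fam j -> x (p j h) = (if (j <= n)%N then p j h else 0) /\
    forall y, p j (x y) = x (p j y)].
Proof.
pose e (i : 'I_n) : H := if fam i.+1 then (N (p i.+1 h))^-1%:C *: p i.+1 h else 0.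
have eE (i : 'I_n) : p i.+1 h = (N (p i.+1 h))%:C *: e i \/ ~~ fam i.+1.
  rewrite /e; case: ifP; [left|by right].
  have [->|h0] := eqVneq (p i.+1 h) 0; first by rewrite !scaler0.
  by rewrite scalerA -rmorphM divff ?scale1r // gt_eqF // rnorm_gt0.
have pe (i : 'I_n) : fam i.+1 -> p i.+1 (e i) = e i.
  by move=> fi; rewrite /e fi (bopZ (bp fi)) pp.
have pe0 (i : 'I_n) j : fam j -> j <> i.+1 -> p j (e i) = 0.
  move=> fj ji; rewrite /e; case: ifP => fi; last by rewrite (bop0 (bp fj)).
  by rewrite (bopZ (bp fj)) pij // scaler0.
have ee0 (i j : 'I_n) : i <> j -> ip (e i) (e j) = 0.
  move=> ij; have [fi|fi] := boolP (fam i.+1); last by rewrite {1}/e (negPf fi) (ip0l ip).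
  rewrite -(pe i fi) pa // pe0 ?(ip0r ip) // => -[ij'].
  by apply: ij; exact: val_inj.
have ee1 (i : 'I_n) : ip (e i) (e i) *: e i = e i.
  have [->|ei0] := eqVneq (e i) 0; first by rewrite scaler0.
  suff -> : ip (e i) (e i) = 1 by rewrite scale1r.
  rewrite (ip_normr ip_norm); move: ei0; rewrite /e; case: ifP => fi; last by rewrite eqxx.
  have [->|h0 _] := eqVneq (p i.+1 h) 0; first by rewrite scaler0 eqxx.
  by rewrite rnormZr gtr0_norm ?invr_gt0 ?rnorm_gt0 // mulVf ?expr1n // gt_eqF // rnorm_gt0.
pose x y := \sum_i ip y (e i) *: e i.
have xe i : x (e i) = e i.
  rewrite /x (bigD1 i) //= big1 ?addr0 ?ee1 // => j /eqP ji.
  by rewrite ee0 ?scale0r //; exact: nesym.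
have xn : rank_le ip n x by exists e, e.
have bx := rank_le_bounded ip_norm xn.
have xx y : x (x y) = x y.
  by rewrite {2 3}/x (bop_sum bx); apply: eq_bigr => i _; rewrite (bopZ bx) xe.
have xa : self_adjoint ip x.
  move=> a b; rewrite /x (ip_suml ip) (ip_sumr ip); apply: eq_bigr => i _.
  by rewrite (ipZl ip) (ipZr ip) (ipC ip b) conjcK mulrC.
exists x; split => //; first by apply: proj_contract => //; apply: funext => y; exact: xx.
move=> j fj; have j1 : (1 <= j)%N by case/andP: fj.
split=> [|y].
  case: leqP => jn.
    have jn' : (j.-1 < n)%N by rewrite prednK.
    have := eE (Ordinal jn'); rewrite /= prednK // fj => -[->|//].
    by rewrite (bopZ bx) xe.
  rewrite /x big1 // => i _; rewrite pa // pe0 ?(ip0r ip) ?scale0r //.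
  by move=> ji; move: jn; rewrite ji ltnS leqNgt ltn_ord.
rewrite /x (bop_sum (bp fj)); apply: eq_bigr => i _; rewrite (bopZ (bp fj)) pa //.
have [ji|/eqP ji] := eqVneq j i.+1; last by rewrite pe0 // scaler0 (ip0r ip) scale0r.
by rewrite ji pe // -ji.
Qed.

Variable M : R.
Hypothesis M0 : 0 < M.
Hypothesis M_bound : forall n, exists2 n', psum n = psum n' &
  Phi (trunc (fun=> 1) n') <= M.

(** [near_P] is tested on the block projection [x], of ideal norm at most [M]: there P x h = psum n
    h and P (u^* x) h = c_u (psum n h). Passing from n to n' keeps [M] uniform. *)
Lemma diag_part_psum d u n h : 0 <= d -> near_P d u ->
  N (U_val u (c_ u (psum n h)) - psum n h) <= M * d * N h.
Proof.
move=> d0 ud; have [n' -> n'M] := M_bound n.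
have [x [xn x1 xp]] := exists_block_projection n' h.
pose X := to_S (S_Phi_rank ip_norm H_infinite Phi_sn xn).
have XM : Phi_le ip Phi (set_val X) M.
  rewrite to_SE -[M]mulr1.
  exact: Phi_le_bound ip_norm H_infinite Phi Phi_sn n' M x 1 xn ler01 x1 n'M.
have := ud X M M0 XM h; rewrite fctE fctE left_actE.
have jE j : fam j -> p j (psum n' h) = (if (j <= n')%N then p j h else 0).
  move=> fj; case: leqP => jn; first by rewrite (psum_proj ip_norm p_proj).
  exact: psum_proj_gt.
have sp0 : p0 (psum n' h) = 0.
  rewrite /psum (bop_sum bp0) big1 // => i fi; exact: (p0_pj ip_norm p_proj p0E).
have PX : set_val (P X) h = psum n' h.
  apply: ext => [j fj|]; last by rewrite (p0_pinch ip_norm p_proj p0E PE) sp0.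
  rewrite (pj_pinch ip_norm p_proj PE) // to_SE.
  have [-> _] := xp j fj; rewrite jE //; case: ifP => _; first exact: pp.
  exact: bop0 (bp fj).
have PuX : set_val (P (Lmul (adj (U_val u)) X)) h = c_ u (psum n' h).
  apply: ext => [j fj|]; last first.
    rewrite (p0_pinch ip_norm p_proj p0E PE) p0_c sp0.
    by rewrite (bop0 (U_adj_bounded ip_norm u)) (bop0 bp0).
  rewrite (pj_pinch ip_norm p_proj PE) //.
  rewrite (Lmul_adjE ip_norm H_infinite Phi_sn u X) /= to_SE.
  have [-> _] := xp j fj; by rewrite p_c // jE //; case: ifP => // _; rewrite !(bop0 (U_adj_bounded ip_norm u)) (bop0 (bp fj)).
by rewrite PuX PX.
Qed.

Lemma diag_part_p0C d u h : 0 <= d -> near_P d u ->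
  N (U_val u (c_ u (h - p0 h)) - (h - p0 h)) <= M * d * N h.
Proof.
move=> d0 ud.
have buc : bounded_op ((U_val u \o c_ u) - id).
  apply: bounded_sub; last exact: bounded_id.
  by apply: bounded_comp => //; exact: U_bounded.
suff : N (0 - ((U_val u \o c_ u) - id) (h - p0 h)) <= M * d * N h by rewrite sub0r rnormN.
have ul : psum n h @[n --> \oo] --> h - p0 h by exact: p0E.
have vl := bop_cvg buc ul; apply: (rcvg_le vl) => n.
by rewrite sub0r rnormN; exact: diag_part_psum.
Qed.

(** With g = (1 - p_0) h, the estimate for u^-1 says that u g is close to c_(u^-1) g, and p_0
    annihilates the latter. *)
Lemma p0_U_p0C d u h : 0 <= d -> near_P d u ->
  N (p0 (U_val u (h - p0 h))) <= M * d * N h.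
Proof.
move=> d0 ud; have ud' := near_P_inv ip_norm H_infinite Phi_sn d0 ud.
have := diag_part_p0C h d0 ud'; set g := h - p0 h; rewrite U_invE.
have g0 : p0 g = 0 by rewrite (bopB bp0) q0 subrr.
apply: le_trans; have -> : p0 (U_val u g) = - p0 (c_ (U_inv u) g - U_val u g).
  by rewrite (bopB bp0) p0_c g0 U_invE (adjK ip_norm (U_bounded u))
    (bop0 (U_bounded u)) (bop0 bp0) sub0r opprK.
rewrite rnormN; have := p0_contract ip_norm p_proj p0E (c_ (U_inv u) g - U_val u g).
rewrite mul1r => /le_trans; apply.
by rewrite -(U_adj_norm ip_norm u) (bopB (U_adj_bounded ip_norm u)) U_adjK.
Qed.

(** The adjoint corner, bounded by duality: |z|^2 = <h, p_0 u z>. *)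
Lemma p0C_adj_p0 d u h : 0 <= d -> near_P d u ->
  N (adj (U_val u) (p0 h) - p0 (adj (U_val u) (p0 h))) <= M * d * N h.
Proof.
move=> d0 ud; set y := adj (U_val u) (p0 h); set z := y - p0 y.
have pz : p0 z = 0 by rewrite (bopB bp0) q0 subrr.
have p0a := p0_self_adjoint ip_norm p_proj p0E.
have zz : N z ^+ 2 <= N h * (M * d * N z).
  have -> : N z ^+ 2 = rip ip h (p0 (U_val u (z - p0 z))).
    rewrite pz subr0 -(rip_norm ip_norm) {1}/z (ripDl ip) (ripNl ip).
    have -> : rip ip (p0 y) z = 0 by rewrite /rip p0a pz (ip0r ip).
    by rewrite subr0 /rip /y (adjE' ip_norm (U_bounded u)) p0a.
  apply: le_trans (rip_le1 ip_norm _ _) _; rewrite ler_wpM2l ?rnorm_ge0 //.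
  exact: p0_U_p0C.
have [->|z0] := eqVneq (N z) 0; first by rewrite !mulr_ge0 ?rnorm_ge0 // ltW.
rewrite -(@ler_pM2r _ (N z)) ?lt_neqAle 1?eq_sym ?z0 ?rnorm_ge0 //.
by rewrite -expr2; apply: le_trans zz _; rewrite mulrCA mulrA.
Qed.

(** The factor 2 counts the two parts: on the range of 1 - p_0 this is [diag_part_p0C], and on that
    of p_0 the operator is u (p_0 - 1) u^*. *)
Lemma U_diag_part_near d u : 0 <= d -> near_P d u ->
  opb (2 * (M * d)) ((U_val u \o c_ u) - id).
Proof.
move=> d0 ud h; rewrite -[(_ - _) h]/(U_val u (c_ u h) - h).
have -> : U_val u (c_ u h) - h = (U_val u (c_ u (h - p0 h)) - (h - p0 h)) +
    U_val u (p0 (adj (U_val u) (p0 h)) - adj (U_val u) (p0 h)).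
  rewrite (bopB (U_bounded u)) U_Kadj -c_p0 (bopB (bc u)) (bopB (U_bounded u)).
  by apply: (rip_ext ip_norm) => y; rewrite !(ripDl ip, ripNl ip); ring.
apply: le_trans (rnormD _ _) _; rewrite mulrDl mul1r mulrDl lerD //.
  exact: diag_part_p0C.
by rewrite U_norm // rdistC; exact: p0C_adj_p0.
Qed.

(** With e = 1 - p_i0 and v = u c - 1, on the range of p_i0 one has v = - u e u^*. So v = v e - u e
    u^* p_i0, of rank bounded independently of u. *)
Lemma U_diag_part_finite_rank u i0 r : i0 = 0%N \/ fam i0 ->
  rank_le ip r (id - p i0) -> rank_le ip (r + r) ((U_val u \o c_ u) - id).
Proof.
move=> i0P pr; set v := (U_val u \o c_ u) - id.
have bu := U_bounded u.
have bv : bounded_op v.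
  by apply: bounded_sub; [exact: bounded_comp|exact: bounded_id].
have bpi : bounded_op (p i0) by case: i0P => [->|/bp].
have cpi h : c_ u (p i0 h) = p i0 (adj (U_val u) (p i0 h)).
  case: i0P => [->|fi]; first exact: c_p0.
  by rewrite c_comm // p_c.
pose e := id - p i0.
have -> : v = (v \o e \o id) - (U_val u \o e \o (adj (U_val u) \o p i0)).
  apply: funext => h; rewrite -[RHS]/(v (h - p i0 h) -
    U_val u (adj (U_val u) (p i0 h) - p i0 (adj (U_val u) (p i0 h)))).
  rewrite (bopB bv) (bopB bu) U_Kadj.
  have -> : v (p i0 h) = U_val u (p i0 (adj (U_val u) (p i0 h))) - p i0 h.
    by rewrite -cpi.
  by apply: (rip_ext ip_norm) => y; rewrite !(ripDl ip, ripNl ip); ring.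
apply: rank_le_sub; apply: (rank_le_comp ip_norm) => //; first exact: bounded_id.
by apply: bounded_comp => //; exact: U_adj_bounded.
Qed.

(* [K] converts operator norm estimates into estimates in the ideal. *)
Lemma local_section K : 0 <= K ->
  (forall u d, 0 <= d -> opb d ((U_val u \o c_ u) - id) ->
    Phi_le ip Phi ((U_val u \o c_ u) - id) (K * d)) ->
  forall eps, 0 < eps -> exists2 d, 0 < d & forall u, near_P d u ->
    exists2 g, left_act P g = left_act P u & Phi_le ip Phi (U_val g - id) eps.
Proof.
move=> K0 KP eps eps0.
(* With d = 1 / D, the first term gives 2 M d <= 1/32 as [polar_unitary] requires, and the second 64
   K (2 M d) <= eps. *)
pose D := 64 * M + 128 * M * K / eps.
have D0 : 0 < D.
  by rewrite /D ltr_pwDl ?mulr_gt0 // divr_ge0 ?(ltW eps0) // !mulr_ge0 // ltW.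
pose d := D^-1; have d0 : 0 < d by rewrite invr_gt0.
have Dd : D * d = 1 by rewrite divff // gt_eqF.
have h1 : 0 <= 128 * M * K / eps * d.
  by rewrite mulr_ge0 ?(ltW d0) // divr_ge0 ?(ltW eps0) // !mulr_ge0 // ltW.
have h2 : 0 < M * d by rewrite mulr_gt0.
have De : 64 * M * d + 128 * M * K / eps * d = 1 by rewrite -mulrDl.
exists d => // u ud.
have vd := U_diag_part_near (ltW d0) ud.
have d2 : 0 <= 2 * (M * d) by rewrite mulr_ge0 // ltW.
have d32 : 2 * (M * d) <= 32^-1.
  by move: De h1; move: (128 * M * K / eps * d) => t; lra.
have vk := KP _ _ d2 vd.
have bv : bounded_op (U_val u \o c_ u) by apply: bounded_comp => //; exact: U_bounded.
have [z [bz Wu Wk _ zq]] := polar_unitary ip_norm H_infinite Phi_sn bv d2 d32 vd vk.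
have SW : SP ((U_val u \o c_ u \o z) - id) by apply/(S_PhiP ip Phi_sn); eexists; exact: Wk.
pose g := to_U (conj Wu SW).
exists g; last first.
  apply: (Phi_le_widen Wk).
  have : 128 * M * K * d <= eps.
    have : 128 * M * K / eps * d <= 1.
      by move: De h2; move: (128 * M * K / eps * d) => t; lra.
    by rewrite mulrAC ler_pdivrMr // mul1r.
  by apply: le_trans; rewrite le_eqVlt; apply/orP; left; apply/eqP; ring.
have gE : U_mul u (U_mul (U_inv u) g) = g.
  by apply: U_inj => h; rewrite !U_mulE U_invE U_Kadj.
rewrite -gE; apply: (comm_left_act ip_norm H_infinite Phi_sn p_proj p0E PE) => j fj h.
have kE h' : U_val (U_mul (U_inv u) g) h' = c_ u (z h').
  by rewrite U_mulE U_invE -[U_val g h']/(U_val u (c_ u (z h'))) U_adjK.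
rewrite !kE -c_comm //; congr (c_ u _).
(* v^* v = c^* c commutes with the p_j, hence so do z and u^-1 g = c z. *)
have vv : adj (U_val u \o c_ u) \o (U_val u \o c_ u) = adj (c_ u) \o c_ u.
  rewrite (adj_comp ip_norm (U_bounded u) (bc u)); apply: funext => h' /=.
  by rewrite U_adjK.
have := zq (p j) (bp fj); rewrite vv => /(_ _)/(congr1 (fun f => f h)) /= -> //.
apply: funext => h' /=; rewrite c_comm //.
by rewrite (commutes_adj ip_norm p_proj (bc u)).
Qed.

End LocalSectionEstimates.

(** * Boundedness of the pinching and the two kinds of ideals *)

Section PinchBound.
Context {R : realType} {H : completeNormedModType R[i]}.
Variable ip : {dot H for Num.conj}.
Hypothesis ip_norm : forall h : H, ip h h = `|h| ^+ 2.
Hypothesis H_infinite : ~ finite_dim [set: H].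
Variable Phi : (nat -> R) -> R.
Hypothesis Phi_sn : symmetric_norming Phi.
Local Notation N := (@rnorm R H).
Local Notation SP := (S_Phi ip Phi).
Local Notation UI := (U_I ip Phi).
Implicit Types (h : H) (u v g : UI).

Variables (w : option nat) (p : nat -> H -> H).
Hypothesis p_proj : orthogonal_projections ip w p.
Hypothesis p0E : complement_projection w p.
Variable P : SP -> SP.
Hypothesis PE : is_pinching w p P.
Local Notation fam := (in_family w).
Local Notation p0 := (p 0%N).
Local Notation psum := (psum w p).

Let bp i : fam i -> bounded_op (p i).
Proof. by move=> /(proj1 p_proj)/(hermitian_projectionP ip_norm)[]. Qed.
Let pp i h : fam i -> p i (p i h) = p i h.
Proof. by move=> /(proj1 p_proj)/(hermitian_projectionP ip_norm)[]. Qed.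
Let pa i : fam i -> self_adjoint ip (p i).
Proof. by move=> /(proj1 p_proj)/(hermitian_projectionP ip_norm)[]. Qed.
Let pij i j h : fam i -> fam j -> i <> j -> p i (p j h) = 0.
Proof. by move=> fi fj ij; have := congr1 (fun f => f h) ((proj2 p_proj) i j fi fj ij). Qed.
Let bp0 : bounded_op p0 := p0_bounded ip_norm p_proj p0E.

Lemma pinch_partial_sum_norm n (a : nat -> H) :
  N (\sum_(1 <= i < n.+1 | fam i) p i (a i)) ^+ 2 =
  \sum_(1 <= i < n.+1 | fam i) N (p i (a i)) ^+ 2.
Proof.
apply: complexI; rewrite -(ip_normr ip_norm) rmorph_sum /= {1}(ip_suml ip).
rewrite big_seq_cond [RHS]big_seq_cond; apply: eq_bigr => j /andP[].
rewrite mem_index_iota => /andP[j1 jn] fj.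
rewrite pa // (bop_sum (bp fj)) big_mkcond (bigD1_seq j) ?iota_uniq //=; last first.
  by rewrite mem_index_iota j1.
rewrite fj pp // big1 ?addr0 => [|i /eqP ij]; last first.
  by case: ifP => // fi; rewrite pij //; exact: nesym.
by rewrite -(ip_normr ip_norm) pa // pp.
Qed.

(** By Pythagoras the blocks can be estimated separately. *)
Lemma pinch_opb (r : R) (x : SP) : 0 <= r -> opb r (set_val x) -> opb r (set_val (P x)).
Proof.
move=> r0 xr h; rewrite -rnormN -sub0r.
have ul : \sum_(1 <= i < n.+1 | fam i) p i (set_val x (p i h)) @[n --> \oo] -->
    set_val (P x) h by exact: (pinch_cvg ip_norm p_proj PE).
apply: (rcvg_le ul) => n.
rewrite sub0r rnormN -(@ler_pXn2r _ 2) ?nnegrE ?mulr_ge0 ?rnorm_ge0 //.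
rewrite (pinch_partial_sum_norm n (fun i => set_val x (p i h))).
apply: (@le_trans _ _ (r ^+ 2 * N (psum n h) ^+ 2)); last first.
  rewrite exprMn ler_wpM2l ?sqr_ge0 // ler_pXn2r ?nnegrE ?rnorm_ge0 //.
  by have := psum_contract ip_norm p_proj n h; rewrite mul1r.
rewrite (pinch_partial_sum_norm n (fun=> h)) mulr_sumr; apply: ler_sum => i fi.
rewrite -exprMn ler_pXn2r ?nnegrE ?mulr_ge0 ?rnorm_ge0 //.
have [_ _ _ p1] := hermitian_projectionP ip_norm ((proj1 p_proj) i fi).
by have := p1 (set_val x (p i h)); rewrite mul1r => /le_trans; apply.
Qed.

Lemma pinch_Phi_compact M (x : SP) r : (forall n, Phi (trunc (fun=> 1) n) <= M) ->
  Phi_le ip Phi (set_val x) r -> Phi_le ip Phi (set_val (P x)) (M * r).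
Proof.
move=> nM xr; have r0 := Phi_le_ge0 Phi_sn xr.
have Pr := pinch_opb r0 (Phi_le_opb ip_norm H_infinite Phi_sn xr).
have [cPx _] := S_PhiV (P x).
exact: (Phi_le_compact ip_norm H_infinite Phi_sn cPx r0 Pr nM).
Qed.

(** Any constant independent of [x] will do. On the range of p_i0 the pinching is the compression
    p_i0 x p_i0, or 0 if i0 = 0; what remains has rank at most k. *)
Lemma pinch_Phi_rank i0 k (x : SP) r : i0 = 0%N \/ fam i0 -> rank_le ip k (id - p i0) ->
  Phi_le ip Phi (set_val x) r -> Phi_le ip Phi (set_val (P x)) (2 * (r + k%:R * (2 * r))).
Proof.
move=> i0P pk xr; have r0 := Phi_le_ge0 Phi_sn xr.
have xo := Phi_le_opb ip_norm H_infinite Phi_sn xr.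
have [bpi p1] : bounded_op (p i0) /\ opb 1 (p i0).
  case: i0P => [->|fi]; first by split => //; exact: (p0_contract ip_norm p_proj p0E).
  by have [] := hermitian_projectionP ip_norm ((proj1 p_proj) i0 fi).
have -> : set_val (P x) = (set_val (P x) \o p i0) + (set_val (P x) \o (id - p i0)).
  apply: funext => h; rewrite -[RHS]/(set_val (P x) (p i0 h) + set_val (P x) (h - p i0 h)).
  by rewrite (bopB (S_bounded (P x))) addrC subrK.
have b1 : bounded_op (id - p i0) by apply: bounded_sub => //; exact: bounded_id.
apply: Phi_le_add => //.
  case: i0P => [i00|fi]; last first.
    have -> : set_val (P x) \o p i0 = p i0 \o set_val x \o p i0.
      by apply: funext => h /=; rewrite (pinch_pj ip_norm p_proj PE).
    rewrite -[r]mul1r -[1 * r]mulr1; exact: Phi_le_comp.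
  have -> : set_val (P x) \o p i0 = 0.
    by apply: funext => h; rewrite /= i00 (pinch_p0 ip_norm p_proj p0E PE).
  apply: (Phi_le_widen (r := 0%:R * 0)); last by rewrite mul0r.
  apply: (Phi_le_rank ip_norm H_infinite Phi_sn (rank_le0 ip)) => // h.
  by rewrite [X in N X](_ : _ = 0) // rnorm0 mul0r.
apply: (Phi_le_rank ip_norm H_infinite Phi_sn).
- exact: (rank_le_comp ip_norm (S_bounded (P x)) (bounded_id (H := H)) pk).
- by rewrite mulr_ge0.
rewrite mulrC; apply: opbM => //; first exact: pinch_opb.
by apply: opbD => [h|]; [rewrite mul1r|exact: opbN].
Qed.

(** Gram-Schmidt in the range of [q]: either it stops and [q] is the projection on finitely many
    vectors, or it yields n + 1 independent vectors in a space of dimension n. *)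
Lemma finite_dim_rank (q : H -> H) : bounded_op q -> q \o q = q -> self_adjoint ip q ->
  finite_dim (range q) -> exists k, rank_le ip k q.
Proof.
move=> bq qq qa [n qn].
have qqE h : q (q h) = q h by exact: (congr1 (fun f => f h) qq).
have W k : (exists2 j, (j <= k)%N & rank_le ip j q) \/
    exists e, orthonormal_upto ip e k /\ forall i, (i < k)%N -> q (e i) = e i.
  elim: k => [|k [[j jk qj]|[e [eo eq]]]]; first by right; exists (fun=> 0); split.
    by left; exists j => //; exact: leqW.
  have [[h hq]|/forallNP qe] := pselect (exists h, q h - comb ip e k (q h) <> 0); last first.
    left; exists k => //; exists (fun i => e i), (fun i => e i) => h.
    have := qe h; rewrite notK => /eqP; rewrite subr_eq0 => /eqP ->.
    by apply: eq_bigr => i _; rewrite qa eq.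
  right; set g := q h - comb ip e k (q h) in hq.
  have g0 := rnorm_gt0 (introN eqP hq).
  pose g1 := (N g)^-1%:C *: g.
  have Ng1 : N g1 = 1 by rewrite rnormZr gtr0_norm ?invr_gt0 // mulVf // gt_eqF.
  have qg : q g = g.
    rewrite /g (bopB bq) qqE /comb (bop_sum bq); congr (_ - _).
    by apply: eq_bigr => i _; rewrite (bopZ bq) eq.
  have g1e i : (i < k)%N -> ip g1 (e i) = 0.
    by move=> ik; rewrite (ipZl ip) ortho_comb // mulr0.
  exists (fun i => if (i < k)%N then e i else g1); split; last first.
    by move=> i _; case: ifP => [/eq //|_]; rewrite (bopZ bq) qg.
  move=> i j; rewrite ltnS leq_eqVlt => /orP[/eqP ->|ik];
    rewrite ltnS leq_eqVlt => /orP[/eqP ->|jk]; rewrite ?ltnn ?ik ?jk.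
  - by rewrite (ip_normr ip_norm) Ng1 expr1n eqxx.
  - by rewrite g1e // gtn_eqF.
  - by rewrite (ipC ip) g1e // conjc0 ltn_eqF.
  - exact: eo.
have [[j _ qj]|[e [eo eq]]] := W n.+1; first by exists j.
exfalso; pose S := range (fun c : 'I_n.+1 -> R[i] => \sum_i c i *: e i).
have Sq : S `<=` range q.
  move=> _ [c _ <-]; exists (\sum_i c i *: e i) => //.
  by rewrite (bop_sum bq); apply: eq_bigr => i _; rewrite (bopZ bq) eq.
suff /(has_dim_leq Sq) : has_dim S n.+1 by move=> /(_ _ qn); rewrite ltnn.
have sumE (c : 'I_n.+1 -> R[i]) (j : 'I_n.+1) : ip (\sum_i c i *: e i) (e j) = c j.
  rewrite (ip_suml ip) (bigD1 j) //= big1 ?addr0; first by rewrite (ipZl ip) eo // eqxx mulr1.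
  by move=> i /negPf ij; rewrite (ipZl ip) eo // -val_eqE /= in ij *; rewrite ij mulr0.
exists (fun i : 'I_n.+1 => e i); split=> [i|v [c _ <-]].
  exists (fun j => (i == j)%:R) => //; rewrite (bigD1 i) //= eqxx scale1r big1 ?addr0 //.
  by move=> j /negPf ij; rewrite eq_sym ij scale0r.
exists [ffun i => c i]; split.
  by apply: eq_bigr => i _; rewrite ffunE.
by move=> c' cc'; apply/ffunP => j; rewrite ffunE -(sumE c) cc' sumE.
Qed.

Lemma rank_le_sum_seq (I : eqType) (s : seq I) (Q : pred I) (F : I -> H -> H) :
  (forall i, i \in s -> Q i -> exists k, rank_le ip k (F i)) ->
  exists k, rank_le ip k (fun h => \sum_(i <- s | Q i) F i h).
Proof.
elim: s => [|i s IH] sF.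
  by exists 0%N; exists (fun=> 0), (fun=> 0) => h; rewrite big_nil big_ord0.
have [k sk] : exists k, rank_le ip k (fun h => \sum_(i <- s | Q i) F i h).
  by apply: IH => j js; apply: sF; rewrite inE js orbT.
case Qi : (Q i); last first.
  by exists k; under eq_fun do rewrite big_cons Qi.
have [k' Fk'] := sF i (mem_head _ _) Qi.
exists (k' + k)%N; under eq_fun do rewrite big_cons Qi.
exact: rank_le_add.
Qed.

(** In the finite case M = m works: the partial sums are constant from m on, and Phi (1, ..., 1)
    with n ones is at most n. All p_i with i <= m other than p_i0 then have finite rank, and they
    add up to 1 - p_i0. *)
Lemma ideal_cases (w_ge1 : fam 1%N)
    (not_compact : SP <> @compact_op R H -> exists m : nat, w = Some m /\
        exists! i : nat, (i <= m)%N /\ infinite_rank (p i)) :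
  exists M, [/\ 0 < M,
    (forall n, exists2 n', psum n = psum n' & Phi (trunc (fun=> 1) n') <= M) &
    (forall n, Phi (trunc (fun=> 1) n) <= M) \/
    exists i0 k, (i0 = 0%N \/ fam i0) /\ rank_le ip k (id - p i0)].
Proof.
have one_le n : (0 < n)%N -> 1 <= Phi (trunc (fun=> 1) n).
  by case: n => // n _; exact: (Phi_trunc_head Phi_sn n (ler01 : 0 <= (fun=> 1) 0%N)).
have [SK|/not_compact[m [wm [i0 [[i0m _] i0U]]]]] := pselect (SP = @compact_op R H).
  have [M nM] := compact_ideal_bound ip_norm H_infinite Phi_sn SK.
  exists M; split; [|by move=> n; exists n|by left].
  by apply: lt_le_trans ltr01 (le_trans (one_le 1%N isT) (nM 1%N)).
have famE i : fam i = (1 <= i <= m)%N by rewrite /in_family wm.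
have m1 : (1 <= m)%N by move: w_ge1; rewrite famE => /andP[].
have psum_m n : (m <= n)%N -> psum n = psum m.
  move=> mn; apply: funext => h; rewrite /psum.
  rewrite (big_cat_nat (n := m.+1)) //= [X in _ + X]big1_seq ?addr0 // => i.
  by rewrite famE mem_index_iota; lia.
exists m%:R; split; first by rewrite ltr0n.
  move=> n; case: (leqP m n) => mn.
    by exists m; [exact: psum_m|exact: Phi_ones].
  by exists n => //; apply: le_trans (Phi_ones Phi_sn n) _; rewrite ler_nat ltnW.
right; exists i0.
have frank i : (i <= m)%N -> i <> i0 -> exists k, rank_le ip k (p i).
  move=> im ii0; have fd : finite_dim (range (p i)).
    by apply: contrapT => nfd; apply: ii0; apply/esym/i0U.
  have [i_0|i_0] := eqVneq i 0%N.
    move: fd; rewrite i_0; apply: finite_dim_rank => //.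
      by apply: funext => h; exact: (p0_idem ip_norm p_proj p0E).
    exact: (p0_self_adjoint ip_norm p_proj p0E).
  have fi : fam i by rewrite famE im lt0n i_0.
  apply: finite_dim_rank => //; [exact: bp| |exact: pa].
  by apply: funext => h; exact: pp.
have [k kP] : exists k, rank_le ip k (fun h => \sum_(i <- index_iota 0 m.+1 | i != i0) p i h).
  apply: rank_le_sum_seq => i; rewrite mem_index_iota => im /eqP; exact: frank.
exists k; split.
  by have [->|i00] := eqVneq i0 0%N; [left|right; rewrite famE i0m lt0n i00].
have -> : id - p i0 = fun h => \sum_(i <- index_iota 0 m.+1 | i != i0) p i h; last by [].
apply: funext => h; rewrite -[LHS]/(h - p i0 h).
have hE : h = \sum_(0 <= i < m.+1) p i h.
  have : h - p0 h = psum m h.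
    have ul : psum n h @[n --> \oo] --> h - p0 h by exact: p0E.
    apply: (rcvg_cst (n0 := m) ul) => n mn.
    by have := congr1 (fun f => f h) (psum_m n mn).
  move=> /eqP; rewrite subr_eq addrC => /eqP {1}->; rewrite big_nat_recl //; congr (_ + _).
  rewrite /psum big_add1 /= big_mkcond big_nat [RHS]big_nat; apply: eq_bigr => i.
  by rewrite famE => ->.
by rewrite {1}hE (bigD1_seq i0) ?iota_uniq ?mem_index_iota //= addrC addKr.
Qed.

End PinchBound.

(** * The topologies of the orbits *)

Section Orbits.
Context {R : realType} {H : completeNormedModType R[i]}.
Variable ip : {dot H for Num.conj}.
Hypothesis ip_norm : forall h : H, ip h h = `|h| ^+ 2.
Hypothesis H_infinite : ~ finite_dim [set: H].
Variable Phi : (nat -> R) -> R.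
Hypothesis Phi_sn : symmetric_norming Phi.
Local Notation N := (@rnorm R H).
Local Notation SP := (S_Phi ip Phi).
Local Notation UI := (U_I ip Phi).
Local Notation adj := (adj ip).
Implicit Types (h : H) (u v g : UI).

Variables (w : option nat) (p : nat -> H -> H).
Hypothesis p_proj : orthogonal_projections ip w p.
Hypothesis p0E : complement_projection w p.
Variable P : SP -> SP.
Hypothesis PE : is_pinching w p P.
Local Notation U_inv := (U_inv ip_norm H_infinite Phi_sn).
Local Notation U_mul := (U_mul ip_norm H_infinite Phi_sn).
Local Notation U_one := (U_one ip_norm H_infinite Phi_sn).

Lemma Phi_norm_ltP x (e : R) : (Phi_norm ip Phi x < e%:E)%E <->
  exists2 r, r < e & Phi_le ip Phi x r.
Proof.
split=> [xe|[r re /(Phi_normP ip Phi_sn) xr]]; last exact: le_lt_trans xr _.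
have := Phi_norm_ge0 ip Phi_sn x; case E : (Phi_norm ip Phi x) xe => [r| |] // xe _.
by exists r => //; apply/(Phi_normP ip Phi_sn); rewrite E.
Qed.

Lemma Phi_le0 : Phi_le ip Phi 0 0.
Proof.
rewrite -(mulr0 0%:R).
apply: (Phi_le_rank ip_norm H_infinite Phi_sn (rank_le0 ip)) => // h.
by rewrite [X in N X](_ : _ = 0) // rnorm0 mul0r.
Qed.

Lemma Phi_norm0 : Phi_norm ip Phi 0 = 0%E.
Proof.
apply/eqP; rewrite eq_le Phi_norm_ge0 // andbT.
by apply/(Phi_normP ip Phi_sn); exact: Phi_le0.
Qed.

Lemma U_dist_triangle (x y z : H -> H) (e : R) : 0 < e ->
  (U_dist ip Phi x y < e%:E)%E -> (U_dist ip Phi y z < e%:E)%E ->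
  (U_dist ip Phi x z < (4 * e)%:E)%E.
Proof.
move=> e0 /Phi_norm_ltP[r re xy] /Phi_norm_ltP[r' re' yz]; apply/Phi_norm_ltP.
exists (2 * (r + r')); first lra.
have -> : x - z = (x - y) + (y - z) by rewrite addrA subrK.
exact: Phi_le_add.
Qed.

Lemma U_dist_refl (x : H -> H) : U_dist ip Phi x x = 0%E.
Proof. by rewrite /U_dist subrr Phi_norm0. Qed.

Lemma U_openP (A : set UI) : open A <-> forall u, A u ->
  exists2 e : R, 0 < e & forall v, (exists2 r, r < e & Phi_le ip Phi (U_val u - U_val v) r) ->
    A v.
Proof.
split=> [/(edist_open_subspace (ltr0n R 4) U_dist_refl U_dist_triangle) oA u /oA[e e0 eA]|oA].
  by exists e => // v uv; apply: eA; exact/Phi_norm_ltP.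
apply/(edist_open_subspace (ltr0n R 4) U_dist_refl U_dist_triangle) => u /oA[e e0 eA].
by exists e => // v uv; apply: eA; exact/Phi_norm_ltP.
Qed.

Lemma U_open_mulr (A : set UI) g : open A -> open [set u | A (U_mul u g)].
Proof.
move=> /U_openP oA; apply/U_openP => u /oA[e e0 eA]; exists e => // v [r re uv].
apply: eA; exists r => //; rewrite -[r]mulr1.
have -> : U_val (U_mul u g) - U_val (U_mul v g) = (U_val u - U_val v) \o U_val g by [].
by apply: Phi_le_compr => //; [exact: U_bounded|exact: U_opb].
Qed.

Lemma B_distP (S T : SP -> SP) (e : R) : (B_dist S T < e%:E)%E <->
  exists2 r, r < e & forall x : SP, Phi_le ip Phi (set_val x) 1 ->
    Phi_le ip Phi (set_val (S x) - set_val (T x)) r.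
Proof.
(* The zero operator belongs to the unit ball, which makes the supremum nonnegative. *)
have [z zE] : exists z : SP, set_val z = 0.
  by exists (to_S (S_Phi_rank ip_norm H_infinite Phi_sn (rank_le0 ip))).
split=> [STe|[r re STr]].
  have ST0 : (0 <= B_dist S T)%E.
    apply: (@le_trans _ _ (Phi_norm ip Phi (set_val (S z) - set_val (T z)))).
      exact: Phi_norm_ge0.
    by apply: ereal_sup_ubound; exists z => //=; rewrite zE Phi_norm0 lee01.
  case E : (B_dist S T) STe ST0 => [r| |] // re _; exists r => // x x1.
  apply/(Phi_normP ip Phi_sn); rewrite -E; apply: ereal_sup_ubound.
  by exists x => //=; apply/(Phi_normP ip Phi_sn).
apply: le_lt_trans (_ : (_ <= r%:E)%E) _; last by rewrite lte_fin.
apply: ge_ereal_sup => _ [x /= /(Phi_normP ip Phi_sn) x1 <-].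
by apply/(Phi_normP ip Phi_sn); exact: STr.
Qed.

Lemma B_dist_triangle (S T Q : SP -> SP) (e : R) : 0 < e ->
  (B_dist S T < e%:E)%E -> (B_dist T Q < e%:E)%E -> (B_dist S Q < (4 * e)%:E)%E.
Proof.
move=> e0 /B_distP[r re ST] /B_distP[r' re' TQ]; apply/B_distP.
exists (2 * (r + r')); first lra.
move=> x x1; have -> : set_val (S x) - set_val (Q x) =
  (set_val (S x) - set_val (T x)) + (set_val (T x) - set_val (Q x)) by rewrite addrA subrK.
by apply: Phi_le_add => //; [exact: ST|exact: TQ].
Qed.

Lemma B_dist_refl (S : SP -> SP) : B_dist S S = 0%E.
Proof.
apply/eqP; rewrite eq_le; apply/andP; split.
  by apply: ge_ereal_sup => _ [x _ <-]; rewrite subrr Phi_norm0.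
have [z zE] : exists z : SP, set_val z = 0.
  by exists (to_S (S_Phi_rank ip_norm H_infinite Phi_sn (rank_le0 ip))).
apply: ereal_sup_ubound; exists z => /=; first by rewrite zE Phi_norm0 lee01.
by rewrite subrr Phi_norm0.
Qed.

Let left_E u (x : SP) h : set_val (left_act P u x) h =
  U_val u (set_val (P (Lmul (adj (U_val u)) x)) h).
Proof. by have := left_actE ip_norm H_infinite Phi_sn P u x => ->. Qed.

Lemma to_range_eq (X Y : Type) (f : X -> Y) x y :
  to_range f x = to_range f y <-> f x = f y.
Proof. by split=> [/(congr1 sval)//|fxy]; apply: val_inj. Qed.

Lemma left_orbit_map_eq u v :
  left_orbit_map P u = left_orbit_map P v <-> left_act P u = left_act P v.
Proof. exact: to_range_eq. Qed.

Lemma Ad_orbit_map_eq u v :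
  Ad_orbit_map P u = Ad_orbit_map P v <-> Ad_act P u = Ad_act P v.
Proof. exact: to_range_eq. Qed.

Lemma left_orbit_openP (A : set (left_orbit P)) : open A <->
  forall u, A (left_orbit_map P u) -> exists2 e : R, 0 < e & forall v,
    (exists2 r, r < e & forall x : SP, Phi_le ip Phi (set_val x) 1 ->
      Phi_le ip Phi (set_val (left_act P u x) - set_val (left_act P v x)) r) ->
    A (left_orbit_map P v).
Proof.
split=> [/(edist_open_subspace (ltr0n R 4) B_dist_refl B_dist_triangle) oA u /oA[e e0 eA]|oA].
  by exists e => // v uv; apply: eA; exact/B_distP.
apply/(edist_open_subspace (ltr0n R 4) B_dist_refl B_dist_triangle) => x.
have [u <-] : exists u, left_orbit_map P u = x.
  by case: x => y yr; have [u _ uy] := set_mem yr; exists u; apply: val_inj.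
move=> /oA[e e0 eA]; exists e => // y.
have [v <-] : exists v, left_orbit_map P v = y.
  by case: y => y yr; have [v _ vy] := set_mem yr; exists v; apply: val_inj.
by move=> uv; apply: eA; exact/B_distP.
Qed.

Lemma Ad_orbit_open (A : set (Ad_orbit P)) : open A <-> open (Ad_orbit_map P @^-1` A).
Proof.
have <- : \pi_(Ad_orbit P)%qT = Ad_orbit_map P by rewrite pi.unlock.
by [].
Qed.

Lemma left_orbit_open_pre C (A : set (left_orbit P)) : 0 <= C ->
  (forall (x : SP) r, Phi_le ip Phi (set_val x) r -> Phi_le ip Phi (set_val (P x)) (C * r)) ->
  open A -> open (left_orbit_map P @^-1` A).
Proof.
move=> C0 PC /left_orbit_openP oA; apply/U_openP => u /oA[e e0 eA].
pose d := e / (4 * C + 1).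
have D0 : 0 < 4 * C + 1 by rewrite ltr_wpDl // mulr_ge0.
have d0 : 0 < d by rewrite divr_gt0.
exists d => // v [r rd uv]; apply: eA; have r0 := Phi_le_ge0 Phi_sn uv.
exists (2 * (r * C + C * r)).
  have : r * (4 * C + 1) < e by rewrite -ltr_pdivlMr.
  lra.
move=> x x1.
have xo : opb 1 (set_val x) := Phi_le_opb ip_norm H_infinite Phi_sn x1.
have [ux uxL uxE] : exists2 z : SP, z = Lmul (adj (U_val u)) x &
    set_val z = adj (U_val u) \o set_val x by eexists; [by []|exact: Lmul_adjE].
have [vx vxL vxE] : exists2 z : SP, z = Lmul (adj (U_val v)) x &
    set_val z = adj (U_val v) \o set_val x by eexists; [by []|exact: Lmul_adjE].
have buv : bounded_op (U_val u - U_val v) by apply: bounded_sub; exact: U_bounded.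
have [y yE] : exists y : SP, set_val y = adj (U_val u - U_val v) \o set_val x.
  by exists (Lmul (adj (U_val u - U_val v)) x); apply: LmulE => //; exact: adj_bounded.
have yr : Phi_le ip Phi (set_val y) r.
  rewrite yE -[r]mulr1; apply: Phi_le_compr => //; [exact: S_bounded|exact: Phi_le_adj].
have uxr : Phi_le ip Phi (set_val ux) 1.
  rewrite uxE -[1]mulr1; apply: Phi_le_compl => //; [exact: U_adj_bounded|exact: U_adj_opb].
(* The additivity of [P] needed here is read off the blocks. *)
have Py h : set_val (P y) h = set_val (P ux) h - set_val (P vx) h.
  apply: (proj_ext ip_norm p_proj p0E) => [j fj|].
    have [bpj _ _ _] := hermitian_projectionP ip_norm ((proj1 p_proj) j fj).
    have pP z := pj_pinch ip_norm p_proj PE z h fj.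
    rewrite (bopB bpj) (pP y) (pP ux) (pP vx) yE uxE vxE -(bopB bpj) /=.
    by rewrite (adj_sub ip_norm (U_bounded u) (U_bounded v)).
  rewrite (bopB (p0_bounded ip_norm p_proj p0E)).
  have pP z := p0_pinch ip_norm p_proj p0E PE z h.
  by rewrite (pP y) (pP ux) (pP vx) subrr.
have -> : set_val (left_act P u x) - set_val (left_act P v x) =
    ((U_val u - U_val v) \o set_val (P ux)) + (U_val v \o set_val (P y)).
  apply: funext => h; rewrite -[LHS]/(set_val (left_act P u x) h - set_val (left_act P v x) h).
  rewrite (left_E u x h) (left_E v x h) -uxL -vxL -[RHS]/(U_val u (set_val (P ux) h) - U_val v (set_val (P ux) h) +
    U_val v (set_val (P y) h)).
  by rewrite Py (bopB (U_bounded v)) subrKA.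
have Pux := PC _ _ uxr; rewrite mulr1 in Pux.
apply: Phi_le_add => //.
  apply: Phi_le_compr => //; first exact: S_bounded.
  exact: Phi_le_opb Pux.
rewrite -[C * r]mul1r; apply: Phi_le_compl => //; [exact: U_bounded|exact: U_opb|exact: PC].
Qed.

(** Equivariance moves the point of [u] to [P]: u^-1 v is then [near_P], and the local section
    replaces it by some g near 1, so that u g is near u and represents the point of v. *)
Lemma left_orbit_pre_open (A : set (left_orbit P)) :
  (forall eps, 0 < eps -> exists2 d, 0 < d & forall u, near_P P d u ->
    exists2 g, left_act P g = left_act P u & Phi_le ip Phi (U_val g - id) eps) ->
  open (left_orbit_map P @^-1` A) -> open A.
Proof.
move=> loc /U_openP oA; apply/left_orbit_openP => u Au.
have [e e0 eA] := oA u Au.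
have [d d0 dP] := loc _ (divr_gt0 e0 (ltr0n _ 2)).
exists d => // v [r rd uv]; pose k := U_mul (U_inv u) v.
have kd : near_P P d k.
  apply: (near_P_scale ip_norm H_infinite Phi_sn p_proj p0E PE (ltW d0)).
  move=> x x1; have [y yE] : exists y : SP, set_val y = U_val u \o set_val x.
    by exists (Lmul (U_val u) x); apply: LmulE => //; exact: U_bounded.
  have y1 : Phi_le ip Phi (set_val y) 1.
    by rewrite yE -[1]mulr1; apply: Phi_le_compl => //; [exact: U_bounded|exact: U_opb].
  have yx : Lmul (adj (U_val u)) y = x.
    apply: S_inj; apply: etrans (Lmul_adjE ip_norm H_infinite Phi_sn u y) _.
    by rewrite yE; apply: funext => h' /=; rewrite U_adjK.
  have yx' : Lmul (adj (U_val (U_inv u))) x = y.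
    apply: S_inj; apply: etrans (Lmul_adjE ip_norm H_infinite Phi_sn (U_inv u) x) _.
    by rewrite yE U_invE (adjK ip_norm (U_bounded u)).
  move=> h; have := Phi_le_opb ip_norm H_infinite Phi_sn (uv y y1) h.
  rewrite !fctE; have -> : set_val (left_act P u y) h = U_val u (set_val (P x) h).
    by rewrite (left_E u y h) yx.
  have -> : set_val (left_act P k x) h = adj (U_val u) (set_val (left_act P v y) h).
    have := left_act_mul ip_norm H_infinite Phi_sn P (U_inv u) v x; rewrite yx' => ->.
    by rewrite /= U_invE.
  rewrite -{2}(U_adjK u (set_val (P x) h)) -(bopB (U_adj_bounded ip_norm u)).
  rewrite U_adj_norm // rdistC => /le_trans; apply.
  by rewrite ler_wpM2r ?rnorm_ge0 // ltW.
have [g gk ge] := dP _ kd.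
have gv : left_act P (U_mul u g) = left_act P v.
  apply: (etrans (left_act_mull ip_norm H_infinite Phi_sn u gk)).
  apply: (congr1 (fun a => left_act P a)).
  by apply: U_inj => h; rewrite !U_mulE U_invE U_Kadj.
suff Aug : A (left_orbit_map P (U_mul u g)).
  exact: (eq_ind _ A Aug _ ((left_orbit_map_eq (U_mul u g) v).2 gv)).
apply: eA; exists (e / 2); first lra.
have -> : U_val u - U_val (U_mul u g) = - (U_val u \o (U_val g - id)).
  apply: funext => h; rewrite -[LHS]/(U_val u h - U_val u (U_val g h)).
  by rewrite -[RHS]/(- (U_val u (U_val g h - h))) (bopB (U_bounded u)) opprB.
have ge' := Phi_le_compl ip_norm H_infinite Phi_sn (U_bounded u) ler01 (U_opb ip_norm u) ge.
rewrite mul1r in ge'; exact: (Phi_leN ip_norm H_infinite Phi_sn ge').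
Qed.

(** [M] is the interior of a ball, since with the factor 2 in [Phi_le_add] the ball itself is not
    known to be open. *)
Lemma exists_small_open (e : R) : 0 < e -> exists M : set UI, [/\ open M, M U_one &
  forall m, M m -> opb e (U_val m - id)].
Proof.
move=> e0.
pose M : set UI := [set m | exists2 d : R, 0 < d & forall m' : UI,
  (exists2 r, r < d & Phi_le ip Phi (U_val m - U_val m') r) ->
  exists2 r, r < e & Phi_le ip Phi (id - U_val m') r].
exists M; split.
- apply/U_openP => m [d d0 dP]; exists (d / 4); first by rewrite divr_gt0.
  move=> m' [r rd mm']; exists (d / 4); first by rewrite divr_gt0.
  move=> m'' [r' rd' mm'']; apply: dP; exists (2 * (r + r')); first lra.
  have -> : U_val m - U_val m'' = (U_val m - U_val m') + (U_val m' - U_val m'').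
    by rewrite addrA subrK.
  exact: Phi_le_add.
- by exists e.
- move=> m [d d0 dP]; have [|r re rP] := dP m.
    by exists 0 => //; rewrite subrr; exact: Phi_le0.
  apply: (@opb_widen _ _ r); first exact: ltW.
  by rewrite -opprB; apply: opbN; exact: Phi_le_opb rP.
Qed.

End Orbits.

(** * The covering map *)

Theorem theorem4p5 (R : realType) (H : completeNormedModType R[i])
    (ip : {dot H for Num.conj})
    (ip_norm : forall h : H, ip h h = `|h| ^+ 2)
    (H_separable : separable_space H)
    (H_infinite : ~ finite_dim [set: H])
    (Phi : (nat -> R) -> R) (Phi_sn : symmetric_norming Phi)
    (w : option nat) (w_ge1 : in_family w 1)
    (p : nat -> H -> H)
    (p_proj : orthogonal_projections ip w p)
    (p0E : complement_projection w p)
    (P : S_Phi ip Phi -> S_Phi ip Phi)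
    (PE : is_pinching w p P)
    (not_compact : S_Phi ip Phi <> compact_op ->
      exists m : nat, w = Some m /\
        exists! i : nat, (i <= m)%N /\ infinite_rank (p i)) :
  exists Pi : left_orbit P -> Ad_orbit P,
    (forall u : U_I ip Phi, Pi (left_orbit_map P u) = Ad_orbit_map P u) /\
    covering_map Pi.
Proof.
have [M [M0 Mb cases]] := ideal_cases ip_norm H_infinite Phi_sn p_proj p0E w_ge1 not_compact.
pose c u := diag_part ip_norm H_infinite Phi_sn p P u.
(* [K] converts operator norm bounds on u c - 1: either all compact operators admit such a bound, or
   u c - 1 has rank at most k + k. *)
have [K K0 KP] : exists2 K : R, 0 <= K & forall u (d : R), 0 <= d ->
    opb d ((U_val u \o c u) - id) -> Phi_le ip Phi ((U_val u \o c u) - id) (K * d).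
  case: cases => [nM|[i0 [k [i0P pk]]]].
    exists M; first exact: ltW.
    move=> u d d0 ud; apply: (Phi_le_compact ip_norm H_infinite Phi_sn) => //.
    by have [] := S_diag_part ip_norm H_infinite Phi_sn p_proj p0E P u.
  exists (k + k)%:R => // u d d0 ud; apply: (Phi_le_rank ip_norm H_infinite Phi_sn) => //.
  exact: (U_diag_part_finite_rank ip_norm H_infinite Phi_sn p_proj p0E PE u i0P pk).
have [C C0 CP] : exists2 C : R, 0 <= C & forall (x : S_Phi ip Phi) r,
    Phi_le ip Phi (set_val x) r -> Phi_le ip Phi (set_val (P x)) (C * r).
  case: cases => [nM|[i0 [k [i0P pk]]]].
    exists M; first exact: ltW.
    move=> x r; exact: (pinch_Phi_compact ip_norm H_infinite Phi_sn p_proj PE).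
  exists (2 * (1 + k%:R * 2)) => [|x r xr]; first by rewrite mulr_ge0 // addr_ge0 // mulr_ge0.
  rewrite (_ : _ * r = 2 * (r + k%:R * (2 * r))); last by ring.
  exact: (pinch_Phi_rank ip_norm H_infinite Phi_sn p_proj p0E PE i0P pk).
have loc := local_section p_proj p0E PE M0 Mb K0 KP.
have X_surj x : exists u, left_orbit_map P u = x.
  by case: x => y yr; have [u _ uy] := set_mem yr; exists u; apply: val_inj.
have Y_surj (y : Ad_orbit P) : exists u, Ad_orbit_map P u = y.
  by case: y => y yr; have [u _ uy] := set_mem yr; exists u; apply: eq_exist.
(* An arbitrary section of the orbit map; [left_act_Ad_act] makes [Pi] independent of it. *)
have /choice[s sP] := X_surj.
pose Pi x := Ad_orbit_map P (s x).
have PiE u : Pi (left_orbit_map P u) = Ad_orbit_map P u.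
  apply/Ad_orbit_map_eq/(left_act_Ad_act ip_norm H_infinite Phi_sn p_proj p0E PE).
  exact/left_orbit_map_eq/sP.
exists Pi; split => //.
(* Two elements within 1/4 of 1 differ by at most 1/2 < 1, as [Ad_act_left_act] requires. *)
have e4 : 0 < 4^-1 :> R by lra.
have [V [oV V1 VP]] := exists_small_open ip_norm H_infinite Phi_sn e4.
apply: (covering_quotient (U_mulA ip_norm H_infinite Phi_sn)
  (U_mul1g ip_norm H_infinite Phi_sn) (U_mulg1 ip_norm H_infinite Phi_sn)
  (U_mulVg ip_norm H_infinite Phi_sn) (U_mulgV ip_norm H_infinite Phi_sn)
  _ X_surj Y_surj _ (@Ad_orbit_open _ _ _ _ P) _ _ PiE oV V1).
- exact: U_open_mulr.
- move=> A; split; last exact: (left_orbit_pre_open ip_norm H_infinite Phi_sn p_proj p0E PE loc).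
  exact: (left_orbit_open_pre ip_norm H_infinite Phi_sn p_proj p0E PE C0 CP).
- move=> u v g /left_orbit_map_eq uv; apply/left_orbit_map_eq.
  exact: (left_act_mull ip_norm H_infinite Phi_sn g uv).
- move=> u v g /Ad_orbit_map_eq uv; apply/Ad_orbit_map_eq.
  exact: (Ad_act_mull ip_norm H_infinite Phi_sn g uv).
move=> m m' u Vm Vm' /Ad_orbit_map_eq mm'; apply/left_orbit_map_eq; move: mm'.
apply: (Ad_act_left_act ip_norm H_infinite Phi_sn p_proj p0E PE (r := 2^-1)); first lra.
move=> h; rewrite -(U_norm ip_norm u h); set h' := U_val u h.
rewrite (_ : (_ - _) h = (U_val m h' - h') - (U_val m' h' - h')).
  apply: le_trans (rnormB _ _) _.
  have := lerD (VP m Vm h') (VP m' Vm' h'); rewrite !fctE => /le_trans; apply.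
  by rewrite -mulrDl ler_wpM2r ?rnorm_ge0 //; lra.
by rewrite opprB addrA subrK.
Qed.
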